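(* For every $p\in(1,\infty)$ the following two statements hold. (c) If $\zeta(s)\neq0$ for $\Re s>1/p$, then $\|G_n-\lambda\|_r\to0$ as $n\to\infty$ for all $r\in(1,p)$. (d) If $\|G_n-\lambda\|_p\to0$ as $n\to\infty$, then $\zeta(s)\neq0$ for $\Re s\ge 1/p$.
   Context: $\zeta$ is the Riemann zeta function. $\rho(x):=x-[x]$ is the fractional part of $x$. $\chi$ is the characteristic function of $(0,1]$, and $\lambda(x):=\chi(x)\log x$ for $x>0$. $M(x):=\sum_{k\le x}\mu(k)$ where $\mu$ is the Möbius function, and $M_1(\theta):=M(1/\theta)$ for $\theta>0$ (so $M_1(\theta)=0$ for $\theta>1$). For $n\in\mathbb N$ and $x>0$, $$G_n(x):=\int_{1/n}^{\infty}M_1(\theta)\,\rho\left(\frac{\theta}{x}\right)\frac{d\theta}{\theta}.$$ $\|\cdot\|_p$ is the norm of $L_p(0,\infty)$ with Lebesgue measure. *)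

(* Defs.v *)
From HB Require Import structures.
From mathcomp Require Import all_boot all_order all_algebra.
From mathcomp Require Import complex.
From mathcomp Require Import all_classical all_reals all_analysis.

Set Implicit Arguments.
Unset Strict Implicit.
Unset Printing Implicit Defensive.

Import Order.TTheory GRing.Theory Num.Theory.
Import numFieldNormedType.Exports.

Local Open Scope classical_set_scope.
Local Open Scope ring_scope.
Local Open Scope complex_scope.

(* The topology of [R[i]] given by the norm [`|z|]. *)
#[warnings="-redundant-canonical-projection"]
HB.instance Definition _ (R : realType) := NormedModule.copy R[i] R[i]^o.

Definition cexp (R : realType) (z : R[i]) : R[i] :=
  (expR (complex.Re z) * cos (complex.Im z)) +i*
  (expR (complex.Re z) * sin (complex.Im z)).

(* [k ^ (- s)] for an integer [k >= 1]. *)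
Definition npowNC (R : realType) (k : nat) (s : R[i]) : R[i] :=
  cexp (- s * (ln (k%:R : R))%:C).

Definition analytic_at (R : realType) (f : R[i] -> R[i]) (s0 : R[i]) : Prop :=
  exists a : nat -> R[i],
    \forall s \near s0, series (fun k => a k * (s - s0) ^+ k) @ \oo --> f s.

(* The Riemann zeta function, as the analytic continuation of its Dirichlet
   series to [C \ {1}].  Since [C \ {1}] is connected, this determines
   [zeta s] for all [s != 1]; the value of [zeta] at the pole [1] is left
   arbitrary. *)
Definition is_riemann_zeta (R : realType) (zeta : R[i] -> R[i]) : Prop :=
  (forall s : R[i], 1 < complex.Re s ->
     series (fun k => npowNC k.+1 s) @ \oo --> zeta s) /\
  (forall s : R[i], s != 1 -> analytic_at zeta s).

(* [k] is squarefree iff all exponents in its prime factorization are 1. *)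
Definition mobius (k : nat) : int :=
  if all (fun q => logn q k == 1%N) (primes k)
  then (-1) ^+ size (primes k) else 0.

Section BaezDuarte.
Variable R : realType.
Implicit Types x theta : R.

Definition mertens x : R :=
  \sum_(1 <= k < (Num.truncn x).+1) (mobius k)%:~R.

Definition M1 theta : R := mertens theta^-1.

Definition rho x : R := x - (Num.floor x)%:~R.

Definition lambda x : R := \1_(`]0, 1]%classic) x * ln x.

(* Meant for [0 < n] and [0 < x]. *)
Definition G (n : nat) x : R :=
  (\int[lebesgue_measure]_(theta in `[n%:R^-1, +oo[)
     (M1 theta * rho (theta / x) / theta))%R.

(* The norm of [L_p(0, +oo)]; the value is [+oo] for functions not in L_p. *)
Definition Lp_norm (p : R) (f : R -> R) : \bar R :=
  ('N[lebesgue_measure]_p%:E[(EFin \o f) \_ `]0%R, +oo[])%E.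

End BaezDuarte.

(* Main.v *)
(* Write [mu] for the Moebius function, [M] for its summatory function, and
   [c_n = sum_(k <= n) mu k (1/k - 1/n)].  By Moebius inversion [G n - lambda]
   equals [c_n / x] on [1/n, +oo), while [|G n|] is at most
   [I n = sum_(N <= n) |M N| / N] everywhere.

   (d) Convergence in L_p forces [n c_n = o(n ^ (1/p))].  Two summations by
   parts express [sum mu k k ^ (- s)] through the numbers [n c_n], so it
   continues to [Re s > 1/p] and stays the inverse of [zeta] there; at the
   boundary line its growth is too slow for a zero of [zeta].

   (c) It suffices that [I n = O(n ^ s)] for some [s < 1/r].  If [zeta] has no
   zeros with [Re > a], the inequality of Borel and Caratheodory bounds the
   [k]-th Taylor coefficient of [1 / zeta] at [2 + i t] by
   [C R ^ (- k) (4 + |t|) ^ (1/4)] for every [R < 2 - a].  A mean square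
   inequality converts this into bounds for the partial sums of
   [mu n (ln n) ^ k / k!] in mean square; summing the exponential series over
   [k] gives the partial sums of [mu n n ^ R'] with [R' < R], hence [M] on
   average by Abel summation. *)
Require Import Defs.
From HB Require Import structures.
From mathcomp Require Import all_boot all_order all_algebra.
From mathcomp Require Import complex ring lra zify.
From mathcomp Require Import all_classical all_reals all_analysis.
From mathcomp Require Import measurable_realfun.

Set Implicit Arguments.
Unset Strict Implicit.
Unset Printing Implicit Defensive.

Import Order.TTheory GRing.Theory Num.Theory.
Import numFieldNormedType.Exports.

Local Open Scope classical_set_scope.
Local Open Scope ring_scope.
Local Open Scope complex_scope.

(** * Series of complex numbers *)

Section ComplexModulus.
Variable R : realType.
Implicit Types (z w : R[i]) (x y : R).

(** Since [I n] averages [|M N|], in (c) a mean square estimate takes the place of Perron's formula.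
    The hypothesis on zeros enters as the radius [2 - a] of Taylor discs about [2 + i t], a line on
    which all Dirichlet series involved converge absolutely. The mean square inequality is
    Plancherel's identity for [sum a n n ^ (- s) / s] on that line. Its weight [1 / |s| ^ 2] leaves
    room for any growth exponent below [1/2] in [t]; [1/4] is one such. It can be reached because
    the logarithm of [zeta] is bounded by a constant on the disc of radius [1/2] and by a multiple
    of [ln |t|] on the large disc, and only the geometrically small tail of the coefficients is
    charged to the latter. Continuation, logarithm and Fourier transform take algebraic forms:
    absolutely convergent double series with uniqueness of coefficients, power sums of the inverse
    zeros of a truncation, and sampling at roots of unity. The pole is removed by expanding
    [zf s = (s - 1) zeta s] instead of [zeta]. *)

Definition cabs z : R := ComplexField.Normc.normc z.

Lemma normC_cabs z : `|z| = (cabs z)%:C.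
Proof. by []. Qed.

Lemma cabsE z : cabs z = Num.sqrt (complex.Re z ^+ 2 + complex.Im z ^+ 2).
Proof. by case: z. Qed.

Lemma cabs_sqr z : cabs z ^+ 2 = complex.Re z ^+ 2 + complex.Im z ^+ 2.
Proof. by rewrite cabsE sqr_sqrtr // addr_ge0 // sqr_ge0. Qed.

Lemma cabs_ge0 z : 0 <= cabs z.
Proof. by rewrite cabsE sqrtr_ge0. Qed.

Lemma cabs0 : cabs 0 = 0.
Proof. exact: ComplexField.Normc.normc0. Qed.

Lemma cabs1 : cabs 1 = 1.
Proof. exact: ComplexField.Normc.normc1. Qed.

Lemma cabs_eq0 z : (cabs z == 0) = (z == 0).
Proof.
apply/eqP/eqP => [/ComplexField.Normc.eq0_normc //|->]; exact: cabs0.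
Qed.

Lemma cabs_gt0 z : (0 < cabs z) = (z != 0).
Proof. by rewrite lt_neqAle cabs_ge0 andbT eq_sym cabs_eq0. Qed.

Lemma cabsM z w : cabs (z * w) = cabs z * cabs w.
Proof. exact: ComplexField.Normc.normcM. Qed.

Lemma cabsV z : cabs z^-1 = (cabs z)^-1.
Proof. exact: ComplexField.Normc.normcV. Qed.

Lemma cabsN z : cabs (- z) = cabs z.
Proof. exact: (@normcN R). Qed.

Lemma cabsD z w : cabs (z + w) <= cabs z + cabs w.
Proof. exact: (@le_normcD R). Qed.

Lemma cabsB z w : cabs (z - w) <= cabs z + cabs w.
Proof. by rewrite -(cabsN w) cabsD. Qed.

Lemma cabs_distC z w : cabs (z - w) = cabs (w - z).
Proof. by rewrite -cabsN opprB. Qed.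

Lemma cabs_subr_ge z w : cabs z - cabs w <= cabs (z - w).
Proof. by rewrite lerBlDr -{1}(subrK w z) cabsD. Qed.

Lemma cabsX z n : cabs (z ^+ n) = cabs z ^+ n.
Proof. by elim: n => [|n IH]; rewrite ?expr0 ?cabs1 // !exprS cabsM IH. Qed.

Lemma cabs_real x : cabs x%:C = `|x|.
Proof. by rewrite cabsE /= expr0n /= addr0 sqrtr_sqr. Qed.

Lemma cabs_nat n : cabs n%:R = n%:R.
Proof.
have -> : (n%:R : R[i]) = (n%:R : R)%:C by rewrite rmorph_nat.
by rewrite cabs_real ger0_norm.
Qed.

Lemma cabs_sum (I : Type) (s : seq I) (P : pred I) (F : I -> R[i]) :
  cabs (\sum_(i <- s | P i) F i) <= \sum_(i <- s | P i) cabs (F i).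
Proof.
elim/big_rec2: _ => [|i y1 y2 _ IH]; first by rewrite cabs0.
by apply: le_trans (cabsD _ _) _; rewrite lerD2l.
Qed.

Lemma cabs_prod (I : Type) (s : seq I) (F : I -> R[i]) :
  cabs (\prod_(i <- s) F i) = \prod_(i <- s) cabs (F i).
Proof. by elim: s => [|i s IH]; rewrite ?big_nil ?cabs1 // !big_cons cabsM IH. Qed.

Lemma normr_Re_cabs z : `|complex.Re z| <= cabs z.
Proof. by rewrite cabsE -sqrtr_sqr ler_wsqrtr // lerDl sqr_ge0. Qed.

Lemma normr_Im_cabs z : `|complex.Im z| <= cabs z.
Proof. by rewrite cabsE -sqrtr_sqr ler_wsqrtr // lerDr sqr_ge0. Qed.

Lemma Re_le_cabs z : complex.Re z <= cabs z.
Proof. exact: le_trans (ler_norm _) (normr_Re_cabs _). Qed.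

Lemma cabs_le_ReIm z : cabs z <= `|complex.Re z| + `|complex.Im z|.
Proof.
rewrite cabsE -[leRHS]ger0_norm ?addr_ge0 // -sqrtr_sqr ler_wsqrtr //.
rewrite sqrrD !real_normK ?num_real // addrAC lerDl.
by rewrite mulrn_wge0 // mulr_ge0.
Qed.

Lemma cReD z w : complex.Re (z + w) = complex.Re z + complex.Re w.
Proof. by case: z; case: w. Qed.

Lemma cImD z w : complex.Im (z + w) = complex.Im z + complex.Im w.
Proof. by case: z; case: w. Qed.

Lemma cReN z : complex.Re (- z) = - complex.Re z.
Proof. by case: z. Qed.

Lemma cImN z : complex.Im (- z) = - complex.Im z.
Proof. by case: z. Qed.

Lemma cReM z w : complex.Re (z * w)
  = complex.Re z * complex.Re w - complex.Im z * complex.Im w.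
Proof. by case: z; case: w. Qed.

Lemma cImM z w : complex.Im (z * w)
  = complex.Re z * complex.Im w + complex.Im z * complex.Re w.
Proof. by case: z; case: w. Qed.

Lemma cRe_sum (I : Type) (s : seq I) (P : pred I) (F : I -> R[i]) :
  complex.Re (\sum_(i <- s | P i) F i) = \sum_(i <- s | P i) complex.Re (F i).
Proof. by elim/big_rec2: _ => // i y1 y2 _ <-; rewrite cReD. Qed.

Lemma cIm_sum (I : Type) (s : seq I) (P : pred I) (F : I -> R[i]) :
  complex.Im (\sum_(i <- s | P i) F i) = \sum_(i <- s | P i) complex.Im (F i).
Proof. by elim/big_rec2: _ => // i y1 y2 _ <-; rewrite cImD. Qed.

End ComplexModulus.
Arguments cabs {R} z : simpl never.

Section ComplexSeries.
Variable R : realType.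
Implicit Types (u v : nat -> R) (a b : nat -> R[i]) (l : R[i]) (e : R).

Definition ctends a l := forall e, 0 < e ->
  exists N, forall n, (N <= n)%N -> cabs (a n - l) < e.

Definition hasS a l := ctends (fun n => \sum_(k < n) a k) l.

(** Convergence of a series with nonnegative terms, recorded as a bound because bounds are easy to
    transport; [abs_hasS] turns it into a sum. *)
Definition bsum u := exists U, forall n, \sum_(k < n) u k <= U.

Definition conv a b n := \sum_(i < n.+1) a i * b (n - i)%N.

Lemma ctends_le a l U : ctends a l -> (forall n, cabs (a n) <= U) -> cabs l <= U.
Proof.
move=> al aU; rewrite leNgt; apply/negP => Ul.
rewrite -subr_gt0 in Ul; have [N /(_ N (leqnn N)) h] := al _ Ul.
have := cabs_subr_ge l (a N); rewrite cabs_distC => h2.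
have := aU N; lra.
Qed.

Lemma ctends_unique a l l' : ctends a l -> ctends a l' -> l = l'.
Proof.
move=> al al'; apply/eqP; rewrite -subr_eq0 -cabs_eq0 eq_le cabs_ge0 andbT.
rewrite leNgt; apply/negP => h; have h2 : 0 < cabs (l - l') / 2 by rewrite divr_gt0.
have [N hN] := al _ h2; have [N' hN'] := al' _ h2.
have := hN _ (leq_maxl N N'); have := hN' _ (leq_maxr N N').
set n := maxn N N'; move=> h3 h4.
have : cabs (l - l') <= cabs (a n - l') + cabs (a n - l).
  rewrite (_ : l - l' = (a n - l') - (a n - l)) ?cabsB //; ring.
lra.
Qed.

Lemma ctends_cst l : ctends (fun=> l) l.
Proof. by move=> e e0; exists 0%N => n _; rewrite subrr cabs0. Qed.

Lemma ctends_eventually a b l N :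
  (forall n, (N <= n)%N -> a n = b n) -> ctends a l -> ctends b l.
Proof.
move=> ab al e /al[N' h]; exists (maxn N N') => n; rewrite geq_max => /andP[h1 h2].
by rewrite -ab // h.
Qed.

Lemma ctends_ext a b l : a =1 b -> ctends a l -> ctends b l.
Proof. by move=> ab; apply: (@ctends_eventually _ _ _ 0%N) => n _. Qed.

Lemma ctendsD a b l l' : ctends a l -> ctends b l' ->
  ctends (fun n => a n + b n) (l + l').
Proof.
move=> al bl e e0; have h2 : 0 < e / 2 by rewrite divr_gt0.
have [N hN] := al _ h2; have [N' hN'] := bl _ h2.
exists (maxn N N') => n; rewrite geq_max => /andP[/hN h3 /hN' h4].
rewrite opprD addrACA; apply: le_lt_trans (cabsD _ _) _; lra.
Qed.

Lemma ctendsZ c a l : ctends a l -> ctends (fun n => c * a n) (c * l).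
Proof.
move=> al e e0; have h2 : 0 < e / (1 + cabs c).
  by rewrite divr_gt0 // ltr_pwDl // cabs_ge0.
have [N hN] := al _ h2; exists N => n /hN; rewrite -mulrBr cabsM.
rewrite ltr_pdivlMr ?ltr_pwDl ?cabs_ge0 //.
have := cabs_ge0 (a n - l); have := cabs_ge0 c; nra.
Qed.

Lemma ctendsN a l : ctends a l -> ctends (fun n => - a n) (- l).
Proof.
move=> /(@ctendsZ (-1)); rewrite mulN1r; apply: ctends_ext => n.
by rewrite mulN1r.
Qed.

Lemma ctends_bounded a l : ctends a l -> exists2 U, 0 < U & forall n, cabs (a n) <= U.
Proof.
move=> /(_ 1 ltr01)[N hN]; exists (1 + cabs l + \sum_(k < N) cabs (a k)).
  have := cabs_ge0 l; have : 0 <= \sum_(k < N) cabs (a k).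
    by apply: sumr_ge0 => i _; exact: cabs_ge0.
  lra.
move=> n; case: (leqP N n) => [/hN h|h].
  have : 0 <= \sum_(k < N) cabs (a k) by apply: sumr_ge0 => i _; exact: cabs_ge0.
  have := cabs_subr_ge (a n) l; lra.
rewrite (bigD1 (Ordinal h)) //=.
have : 0 <= \sum_(i < N | i != Ordinal h) cabs (a i).
  by apply: sumr_ge0 => i _; exact: cabs_ge0.
have := cabs_ge0 l; lra.
Qed.

Lemma ctendsM a b l l' : ctends a l -> ctends b l' ->
  ctends (fun n => a n * b n) (l * l').
Proof.
move=> al bl; have [U U0 hU] := ctends_bounded al.
have h1 : ctends (fun n => a n * (b n - l')) 0.
  move=> e e0; have /bl[N hN] : 0 < e / U by rewrite divr_gt0.
  exists N => n /hN; rewrite subr0 cabsM ltr_pdivlMr //.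
  move=> h; apply: le_lt_trans h; rewrite mulrC ler_wpM2l ?cabs_ge0 //.
have := ctendsD h1 (ctendsZ l' al); rewrite add0r mulrC.
by apply: ctends_ext => n; ring.
Qed.

Lemma ctends_shift a l m : ctends a l -> ctends (fun n => a (n + m)%N) l.
Proof.
move=> al e /al[N h]; exists N => n hn; apply: h; exact: leq_trans (leq_addr _ _).
Qed.

Lemma ctends_cauchy a :
  (forall e, 0 < e -> exists N, forall n, (N <= n)%N -> cabs (a n - a N) < e) ->
  exists l, ctends a l.
Proof.
move=> ac.
have key (f : R[i] -> R) : (forall z w, f (z - w) = f z - f w) ->
    (forall z, `|f z| <= cabs z) ->
    exists l : R, forall e, 0 < e -> exists N, forall n, (N <= n)%N ->
      `|f (a n) - l| < e.
  move=> fB fc.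
  have /cauchy_cvgP/cvg_ex[/= l hl] : cauchy ((f \o a) @ \oo).
    apply: cauchy_exP => e e0; have [N hN] := ac _ e0.
    exists (f (a N)); exists N => // n /= hn.
    by rewrite /ball /= distrC -fB; apply: le_lt_trans (fc _) _; exact: hN.
  exists l => e e0; move/cvgrPdist_lt : hl => /(_ e e0)[N _ hN].
  by exists N => n hn; rewrite distrC; exact: hN.
have [x hx] := key (@complex.Re R) (fun z w => etrans (cReD _ _) (congr1 _ (cReN _)))
  (@normr_Re_cabs R).
have [y hy] := key (@complex.Im R) (fun z w => etrans (cImD _ _) (congr1 _ (cImN _)))
  (@normr_Im_cabs R).
exists (x +i* y) => e e0; have h2 : 0 < e / 2 by rewrite divr_gt0.
have [N hN] := hx _ h2; have [N' hN'] := hy _ h2.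
exists (maxn N N') => n; rewrite geq_max => /andP[/hN h3 /hN' h4].
apply: le_lt_trans (cabs_le_ReIm _) _; rewrite cReD cImD cReN cImN /=; lra.
Qed.

Lemma psum_split (V : nmodType) (f : nat -> V) m n : (m <= n)%N ->
  \sum_(k < n) f k = \sum_(k < m) f k + \sum_(m <= k < n) f k.
Proof. by move=> mn; rewrite -!(big_mkord xpredT f) (big_cat_nat (leq0n m) mn). Qed.

Lemma psum_mono u m n : (forall k, 0 <= u k) -> (m <= n)%N ->
  \sum_(k < m) u k <= \sum_(k < n) u k.
Proof. by move=> u0 mn; rewrite (psum_split u mn) lerDl sumr_ge0. Qed.

Lemma bsum_tail u : (forall k, 0 <= u k) -> bsum u -> forall e, 0 < e ->
  exists N, forall m n, (N <= m)%N -> \sum_(m <= k < n) u k < e.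
Proof.
move=> u0 [U hU] e e0.
pose E := [set x | exists n, x = \sum_(k < n) u k].
have supE : has_sup E.
  by split; [exists (\sum_(k < 0) u k); exists 0%N | exists U => _ [n ->]].
have [_ [N ->] hN] := sup_adherent e0 supE.
exists N => m n Nm; case: (leqP m n) => [mn|/ltnW nm]; last by rewrite big_geq.
have h1 : \sum_(k < n) u k <= sup E by apply: ub_le_sup; [case: supE|exists n].
have := psum_mono u0 Nm; rewrite (psum_split u mn) in h1; lra.
Qed.

Lemma bsum_le u v : (forall k, u k <= v k) -> bsum v -> bsum u.
Proof.
by move=> uv [U hU]; exists U => n; apply: le_trans (hU n); exact: ler_sum.
Qed.

Lemma bsumZ c u : 0 <= c -> bsum u -> bsum (fun k => c * u k).
Proof.
move=> c0 [U hU]; exists (c * U) => n; rewrite -mulr_sumr; exact: ler_wpM2l.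
Qed.

Lemma abs_hasS a : bsum (fun k => cabs (a k)) -> exists l, hasS a l.
Proof.
move=> ha; apply: ctends_cauchy => e e0.
have [N hN] := bsum_tail (fun k => cabs_ge0 (a k)) ha e0.
exists N => n Nn; rewrite (psum_split a Nn) addrAC subrr add0r.
by apply: le_lt_trans (cabs_sum _ _ _) _; exact: hN.
Qed.

Lemma hasS_le a l U : hasS a l -> (forall n, \sum_(k < n) cabs (a k) <= U) ->
  cabs l <= U.
Proof.
move=> al aU; apply: ctends_le al _ => n.
exact: le_trans (cabs_sum _ _ _) (aU n).
Qed.

Lemma hasS_tail a l U N : hasS a l ->
  (forall n, \sum_(N <= k < n) cabs (a k) <= U) ->
  cabs (l - \sum_(k < N) a k) <= U.
Proof.
move=> al aU; apply: (@ctends_le (fun n => \sum_(k < n + N) a k - \sum_(k < N) a k)).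
  apply: ctendsD; first exact: (@ctends_shift (fun n => \sum_(k < n) a k)).
  exact: ctends_cst.
move=> n; rewrite (psum_split a (leq_addl n N)) addrAC subrr add0r.
by apply: le_trans (cabs_sum _ _ _) _; exact: aU.
Qed.

Lemma hasS_unique a l l' : hasS a l -> hasS a l' -> l = l'.
Proof. exact: ctends_unique. Qed.

Lemma hasS_ext a b l : a =1 b -> hasS a l -> hasS b l.
Proof. by move=> ab; apply: ctends_ext => n; apply: eq_bigr => k _. Qed.

Lemma hasSD a b l l' : hasS a l -> hasS b l' -> hasS (fun n => a n + b n) (l + l').
Proof.
by move=> al bl; apply: ctends_ext (ctendsD al bl) => n; rewrite big_split.
Qed.

Lemma hasSZ c a l : hasS a l -> hasS (fun n => c * a n) (c * l).
Proof.
by move=> al; apply: ctends_ext (ctendsZ c al) => n; rewrite mulr_sumr.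
Qed.

Lemma hasS_fin a N : (forall k, (N <= k)%N -> a k = 0) -> hasS a (\sum_(k < N) a k).
Proof.
move=> a0; apply: (ctends_eventually (N := N)) (ctends_cst _) => n Nn.
rewrite (psum_split a Nn) [X in _ + X]big_nat_cond [X in _ + X]big1 ?addr0 // => k.
by rewrite andbT => /andP[/a0].
Qed.

(** Dominated convergence for series: through [u], one index [N] makes the tails of all the [F K]
    and of [G] small, and the finitely many remaining terms converge. *)
Lemma tannery (F : nat -> nat -> R[i]) (G : nat -> R[i]) u (S : nat -> R[i]) :
  bsum u -> (forall K n, cabs (F K n) <= u n) ->
  (forall n, ctends (fun K => F K n) (G n)) ->
  (forall K, hasS (F K) (S K)) ->
  exists2 T, hasS G T & ctends S T.
Proof.
move=> ub Fu FG FS.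
have u0 k : 0 <= u k by exact: le_trans (cabs_ge0 _) (Fu 0%N k).
have Gu n : cabs (G n) <= u n by exact: ctends_le (FG n) _.
have [T GT] : exists T, hasS G T by apply: abs_hasS; exact: bsum_le ub.
exists T => // e e0; have h2 : 0 < e / 4 by rewrite divr_gt0.
have [N hN] := bsum_tail u0 ub h2.
have hF K : cabs (S K - \sum_(k < N) F K k) <= e / 4.
  apply: hasS_tail (FS K) _ => n; apply: le_trans (ltW (hN N n (leqnn N))).
  by apply: ler_sum => k _.
have hG : cabs (T - \sum_(k < N) G k) <= e / 4.
  apply: hasS_tail GT _ => n; apply: le_trans (ltW (hN N n (leqnn N))).
  by apply: ler_sum => k _.
have : ctends (fun K => \sum_(k < N) F K k) (\sum_(k < N) G k).
  elim: {hN hF hG} N => [|N IH].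
    by rewrite big_ord0; apply: ctends_ext (ctends_cst 0) => K; rewrite big_ord0.
  rewrite big_ord_recr; apply: ctends_ext (ctendsD IH (FG N)) => K.
  by rewrite big_ord_recr.
move=> /(_ _ h2)[K0 hK0]; exists K0 => K /hK0 hK.
rewrite (_ : S K - T = (S K - \sum_(k < N) F K k) +
  (\sum_(k < N) F K k - \sum_(k < N) G k) - (T - \sum_(k < N) G k)); last by ring.
apply: le_lt_trans (cabsB _ _) _.
have := cabsD (S K - \sum_(k < N) F K k) (\sum_(k < N) F K k - \sum_(k < N) G k).
have := hF K; lra.
Qed.

End ComplexSeries.

(** * Cauchy products *)

Section CauchyProduct.
Variable R : realType.

Lemma conv_triangle (V : nzRingType) (a b : nat -> V) n :
  \sum_(k < n) \sum_(i < k.+1) a i * b (k - i)%N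
  = \sum_(i < n) a i * \sum_(j < n - i) b j.
Proof.
elim: n => [|n IH]; first by rewrite !big_ord0.
rewrite big_ord_recr /= IH [RHS]big_ord_recr /= subSn // subnn big_ord1.
rewrite big_ord_recr /= subnn addrA; congr (_ + _).
rewrite -big_split; apply: eq_bigr => i _ /=.
by rewrite subSn ?(ltnW (ltn_ord i)) // big_ord_recr /= mulrDr.
Qed.

Lemma conv_le (u v : nat -> R) n : (forall k, 0 <= u k) -> (forall k, 0 <= v k) ->
  \sum_(k < n) \sum_(i < k.+1) u i * v (k - i)%N
  <= (\sum_(k < n) u k) * (\sum_(k < n) v k).
Proof.
move=> u0 v0; rewrite conv_triangle mulr_suml; apply: ler_sum => i _.
apply: ler_wpM2l => //; exact/psum_mono/leq_subr.
Qed.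

(** The square of side [n] is contained in the triangle of side [2 n]. *)
Lemma conv_ge (u v : nat -> R) n : (forall k, 0 <= u k) -> (forall k, 0 <= v k) ->
  (\sum_(k < n) u k) * (\sum_(k < n) v k) <=
  \sum_(k < n + n) \sum_(i < k.+1) u i * v (k - i)%N.
Proof.
move=> u0 v0; rewrite conv_triangle mulr_suml big_split_ord /=.
rewrite -[leLHS]addr0; apply: lerD.
  apply: ler_sum => i _; apply: ler_wpM2l => //; apply: psum_mono => //.
  by rewrite -addnBA ?leq_addr // ltnW.
by apply: sumr_ge0 => i _; rewrite mulr_ge0 // sumr_ge0.
Qed.

Lemma cabs_conv (a b : nat -> R[i]) n :
  cabs (conv a b n) <= \sum_(i < n.+1) cabs (a i) * cabs (b (n - i)%N).
Proof.
by apply: le_trans (cabs_sum _ _ _) _; apply: ler_sum => i _; rewrite cabsM.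
Qed.

Lemma conv_bsum_le (a b : nat -> R[i]) (U V : R) :
  (forall n, \sum_(k < n) cabs (a k) <= U) ->
  (forall n, \sum_(k < n) cabs (b k) <= V) ->
  forall n, \sum_(k < n) cabs (conv a b k) <= U * V.
Proof.
move=> aU bV n.
have /le_trans -> // : \sum_(k < n) cabs (conv a b k) <=
    \sum_(k < n) \sum_(i < k.+1) cabs (a i) * cabs (b (k - i)%N).
  by apply: ler_sum => k _; exact: cabs_conv.
apply: le_trans (conv_le n (fun k => cabs_ge0 (a k)) (fun k => cabs_ge0 (b k))) _.
by apply: ler_pM => //; apply: sumr_ge0 => k _; exact: cabs_ge0.
Qed.

Lemma conv_defect (a b : nat -> R[i]) n :
  cabs ((\sum_(k < n) a k) * (\sum_(k < n) b k) - \sum_(k < n) conv a b k) <=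
  (\sum_(k < n) cabs (a k)) * (\sum_(k < n) cabs (b k)) -
   \sum_(k < n) \sum_(i < k.+1) cabs (a i) * cabs (b (k - i)%N).
Proof.
rewrite /conv conv_triangle (conv_triangle (fun k => cabs (a k)) (fun k => cabs (b k))) !mulr_suml -!sumrB.
apply: le_trans (cabs_sum _ _ _) _; apply: ler_sum => i _.
rewrite -!mulrBr cabsM; apply: ler_wpM2l; first exact: cabs_ge0.
rewrite (psum_split b (leq_subr i n)) addrAC subrr add0r.
rewrite (psum_split (fun k => cabs (b k)) (leq_subr i n)) addrAC subrr add0r.
exact: cabs_sum.
Qed.

(** The difference between square and triangle is dominated by the same difference for the moduli,
    which [conv_ge] bounds by the block from [n] to [2 n] of the convergent series of the [c k]. *)
Lemma cauchy_prod (a b : nat -> R[i]) (l l' : R[i]) :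
  bsum (fun k => cabs (a k)) -> bsum (fun k => cabs (b k)) ->
  hasS a l -> hasS b l' -> hasS (conv a b) (l * l').
Proof.
move=> [U aU] [V bV] al bl.
pose c k := \sum_(i < k.+1) cabs (a i) * cabs (b (k - i)%N).
have c0 k : 0 <= c k by apply: sumr_ge0 => i _; rewrite mulr_ge0 ?cabs_ge0.
have cb : bsum c.
  exists (U * V) => n.
  apply: le_trans (conv_le n (fun k => cabs_ge0 (a k)) (fun k => cabs_ge0 (b k))) _.
  by apply: ler_pM => //; apply: sumr_ge0 => k _; exact: cabs_ge0.
have d0 : ctends (fun n => (\sum_(k < n) a k) * (\sum_(k < n) b k) -
    \sum_(k < n) conv a b k) 0.
  move=> e /(bsum_tail c0 cb)[N hN]; exists N => n Nn; rewrite subr0.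
  apply: le_lt_trans (conv_defect a b n) _.
  have := conv_ge n (fun k => cabs_ge0 (a k)) (fun k => cabs_ge0 (b k)).
  have := psum_split c (leq_addr n n); rewrite /c => -> h.
  have := hN n (n + n)%N Nn; rewrite /c; lra.
have := ctendsD (ctendsM al bl) (ctendsN d0); rewrite oppr0 addr0.
by apply: ctends_ext => n; ring.
Qed.

End CauchyProduct.

(** * The complex exponential and power series *)

Section ComplexExponential.
Variable R : realType.
Implicit Types (z w : R[i]) (x y u : R).

Lemma ctends_ReIm (a : nat -> R[i]) x y :
  (fun n => complex.Re (a n)) @ \oo --> x -> (fun n => complex.Im (a n)) @ \oo --> y ->
  ctends a (x +i* y).
Proof.
move=> ax ay e e0; have h2 : 0 < e / 2 by rewrite divr_gt0.
move/cvgrPdist_lt : ax => /(_ _ h2)[N _ hN].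
move/cvgrPdist_lt : ay => /(_ _ h2)[N' _ hN'].
exists (maxn N N') => n; rewrite geq_max => /andP[/hN + /hN'] /=.
rewrite distrC [X in _ -> X < _ -> _]distrC => h3 h4.
apply: le_lt_trans (cabs_le_ReIm _) _; rewrite cReD cImD cReN cImN /=; lra.
Qed.

Lemma cexp0 : cexp 0 = 1 :> R[i].
Proof. by rewrite /cexp /= expR0 cos0 sin0 mulr1 mulr0. Qed.

Lemma cexpD z w : cexp (z + w) = cexp z * cexp w.
Proof.
apply/eqP; rewrite eq_complex cReM cImM /cexp /= cReD cImD expRD cosD sinD.
by apply/andP; split; apply/eqP; ring.
Qed.

Lemma cabs_cexp z : cabs (cexp z) = expR (complex.Re z).
Proof.
rewrite cabsE /cexp /= !exprMn -mulrDr cos2Dsin2 mulr1 sqrtr_sqr.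
by rewrite ger0_norm // expR_ge0.
Qed.

Lemma cexp_real x : cexp x%:C = (expR x)%:C.
Proof. by rewrite /cexp /= cos0 sin0 mulr1 mulr0. Qed.

Lemma cexpMn z n : cexp (z * n%:R) = cexp z ^+ n.
Proof.
elim: n => [|n IH]; first by rewrite mulr0 cexp0.
by rewrite -addn1 natrD mulrDr mulr1 cexpD IH exprD expr1.
Qed.

Lemma expR_psum_le x n : 0 <= x -> \sum_(k < n) x ^+ k / k`!%:R <= expR x.
Proof.
move=> x0; rewrite /expR -[X in X <= _](big_mkord xpredT (fun k => x ^+ k / k`!%:R)).
apply: nondecreasing_cvgn_le (is_cvg_series_exp_coeff x) n.
by apply/nondecreasing_seqP => m; rewrite /series /= big_nat_recr //= lerDl exp_coeff_ge0.
Qed.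

Lemma cabs_expcoef z k : cabs (z ^+ k / k`!%:R) = cabs z ^+ k / k`!%:R.
Proof. by rewrite cabsM cabsV cabsX cabs_nat. Qed.

Lemma expcoef_psum_le z n : \sum_(k < n) cabs (z ^+ k / k`!%:R) <= expR (cabs z).
Proof.
under eq_bigr do rewrite cabs_expcoef.
by apply: expR_psum_le; exact: cabs_ge0.
Qed.

Lemma hasS_cexp_real x : hasS (fun k => x%:C ^+ k / k`!%:R) (expR x)%:C.
Proof.
have hC k : x%:C ^+ k / k`!%:R = (x ^+ k / k`!%:R)%:C.
  by rewrite rmorphM rmorphXn fmorphV rmorph_nat.
apply: ctends_ReIm.
  have := @is_cvg_series_exp_coeff R x; apply: cvg_trans.
  rewrite (_ : (fun _ => _) = series (exp_coeff x)) //.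
  apply/funext => n; rewrite cRe_sum /series /= big_mkord.
  by apply: eq_bigr => k _; rewrite hC.
rewrite (_ : (fun _ => _) = cst 0); first exact: cvg_cst.
by apply/funext => n; rewrite cIm_sum big1 // => k _; rewrite hC.
Qed.

Lemma hasS_cexp_imag y : hasS (fun k => (0 +i* y) ^+ k / k`!%:R) (cos y +i* sin y).
Proof.
have hE m : (0 +i* y : R[i]) ^+ m.*2 = ((-1) ^+ m * y ^+ m.*2)%:C.
  rewrite -muln2 mulnC exprM (_ : (0 +i* y) ^+ 2 = (- y ^+ 2)%:C).
    by rewrite -rmorphXn /= [in LHS]exprNn -exprM.
  by apply/eqP; rewrite eq_complex [_ ^+ 2]expr2 cReM cImM /=; apply/andP; split; apply/eqP; ring.
have hO m : (0 +i* y : R[i]) ^+ m.*2.+1 = 0 +i* ((-1) ^+ m * y ^+ m.*2.+1).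
  by rewrite exprSr hE; apply/eqP; rewrite eq_complex cReM cImM /=;
     apply/andP; split; apply/eqP; rewrite ?exprS; ring.
have hk k : (0 +i* y : R[i]) ^+ k / k`!%:R = cos_coeff y k +i* sin_coeff y k.
  rewrite -(rmorph_nat (real_complex R)) -fmorphV.
  rewrite -(odd_double_half k); move: (odd k) k./2 => -[] m /=.
    rewrite add1n hO cos_coeff_odd -sin_coeff'E /sin_coeff' -exprnP.
    by apply/eqP; rewrite eq_complex cReM cImM /=; apply/andP; split; apply/eqP; ring.
  rewrite add0n hE sin_coeff_even -cos_coeff'E /cos_coeff' -exprnP.
  by apply/eqP; rewrite eq_complex cReM cImM /=; apply/andP; split; apply/eqP; ring.
apply: ctends_ReIm.
  have h : series (cos_coeff y) @ \oo --> cos y.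
    by rewrite unlock; exact: is_cvg_series_cos_coeff.
  rewrite (_ : (fun _ => _) = series (cos_coeff y)); first exact: h.
  apply/funext => n; rewrite cRe_sum /series /= big_mkord.
  by apply: eq_bigr => k _; rewrite hk.
have h : series (sin_coeff y) @ \oo --> sin y.
    by rewrite unlock; exact: is_cvg_series_sin_coeff.
rewrite (_ : (fun _ => _) = series (sin_coeff y)); first exact: h.
apply/funext => n; rewrite cIm_sum /series /= big_mkord.
by apply: eq_bigr => k _; rewrite hk.
Qed.

(** [cexp] is built from real functions; its series is the Cauchy product of those of [expR x] and
    [cos y + i sin y], rearranged by the binomial theorem. *)
Lemma hasS_cexp z : hasS (fun k => z ^+ k / k`!%:R) (cexp z).
Proof.
case: z => x y.
have -> : cexp (x +i* y) = (expR x)%:C * (cos y +i* sin y).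
  by apply/eqP; rewrite eq_complex cReM cImM /cexp /=; apply/andP; split; apply/eqP; ring.
have b w : bsum (fun k => cabs (w ^+ k / k`!%:R)).
  by exists (expR (cabs w)) => n; exact: expcoef_psum_le.
have := cauchy_prod (b _) (b _) (hasS_cexp_real x) (hasS_cexp_imag y).
apply: hasS_ext => n; rewrite /conv.
have -> : x +i* y = x%:C + (0 +i* y).
  by apply/eqP; rewrite eq_complex /=; apply/andP; split; apply/eqP; ring.
rewrite addrC exprDn mulr_suml; apply: eq_bigr => i _.
rewrite -mulr_natr -(bin_fact (_ : i <= n)%N) ?ltnS -1?ltnS //.
have fn0 m : (m`!%:R : R[i]) != 0 by rewrite pnatr_eq0 -lt0n fact_gt0.
have cn0 : ('C(n, i)%:R : R[i]) != 0 by rewrite pnatr_eq0 -lt0n bin_gt0 -ltnS.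
rewrite !natrM; field.
by rewrite !fn0 cn0.
Qed.

Lemma cexp_lt_pi2 x : 0 < x < pi *+ 2 -> cexp (0 +i* x) != 1.
Proof.
move=> /andP[x0 x2]; apply/negP => /eqP/(congr1 (@complex.Re R)) /=.
rewrite expR0 mul1r => h.
have s0 : 0 < sin (x / 2).
  apply: sin_gt0_pi; rewrite divr_gt0 //= ltr_pdivrMr // mulr_natr //.
have : cos x = 1 - sin (x / 2) ^+ 2 *+ 2.
  rewrite -[in LHS](@divfK _ 2 _ x) // mulr_natr cos_mulr2n cos2sin2; ring.
rewrite h => /eqP; rewrite -subr_eq0 => /eqP; nra.
Qed.

End ComplexExponential.

Lemma psum_shift (V : nmodType) (f : nat -> V) m n :
  \sum_(m <= k < n + m) f k = \sum_(j < n) f (j + m)%N.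
Proof. by rewrite -{1}[m]add0n big_addn addnK big_mkord. Qed.

(** * Power series: bounds, uniqueness, products *)

Section PowerSeries.
Variable R : realType.
Implicit Types (a b : nat -> R[i]) (z w l : R[i]) (rho x : R).

Definition ps_abs a rho := bsum (fun k => cabs (a k) * rho ^+ k).

Definition ps_sum a z l := hasS (fun k => a k * z ^+ k) l.

Lemma ps_abs_le a rho z : ps_abs a rho -> cabs z <= rho ->
  bsum (fun k => cabs (a k * z ^+ k)).
Proof.
move=> ab zr; apply: bsum_le ab => k.
rewrite cabsM cabsX ler_wpM2l ?cabs_ge0 // lerXn2r ?nnegrE ?cabs_ge0 //.
exact: le_trans (cabs_ge0 z) zr.
Qed.

Lemma ps_abs_leR a rho rho' : 0 <= rho' <= rho -> ps_abs a rho -> ps_abs a rho'.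
Proof.
move=> /andP[h0 h]; apply: bsum_le => k.
by rewrite ler_wpM2l ?cabs_ge0 // lerXn2r ?nnegrE // (le_trans h0).
Qed.

Lemma ps_abs_ex a rho z : ps_abs a rho -> cabs z <= rho -> exists l, ps_sum a z l.
Proof. by move=> ab zr; apply: abs_hasS; exact: ps_abs_le zr. Qed.

Lemma ps_abs_of_cvg a z l rho : ps_sum a z l -> 0 <= rho < cabs z -> ps_abs a rho.
Proof.
move=> az /andP[r0 rz]; have z0 : 0 < cabs z by exact: le_lt_trans rz.
have [U U0 hU] := ctends_bounded az.
have hk k : cabs (a k) * cabs z ^+ k <= 2 * U.
  have -> : cabs (a k) * cabs z ^+ k =
      cabs (\sum_(i < k.+1) a i * z ^+ i - \sum_(i < k) a i * z ^+ i).
    by rewrite big_ord_recr /= addrAC subrr add0r cabsM cabsX.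
  have := cabsB (\sum_(i < k.+1) a i * z ^+ i) (\sum_(i < k) a i * z ^+ i).
  have := hU k.+1; have := hU k; lra.
pose q := rho / cabs z.
have q01 : 0 <= q < 1 by rewrite divr_ge0 ?(ltW z0) // ltr_pdivrMr ?mul1r.
have : bsum (fun k => 2 * U * q ^+ k).
  apply: bsumZ; first by rewrite mulr_ge0 // ltW.
  exists (1 - q)^-1 => n; case/andP: q01 => q0 q1.
  rewrite -[leRHS]mul1r ler_pdivlMr ?subr_gt0 //.
  have := @subrXX R 1 q n; rewrite expr1n.
  under eq_bigr do rewrite expr1n mul1r.
  move=> h; rewrite mulrC -h; have := exprn_ge0 n q0; lra.
apply: bsum_le => k; rewrite /q expr_div_n mulrA ler_pdivlMr ?exprn_gt0 //.
by rewrite mulrAC ler_wpM2r ?exprn_ge0.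
Qed.

(** All terms from index 1 on contain a factor [z]. This serves as the Lipschitz estimate at the
    centre of a disc. *)
Lemma ps_cst_dist a rho U z l : (forall n, \sum_(k < n) cabs (a k) * rho ^+ k <= U) ->
  0 < rho -> cabs z <= rho -> ps_sum a z l -> cabs (l - a 0%N) <= cabs z * (U / rho).
Proof.
move=> aU r0 zr al.
have := @hasS_tail _ _ _ (cabs z * (U / rho)) 1 al.
rewrite big_ord1 expr0 mulr1; apply => n.
rewrite mulrA ler_pdivlMr // mulr_suml.
case: n => [|n]; first by rewrite big_geq // mulr_ge0 ?cabs_ge0 //;
  apply: le_trans (aU 0%N); rewrite big_ord0.
apply: (@le_trans _ _ (cabs z * \sum_(1 <= k < n.+1) cabs (a k) * rho ^+ k)).
  rewrite mulr_sumr; apply: ler_sum_nat => -[//|k] _.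
  rewrite cabsM cabsX !exprS.
  have : cabs z ^+ k <= rho ^+ k by rewrite lerXn2r ?nnegrE ?cabs_ge0 // ltW.
  move=> h; rewrite (_ : _ * rho = cabs (a k.+1) * cabs z * rho * cabs z ^+ k); last by ring.
  rewrite [leRHS](_ : _ = cabs (a k.+1) * cabs z * rho * rho ^+ k); last by ring.
  by apply: ler_wpM2l => //; rewrite !mulr_ge0 ?cabs_ge0 // ltW.
rewrite ler_wpM2l ?cabs_ge0 //; apply: le_trans (aU n.+1).
rewrite -(big_mkord xpredT (fun k => cabs (a k) * rho ^+ k)).
by rewrite [leRHS]big_nat_recl // big_add1 lerDr mulr_ge0 ?cabs_ge0 // exprn_ge0 // ltW.
Qed.

(** Once the coefficients below [k] vanish, division by [x ^ k] leaves a series with constant term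
    [a k] and sum 0, and [ps_cst_dist] gives [|a k| = O(x)] as [x] decreases to 0 along the
    reals. *)
Lemma ps_uniq0 a d : 0 < d -> (forall x, 0 < x < d -> ps_sum a x%:C 0) ->
  forall k, a k = 0.
Proof.
move=> d0 ha k; elim/ltn_ind : k => k IH.
pose rho := d / 4; have r0 : 0 < rho by rewrite divr_gt0.
have hd2 : 0 < d / 2 < d by lra.
have ab : ps_abs a rho.
  apply: ps_abs_of_cvg (ha _ hd2) _; rewrite cabs_real gtr0_norm; rewrite /rho; lra.
pose b j := a (k + j)%N.
have hb n x : 0 < x -> \sum_(j < n) b j * x%:C ^+ j =
    x%:C ^- k * \sum_(j < n + k) a j * x%:C ^+ j.
  move=> x0; rewrite (psum_split (fun j => a j * x%:C ^+ j) (leq_addl n k)).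
  rewrite [X in _ * (X + _)]big1 ?add0r => [|j _]; last by rewrite IH ?mul0r.
  rewrite psum_shift mulr_sumr; apply: eq_bigr => j _.
  rewrite /b exprD addnC; have : x%:C ^+ k != 0 by rewrite expf_neq0 // eq_complex /= gt_eqF.
  by move=> h; field.
have [U hU] : ps_abs b rho.
  case: ab => U hU; exists (U / rho ^+ k) => n.
  rewrite ler_pdivlMr ?exprn_gt0 // mulr_suml.
  apply: le_trans (hU (n + k)%N).
  rewrite (psum_split (fun j => cabs (a j) * rho ^+ j) (leq_addl n k)) psum_shift.
  rewrite -[leLHS]add0r lerD //.
    by apply: sumr_ge0 => j _; rewrite mulr_ge0 ?cabs_ge0 // exprn_ge0 // ltW.
  by apply: ler_sum => j _; rewrite /b exprD addnC mulrA.
have key x : 0 < x <= rho -> cabs (a k) <= x * (U / rho).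
  move=> /andP[x0 xr].
  have hx : ps_sum b x%:C 0.
    have xd : 0 < x < d by rewrite /rho in xr; lra.
    have := ctendsZ (x%:C ^- k) (ctends_shift k (ha x xd)); rewrite mulr0.
    by apply: ctends_ext => n; rewrite hb.
  have := ps_cst_dist hU r0 _ hx; rewrite cabs_real gtr0_norm // => /(_ xr).
  by rewrite /b addn0 sub0r cabsN.
apply/eqP; rewrite -cabs_eq0 eq_le cabs_ge0 andbT leNgt; apply/negP => ak.
have U0 : 0 <= U by apply: le_trans (hU 0%N); rewrite big_ord0.
have V0 : 0 < U / rho + 1 by rewrite ltr_wpDl // divr_ge0 // ltW.
pose x := Num.min rho (cabs (a k) / (U / rho + 1) / 2).
have x0 : 0 < x by rewrite lt_min r0 !divr_gt0.
have : x <= cabs (a k) / (U / rho + 1) / 2 by rewrite ge_min lexx orbT.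
have /key : 0 < x <= rho by rewrite x0 ge_min lexx.
rewrite -mulrA -invfM ler_pdivlMr ?mulr_gt0 //.
have : 0 <= U / rho by rewrite divr_ge0 // ltW.
nra.
Qed.

Lemma ps_uniq a b d (F : R -> R[i]) : 0 < d ->
  (forall x, 0 < x < d -> ps_sum a x%:C (F x)) ->
  (forall x, 0 < x < d -> ps_sum b x%:C (F x)) -> a =1 b.
Proof.
move=> d0 ha hb k; apply/eqP; rewrite -subr_eq0; apply/eqP.
apply: (@ps_uniq0 (fun k => a k - b k) d d0) => x xd.
have := hasSD (ha x xd) (hasSZ (-1) (hb x xd)); rewrite mulN1r subrr.
by apply: hasS_ext => j; ring.
Qed.

Lemma ps_mul a b z l l' rho : ps_abs a rho -> ps_abs b rho -> cabs z <= rho ->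
  ps_sum a z l -> ps_sum b z l' -> ps_sum (conv a b) z (l * l').
Proof.
move=> ha hb zr al bl.
have := cauchy_prod (ps_abs_le ha zr) (ps_abs_le hb zr) al bl.
apply: hasS_ext => n; rewrite /conv mulr_suml; apply: eq_bigr => i _.
rewrite -[in z ^+ n](subnKC (_ : i <= n)%N) -1?ltnS // exprD; ring.
Qed.

End PowerSeries.

(** * Double series and Dirichlet series *)

Section AnalyticLine.
Variable R : realType.
Implicit Types (z w l s : R[i]) (rho x : R).

Lemma cvg_ctends (u : nat -> R[i]) l : u @ \oo --> l -> ctends u l.
Proof.
move/cvgrPdist_lt => h e e0; have e0' : (0 : R[i]) < e%:C by rewrite ltcR.
have [N _ hN] := h _ e0'; exists N => n /hN /=.
by rewrite distrC normC_cabs ltcR.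
Qed.

Lemma series_hasS (u : nat -> R[i]) l : series u @ \oo --> l -> hasS u l.
Proof.
by move=> /cvg_ctends; apply: ctends_ext => n; rewrite /series /= big_mkord.
Qed.

Lemma analytic_ps (f : R[i] -> R[i]) s0 : analytic_at f s0 ->
  exists (a : nat -> R[i]) (d : R), 0 < d /\
    forall s, cabs (s - s0) < d -> ps_sum a (s - s0) (f s).
Proof.
move=> [a /nbhs_ballP[e /= e0 he]]; exists a, (complex.Re e).
have ee : e = (complex.Re e)%:C by rewrite RRe_real // gtr0_real.
split; first by rewrite -ltcR -ee.
move=> s hs; apply: series_hasS; apply: he.
by rewrite /ball /= distrC normC_cabs ee ltcR.
Qed.

Lemma analytic_lip (f : R[i] -> R[i]) s0 : analytic_at f s0 ->
  exists (K d : R), 0 < d /\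
    forall s, cabs (s - s0) < d -> cabs (f s - f s0) <= K * cabs (s - s0).
Proof.
move=> /analytic_ps[a [d [d0 hd]]].
have h0 : ps_sum a 0 (f s0) by rewrite -(subrr s0); apply: hd; rewrite subrr cabs0.
have a0 : a 0%N = f s0.
  apply: hasS_unique h0; rewrite -[a 0%N](_ : \sum_(k < 1) a k * 0 ^+ k = _); last first.
    by rewrite big_ord1 expr0 mulr1.
  by apply: hasS_fin => -[//|k] _; rewrite expr0n mulr0.
have [U hU] : ps_abs a (d / 4).
  apply: (@ps_abs_of_cvg _ a (d / 2)%:C (f (s0 + (d / 2)%:C))).
    by have := hd (s0 + (d / 2)%:C); rewrite addrAC subrr add0r cabs_real gtr0_norm; [apply; lra|lra].
  by rewrite cabs_real gtr0_norm; lra.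
exists (U / (d / 4)), (d / 4); split; first lra.
move=> s hs; rewrite mulrC -a0; apply: (@ps_cst_dist _ a _ U); [by []|lra|lra|].
by apply: hd; lra.
Qed.

Definition line_analytic (h : R -> R[i]) x0 := exists (a : nat -> R[i]) (d : R),
  0 < d /\ forall x, `|x - x0| < d -> ps_sum a (x - x0)%:C (h x).

(** Let [m] be the infimum of the [y >= x1] beyond which [h] vanishes. The expansion at [m] is 0 on
    the right of [m], so its coefficients vanish and [h] is 0 on both sides; then either [m = x1]
    and [h x1 = 0], or [m] could be lowered. *)
Lemma identity_line (h : R -> R[i]) :
  (forall x, 0 < x -> line_analytic h x) -> (forall x, 1 < x -> h x = 0) ->
  forall x, 0 < x -> h x = 0.
Proof.
move=> ha h1 x1 x10; apply/eqP; apply/negPn/negP => hx1.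
have x11 : x1 <= 1 by rewrite leNgt; apply/negP => /h1 /eqP; exact/negP.
pose E := [set y | x1 <= y /\ forall t, y < t -> h t = 0].
have infE : has_inf E by split; [exists 1|exists x1 => y []].
pose m := inf E.
have mx1 : x1 <= m by apply: lb_le_inf; [case: infE|move=> y []].
have hm t : m < t -> h t = 0.
  move=> mt; have [y [_ hy] yt] := inf_lt (proj1 infE) mt; exact: hy.
have [a [d [d0 hd]]] := ha m (lt_le_trans x10 mx1).
have a0 : forall k, a k = 0.
  apply: (@ps_uniq0 _ a d d0) => x /andP[x0 xd].
  by have := hd (m + x); rewrite addrAC subrr add0r hm ?ltrDl // gtr0_norm //; exact.
have hd0 x : `|x - m| < d -> h x = 0.
  move=> /hd hx; apply: hasS_unique hx _.
  have := @hasS_fin R (fun k => a k * (x - m)%:C ^+ k) 0.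
  rewrite big_ord0; apply => k _; by rewrite a0 mul0r.
have mm : m != x1 by apply/negP => /eqP mE; move: hx1; rewrite hd0 ?eqxx // mE subrr normr0.
have x1m : x1 < m by rewrite lt_neqAle eq_sym mm.
have : E (Num.max x1 (m - d / 2)).
  split; first by rewrite le_max lexx.
  move=> t; rewrite gt_max => /andP[_ mt].
  case: (ltP m t) => [/hm //|tm]; apply: hd0; rewrite ler0_norm; lra.
move/(ge_inf (proj2 infE)); rewrite le_max -/m => /orP[|]; lra.
Qed.

End AnalyticLine.

Section DoubleSeries.
Variable R : realType.
Implicit Types (z w l s : R[i]) (rho x : R).

Lemma hasS_sumf (f : nat -> nat -> R[i]) (L : nat -> R[i]) K :
  (forall k, (k < K)%N -> hasS (f k) (L k)) ->
  hasS (fun n => \sum_(k < K) f k n) (\sum_(k < K) L k).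
Proof.
elim: K => [|K IH] h.
  have := @hasS_fin R (fun=> 0) 0; rewrite !big_ord0 => /(_ (fun _ _ => erefl)).
  by apply: hasS_ext => n; rewrite big_ord0.
rewrite big_ord_recr /=.
apply: hasS_ext (hasSD (IH (fun k hk => h k (ltnW hk))) (h K (ltnSn K))) => n.
by rewrite big_ord_recr.
Qed.

(* Weierstrass' double series theorem. *)
Lemma ps_double (c : nat -> nat -> R[i]) (u : nat -> R) rho :
  0 < rho -> bsum u -> (forall n m, \sum_(k < m) cabs (c n k) * rho ^+ k <= u n) ->
  exists A : nat -> R[i], [/\ ps_abs A rho,
    forall k, hasS (fun n => c n k) (A k) &
    forall z (g : nat -> R[i]), cabs z <= rho ->
      (forall n, ps_sum (c n) z (g n)) ->
      exists2 G, hasS g G & ps_sum A z G].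
Proof.
move=> r0 ub cu.
have u0 n : 0 <= u n by apply: le_trans (cu n 0%N); rewrite big_ord0.
have cn n k : cabs (c n k) * rho ^+ k <= u n.
  apply: le_trans (cu n k.+1); rewrite big_ord_recr /= lerDr.
  by apply: sumr_ge0 => j _; rewrite mulr_ge0 ?cabs_ge0 // exprn_ge0 // ltW.
have /choice[A hA] : forall k, exists l, hasS (fun n => c n k) l.
  move=> k; apply: abs_hasS; apply: (@bsum_le _ _ (fun n => (rho ^+ k)^-1 * u n)).
    by move=> n; rewrite mulrC ler_pdivlMr ?exprn_gt0.
  by apply: bsumZ => //; rewrite invr_ge0 exprn_ge0 // ltW.
exists A; split => //; last first.
  move=> z g zr hg.
  have hz k : cabs z ^+ k <= rho ^+ k by rewrite lerXn2r ?nnegrE ?cabs_ge0 // ltW.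
  have [||||T gT ST] := @tannery R (fun K n => \sum_(k < K) c n k * z ^+ k) g u
      (fun K => \sum_(k < K) A k * z ^+ k).
  - exact: ub.
  - move=> K n; apply: le_trans (cabs_sum _ _ _) _; apply: le_trans (cu n K).
    by apply: ler_sum => k _; rewrite cabsM cabsX ler_wpM2l ?cabs_ge0.
  - by move=> n; exact: hg.
  - move=> K.
    apply: (hasS_sumf (f := fun k n => c n k * z ^+ k) (L := fun k => A k * z ^+ k)) => k _.
    by rewrite mulrC; apply: hasS_ext (hasSZ (z ^+ k) (hA k)) => n; rewrite mulrC.
  by exists T.
(* The terms with [n < N] contribute at most [U]; each of the [m] columns has a tail below
   [1 / (m + 1)], which accounts for the extra 1. *)
have [U hU] := ub; exists (U + 1) => m.
have e0 : 0 < (m.+1%:R)^-1 :> R by rewrite invr_gt0.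
have [N hN] := bsum_tail u0 ub e0.
apply: (@le_trans _ _ (\sum_(k < m) (cabs (\sum_(n < N) c n k) * rho ^+ k + m.+1%:R^-1))).
  apply: ler_sum => k _; rewrite -lerBlDl -mulrBl.
  apply: (@le_trans _ _ (cabs (A k - \sum_(n < N) c n k) * rho ^+ k)).
    by rewrite ler_wpM2r ?cabs_subr_ge // exprn_ge0 // ltW.
  rewrite -ler_pdivlMr ?exprn_gt0 //; apply: hasS_tail (hA k) _ => n.
  rewrite ler_pdivlMr ?exprn_gt0 // mulr_suml.
  apply: le_trans (ltW (hN N n (leqnn N))); exact: ler_sum.
rewrite big_split /=; apply: lerD.
  apply: le_trans (hU N).
  apply: (@le_trans _ _ (\sum_(k < m) \sum_(n < N) cabs (c n k) * rho ^+ k)).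
    apply: ler_sum => k _; rewrite -mulr_suml ler_wpM2r ?cabs_sum //.
    by rewrite exprn_ge0 // ltW.
  by rewrite exchange_big /=; apply: ler_sum => n _; exact: cu.
by rewrite sumr_const card_ord -[leLHS]mulr_natr ler_pdivrMl // mulr1 ler_nat.
Qed.

End DoubleSeries.

(** * Taylor coefficients of powers and of their first order remainders *)

Section Exponentials.
Variable R : realType.
Implicit Types (z w : R[i]) (rho x u h : R).

(** The coefficients of [exp ((w - z) u)] in [z]. The sign makes [z] a displacement of [s] when [w]
    is [- s] or [1 - s]. *)
Definition ecoef u w k : R[i] := cexp (w * u%:C) * ((- u)^+ k / k`!%:R)%:C.

Lemma ecoef_sum u w z : ps_sum (ecoef u w) z (cexp ((w - z) * u%:C)).
Proof.
rewrite mulrBl cexpD -mulNr.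
apply: hasS_ext (hasSZ (cexp (w * u%:C)) (hasS_cexp (- z * u%:C))) => k.
rewrite /ecoef rmorphM rmorphXn fmorphV rmorph_nat rmorphN.
by rewrite mulNr -mulrN exprMn /=; ring.
Qed.

Lemma exp_tail x N n : 0 <= x -> \sum_(N <= k < n) x ^+ k / k`!%:R <= x ^+ N * expR x.
Proof.
move=> x0; case: (leqP N n) => [Nn|/ltnW nN]; last first.
  by rewrite big_geq // mulr_ge0 ?exprn_ge0 // expR_ge0.
rewrite -[n](subnK Nn) psum_shift.
apply: le_trans (ler_wpM2l (exprn_ge0 N x0) (expR_psum_le (n - N) x0)).
rewrite mulr_sumr; apply: ler_sum => j _.
rewrite exprD -mulrA mulrCA ler_wpM2l ?exprn_ge0 //.
rewrite ler_wpM2l ?exprn_ge0 // lef_pV2 ?posrE ?ltr0n ?fact_gt0 // ler_nat.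
by apply: leq_fact; rewrite leq_addr.
Qed.

Lemma cexp_rem z N : cabs (cexp z - \sum_(k < N) z ^+ k / k`!%:R) <= cabs z ^+ N * expR (cabs z).
Proof.
apply: hasS_tail (hasS_cexp z) _ => n.
under eq_bigr do rewrite cabs_expcoef.
by apply: exp_tail; exact: cabs_ge0.
Qed.

Lemma cexp_rem1 z : cabs (cexp z - 1) <= cabs z * expR (cabs z).
Proof. by have := cexp_rem z 1; rewrite big_ord1 expr0 fact0 divr1 expr1. Qed.

Lemma cexp_rem2 z : cabs (cexp z - 1 - z) <= cabs z ^+ 2 * expR (cabs z).
Proof.
have := cexp_rem z 2; rewrite big_ord_recr big_ord1 /= expr0 fact0 divr1 expr1 divr1.
by rewrite opprD addrA.
Qed.

(** For [|z| > 1] the trivial bound replaces Taylor's formula. Exponential growth is thus confined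
    to the real part, and bounds on vertical strips stay polynomial in [t]. *)
Lemma cexp_rem2_Re z B : complex.Re z <= B ->
  cabs (cexp z - 1 - z) <= cabs z ^+ 2 * (expR B + expR 1 + 2).
Proof.
move=> zB; have eB := expR_ge0 B; have e1 := expR_ge0 (1 : R); have z0 := cabs_ge0 z.
case: (leP (cabs z) 1) => z1.
  apply: le_trans (cexp_rem2 z) _; rewrite ler_wpM2l ?exprn_ge0 //.
  have : expR (cabs z) <= expR 1 by rewrite ler_expR.
  lra.
apply: le_trans (cabsB _ _) _; have := cabsB (cexp z) 1; rewrite cabs1 cabs_cexp.
have : expR (complex.Re z) <= expR B by rewrite ler_expR.
move=> h1 h2; rewrite expr2.
have q1 : 1 <= cabs z * cabs z by nra.
have q2 : cabs z <= cabs z * cabs z by nra.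
have q3 : expR B <= cabs z * cabs z * (expR B + expR 1) by nra.
lra.
Qed.

Lemma ecoef_psum u w rho n : 0 <= rho ->
  \sum_(k < n) cabs (ecoef u w k) * rho ^+ k <= expR (complex.Re w * u + rho * `|u|).
Proof.
move=> r0; rewrite expRD.
have := expR_psum_le n (mulr_ge0 r0 (normr_ge0 u)).
move=> /(ler_wpM2l (expR_ge0 (complex.Re w * u))) => /(le_trans _); apply.
rewrite mulr_sumr le_eqVlt; apply/orP; left; apply/eqP; apply: eq_bigr => k _.
rewrite /ecoef cabsM cabs_cexp cabs_real normrM normfV normr_nat normrX normrN.
by rewrite cReM /= mulr0 subr0 exprMn; ring.
Qed.

Lemma ln1D_bounds h : - 2^-1 <= h -> h - 2 * h ^+ 2 <= ln (1 + h) <= h.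
Proof.
move=> hh; have h0 : 0 < 1 + h by lra.
apply/andP; split; last first.
  by rewrite -ler_expR lnK ?posrE // expR_ge1Dx.
have : - ln (1 + h) <= (1 + h)^-1 - 1.
  rewrite -lnV ?posrE // -ler_expR lnK ?posrE ?invr_gt0 //.
  by have := expR_ge1Dx ((1 + h)^-1 - 1); rewrite addrCA subrr addr0.
have : (1 + h)^-1 - 1 <= - h + 2 * h ^+ 2.
  rewrite lerBlDr -[leLHS]mul1r ler_pdivrMr // expr2; nra.
lra.
Qed.

Lemma ln1D_dist h : - 2^-1 <= h <= 1 -> `|ln (1 + h) - h| <= 2 * h ^+ 2.
Proof. by move=> /andP[/ln1D_bounds/andP[h1 h2] _]; rewrite ler0_norm; lra. Qed.

Lemma ln1D_norm h : - 2^-1 <= h <= 1 -> `|ln (1 + h)| <= 3 * `|h|.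
Proof.
move=> hh; have := ln1D_dist hh.
have : `|h| <= 1 by rewrite ler_norml; lra.
have := ler_normB (ln (1 + h) - h) (- h); rewrite opprK subrK normrN.
rewrite -(real_normK (num_real h)); have := normr_ge0 h; nra.
Qed.

Definition Ecoef h w k : R[i] :=
  ecoef (ln (1 + h)) w k - ((k == 0%N)%:R * (1 + w * h%:C) - (k == 1%N)%:R * h%:C).

Lemma Ecoef_sum h w z : ps_sum (Ecoef h w) z
  (cexp ((w - z) * (ln (1 + h))%:C) - 1 - (w - z) * h%:C).
Proof.
pose c (k : nat) : R[i] := (k == 0%N)%:R * (1 + w * h%:C) - (k == 1%N)%:R * h%:C.
have hc : ps_sum c z (1 + (w - z) * h%:C).
  have -> : 1 + (w - z) * h%:C = \sum_(k < 2) c k * z ^+ k.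
    by rewrite big_ord_recr big_ord1 /c /=; ring.
  by apply: hasS_fin => -[|[|k]] //= _; rewrite /c /=; ring.
rewrite -addrA -opprD.
have := hasSD (ecoef_sum (ln (1 + h)) w z) (hasSZ (-1) hc); rewrite mulN1r.
by apply: hasS_ext => k; rewrite /Ecoef /c; ring.
Qed.

Definition Econst w rho : R := let W := cabs w in
  9 * W ^+ 2 * expR (3 * W) + 2 * W + rho * (9 * W * expR (3 * W) + 2) +
  9 * rho ^+ 2 * expR (3 * rho) * expR (3 * W).

(** Every coefficient is [O(h ^ 2)]: for [k = 0] and [k = 1] because the linear part was subtracted
    and [ln (1 + h) - h = O(h ^ 2)], for [k >= 2] because [ln (1 + h) ^ k] is a factor. The three
    cases give the three summands of [Econst]. *)
Lemma Ecoef_psum h w rho n : 0 <= rho -> - 2^-1 <= h <= 1 ->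
  \sum_(k < n) cabs (Ecoef h w k) * rho ^+ k <= h ^+ 2 * Econst w rho.
Proof.
move=> r0 hh; set u := ln (1 + h); set W := cabs w.
have hu := ln1D_norm hh; have hd := ln1D_dist hh; rewrite -/u in hu hd.
have h1 : `|h| <= 1 by rewrite ler_norml; lra.
have u3 : `|u| <= 3 by lra.
have W0 : 0 <= W := cabs_ge0 w.
have uu : u ^+ 2 <= 9 * h ^+ 2.
  rewrite -(real_normK (num_real h)) -(real_normK (num_real u)).
  have := normr_ge0 h; have := normr_ge0 u; nra.
have eW : expR (cabs (w * u%:C)) <= expR (3 * W).
  by rewrite ler_expR cabsM cabs_real -/W mulrC ler_wpM2r.
have eW0 := expR_ge0 (3 * W).
have b0 : cabs (Ecoef h w 0) <= h ^+ 2 * (9 * W ^+ 2 * expR (3 * W) + 2 * W).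
  have -> : Ecoef h w 0 = (cexp (w * u%:C) - 1 - w * u%:C) + w * (u - h)%:C.
    by rewrite /Ecoef /ecoef /= expr0 fact0 divr1 -/u rmorphB /=; ring.
  apply: le_trans (cabsD _ _) _; rewrite [leRHS]mulrDr; apply: lerD.
    apply: le_trans (cexp_rem2 _) _.
    apply: (@le_trans _ _ (W ^+ 2 * u ^+ 2 * expR (3 * W))).
      rewrite {1}cabsM cabs_real -/W exprMn real_normK ?num_real //.
      by rewrite ler_wpM2l // mulr_ge0 ?sqr_ge0.
    rewrite mulrA; apply: ler_wpM2r => //; have := sqr_ge0 W; nra.
  by rewrite cabsM cabs_real -/W; nra.
have b1 : cabs (Ecoef h w 1) <= h ^+ 2 * (9 * W * expR (3 * W) + 2).
  have -> : Ecoef h w 1 = - (u%:C * (cexp (w * u%:C) - 1) + (u - h)%:C).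
    by rewrite /Ecoef /ecoef /= expr1 divr1 -/u rmorphB rmorphN /=; ring.
  rewrite cabsN; apply: le_trans (cabsD _ _) _; rewrite [leRHS]mulrDr; apply: lerD.
    rewrite cabsM cabs_real.
    apply: (@le_trans _ _ (`|u| * (W * `|u| * expR (3 * W)))).
      rewrite ler_wpM2l //; apply: le_trans (cexp_rem1 _) _.
      by rewrite {1}cabsM cabs_real -/W ler_wpM2l // mulr_ge0.
    rewrite [leLHS](_ : _ = u ^+ 2 * (W * expR (3 * W))); last first.
      by rewrite -(real_normK (num_real u)); ring.
    rewrite (_ : h ^+ 2 * _ = 9 * h ^+ 2 * (W * expR (3 * W))); last by ring.
    by apply: ler_wpM2r; rewrite ?mulr_ge0.
  by rewrite cabs_real mulrC.
have b2 m : \sum_(2 <= k < m) cabs (Ecoef h w k) * rho ^+ k <=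
    h ^+ 2 * (9 * rho ^+ 2 * expR (3 * rho) * expR (3 * W)).
  have ru : 0 <= rho * `|u| by rewrite mulr_ge0.
  apply: (@le_trans _ _ (\sum_(2 <= k < m) expR (3 * W) * ((rho * `|u|) ^+ k / k`!%:R))).
    apply: ler_sum_nat => -[//|[//|k]] _; rewrite /Ecoef /= !mul0r subrr subr0.
    rewrite /ecoef cabsM cabs_cexp cabs_real normrM normfV normr_nat normrX normrN -/u.
    rewrite exprMn -[leLHS]mulrA; apply: ler_pM => //; rewrite ?expR_ge0 //.
    - by rewrite mulr_ge0 ?exprn_ge0 // divr_ge0 ?exprn_ge0.
    - by apply: le_trans eW; rewrite ler_expR; exact: Re_le_cabs.
    - by rewrite le_eqVlt; apply/orP; left; apply/eqP; ring.
  rewrite -mulr_sumr; apply: (@le_trans _ _ (expR (3 * W) * ((rho * `|u|) ^+ 2 * expR (3 * rho)))).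
    apply: ler_wpM2l => //; apply: le_trans (exp_tail _ _ ru) _.
    by rewrite ler_wpM2l ?exprn_ge0 // ler_expR mulrC ler_wpM2r.
  rewrite exprMn real_normK ?num_real //.
  rewrite [leLHS](_ : _ = u ^+ 2 * (rho ^+ 2 * expR (3 * rho) * expR (3 * W))); last by ring.
  rewrite [leRHS](_ : _ = 9 * h ^+ 2 * (rho ^+ 2 * expR (3 * rho) * expR (3 * W))); last by ring.
  by apply: ler_wpM2r => //; rewrite !mulr_ge0 ?sqr_ge0 ?expR_ge0.
have : \sum_(k < n) cabs (Ecoef h w k) * rho ^+ k <=
  \sum_(k < n.+2) cabs (Ecoef h w k) * rho ^+ k.
  by apply: (psum_mono (u := fun k => cabs (Ecoef h w k) * rho ^+ k)) => [k|]; rewrite ?mulr_ge0 ?cabs_ge0 ?exprn_ge0 // ltnW.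
move/le_trans; apply.
rewrite (@psum_split _ (fun k => cabs (Ecoef h w k) * rho ^+ k) 2 n.+2) //.
rewrite big_ord_recr big_ord1 /= expr0 mulr1 expr1 /Econst -/W.
have := b2 n.+2; have : cabs (Ecoef h w 1) * rho <= h ^+ 2 * (9 * W * expR (3 * W) + 2) * rho.
  by rewrite ler_wpM2r.
lra.
Qed.

(** By [cexp_rem2_Re] the dependence on [w] is quadratic once [Re w] is bounded, whereas [Econst] is
    exponential in [|w|]: [Econst] serves convergence, this bound serves growth. *)
Lemma E_bound h w B : - 2^-1 <= h <= 1 -> `|complex.Re w| <= B ->
  cabs (cexp (w * (ln (1 + h))%:C) - 1 - w * h%:C) <=
  h ^+ 2 * ((1 + cabs w) ^+ 2 * (9 * (expR (3 * B) + expR 1 + 2) + 2)).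
Proof.
move=> hh wB; set u := ln (1 + h); set W := cabs w.
have hu := ln1D_norm hh; have hd := ln1D_dist hh; rewrite -/u in hu hd.
have h1 : `|h| <= 1 by rewrite ler_norml; lra.
have W0 : 0 <= W := cabs_ge0 w.
have uu : u ^+ 2 <= 9 * h ^+ 2.
  rewrite -(real_normK (num_real h)) -(real_normK (num_real u)).
  have := normr_ge0 h; have := normr_ge0 u; nra.
have -> : cexp (w * u%:C) - 1 - w * h%:C = (cexp (w * u%:C) - 1 - w * u%:C) + w * (u - h)%:C.
  by rewrite rmorphB /=; ring.
have hB : complex.Re (w * u%:C) <= 3 * B.
  rewrite cReM /= mulr0 subr0; apply: le_trans (ler_norm _) _; rewrite normrM.
  have := normr_ge0 u; have := normr_ge0 (complex.Re w); nra.
set K := expR (3 * B) + expR 1 + 2.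
have K0 : 0 <= K by rewrite !addr_ge0 ?expR_ge0.
apply: le_trans (cabsD _ _) _.
apply: (@le_trans _ _ (W ^+ 2 * (9 * h ^+ 2) * K + W * (2 * h ^+ 2))).
  apply: lerD.
    apply: le_trans (cexp_rem2_Re hB) _; rewrite -/K; apply: ler_wpM2r => //.
    rewrite cabsM cabs_real -/W exprMn real_normK ?num_real //.
    by rewrite ler_wpM2l ?sqr_ge0.
  by rewrite cabsM cabs_real -/W ler_wpM2l.
have h2 := sqr_ge0 h; rewrite [leLHS](_ : _ = h ^+ 2 * (W ^+ 2 * (9 * K) + W * 2)); last by ring.
by apply: ler_wpM2l => //; nra.
Qed.

End Exponentials.

(** * The zeta series at real exponents *)

Section ZetaSums.
Variable R : realType.
Implicit Types (s x : R).

Lemma powR_nat n s : (n.+1%:R : R) `^ s = expR (s * ln n.+1%:R).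
Proof. by rewrite /powR pnatr_eq0. Qed.

(** The comparison of [x ^ (- s)] with its integral, in telescoping form; it follows from
    [1 / (n + 2) <= ln (n + 2) - ln (n + 1)] and [1 + y <= exp y]. *)
Lemma zeta_step n s : 1 < s ->
  (s - 1) * n.+2%:R `^ (- s) <= n.+1%:R `^ (1 - s) - (n.+2%:R : R) `^ (1 - s).
Proof.
move=> s1; rewrite !powR_nat.
have n1 : 0 < (n.+1%:R : R) by [].
have n2 : 0 < (n.+2%:R : R) by [].
have hl : (n.+2%:R : R)^-1 <= ln n.+2%:R - ln n.+1%:R.
  rewrite -ln_div ?posrE // -[ln _]opprK -lnV ?posrE ?divr_gt0 // invf_div.
  rewrite lerNr -ler_expR lnK ?posrE ?divr_gt0 //.
  apply: le_trans (expR_ge1Dx _); rewrite le_eqVlt; apply/orP; left; apply/eqP.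
  have n2E : n.+2%:R = n.+1%:R + 1 :> R by rewrite natr1.
  rewrite n2E; move: n1; set a := n.+1%:R => a0; field.
  by rewrite gt_eqF // addr_gt0.
have -> : expR ((1 - s) * ln n.+1%:R) =
   expR ((1 - s) * ln n.+2%:R) * expR ((s - 1) * (ln n.+2%:R - ln n.+1%:R)).
  by rewrite -expRD; congr expR; ring.
have -> : expR (- s * ln n.+2%:R) = expR ((1 - s) * ln n.+2%:R) * n.+2%:R^-1 :> R.
  rewrite mulrBl mul1r expRB lnK ?posrE // mulNr expRN.
  by rewrite mulrAC divff ?mul1r // gt_eqF.
have h := expR_ge1Dx ((s - 1) * (ln n.+2%:R - ln n.+1%:R)).
have e0 := expR_gt0 ((1 - s) * ln (n.+2%:R : R)).
rewrite -[X in _ <= _ - X]mulr1 -mulrBr mulrCA ler_pM2l //.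
have : (s - 1) * n.+2%:R^-1 <= (s - 1) * (ln n.+2%:R - ln n.+1%:R).
  by rewrite ler_wpM2l // subr_ge0 ltW.
by move=> h3; rewrite lerBrDl; apply: le_trans h; rewrite lerD2l.
Qed.

Lemma zeta_psum s m : 1 < s -> \sum_(n < m) (n.+1%:R : R) `^ (- s) <= 1 + (s - 1)^-1.
Proof.
move=> s1; have s10 : 0 < s - 1 by rewrite subr_gt0.
case: m => [|m]; first by rewrite big_ord0 addr_ge0 // invr_ge0 ltW.
rewrite big_ord_recl /= powR1 lerD2l -[leRHS]mul1r ler_pdivlMr // mulrC mulr_sumr.
apply: (@le_trans _ _ (1 - m.+1%:R `^ (1 - s))); last by rewrite gerBl powR_ge0.
elim: m => [|m IH]; first by rewrite big_ord0 powR1 subrr.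
rewrite big_ord_recr /=; have := zeta_step m s1; lra.
Qed.

Lemma bsum_zeta s : 1 < s -> bsum (fun n => (n.+1%:R : R) `^ (- s)).
Proof. by move=> s1; exists (1 + (s - 1)^-1) => n; exact: zeta_psum. Qed.

End ZetaSums.

(** * Moebius inversion *)

Section Moebius.
Local Open Scope nat_scope.

Lemma mobius_logn_gt1 p d : 0 < d -> prime p -> 1 < logn p d -> mobius d = 0%R.
Proof.
move=> d0 pp h; rewrite /mobius; case: allP => // H.
have : p \in primes d.
  by rewrite mem_primes pp d0 /= -(@expn1 p) (pfactor_dvdn 1 pp d0) ltnW.
by move/H => /eqP hl; rewrite hl in h.
Qed.

Lemma mobius_mul_prime p d : prime p -> 0 < d -> ~~ (p %| d) ->
  mobius (p * d) = (- mobius d)%R.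
Proof.
move=> pp d0 pd; have p0 := prime_gt0 pp.
have pnp : p \notin primes d by rewrite mem_primes pp d0.
have hper : perm_eq (primes (p * d)) (p :: primes d).
  apply: uniq_perm; first exact: primes_uniq.
    by rewrite /= pnp primes_uniq.
  by move=> q; rewrite primesM // primes_prime // !inE.
rewrite /mobius (perm_size hper) (perm_all _ hper) /=.
have -> : logn p (p * d) == 1.
  by rewrite lognM // logn_prime // eqxx (@lognE p d) (negbTE pd) !andbF.
rewrite /=; have -> : all (fun q => logn q (p * d) == 1) (primes d)
    = all (fun q => logn q d == 1) (primes d).
  apply: eq_in_all => q hq; rewrite lognM // logn_prime //.
  by case: (eqVneq q p) => // qp; rewrite qp (negbTE pnp) in hq.
by case: all; rewrite ?oppr0 // exprS mulN1r.
Qed.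

(** For a prime [p] dividing [k], the divisors divisible by [p ^ 2] contribute 0, and [d] cancels
    [p d] for [d] prime to [p]. *)
Lemma sum_mobius k : 0 < k ->
  (\sum_(d <- divisors k) mobius d = (k == 1%N)%:R)%R.
Proof.
move=> k0; have [k1|k1|->] := ltngtP k 1; first by case: k k0 k1.
  pose p := pdiv k; have pp : prime p by apply: pdiv_prime.
  have pk : p %| k by exact: pdiv_dvd.
  have p0 := prime_gt0 pp.
  have div0 d : d %| k -> 0 < d by move=> /dvdn_gt0 -> .
  rewrite (bigID (fun d => p %| d)) /= (bigID (fun d => 1 < logn p d)) /=.
  rewrite big_seq_cond big1 ?add0r; last first.
    move=> d; rewrite -dvdn_divisors // => /and3P[/div0 d0 _].
    exact: mobius_logn_gt1.
  rewrite -big_filter.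
  have hper : perm_eq [seq d <- divisors k | (p %| d) && ~~ (1 < logn p d)]
      [seq p * d | d <- divisors k & ~~ (p %| d)].
    apply: uniq_perm; first by rewrite filter_uniq // divisors_uniq.
      rewrite map_inj_uniq ?filter_uniq ?divisors_uniq // => x y /eqP.
      by rewrite eqn_pmul2l // => /eqP.
    move=> d; rewrite mem_filter -dvdn_divisors //; apply/idP/mapP.
      move=> /andP[/andP[pd hl] dk]; exists (d %/ p); last by rewrite mulnC divnK.
      rewrite mem_filter -dvdn_divisors // (dvdn_trans _ dk) ?andbT; last first.
        by rewrite -{2}(divnK pd) dvdn_mulr.
      apply: contra hl => h; rewrite -(pfactor_dvdn 2 pp (div0 _ dk)) expnS expn1.
      by rewrite -(divnK pd) dvdn_mul.
    move=> [e]; rewrite mem_filter -dvdn_divisors // => /andP[pe ek] ->.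
    rewrite dvdn_mulr // lognM ?(div0 _ ek) // logn_prime // eqxx.
    rewrite Gauss_dvd ?pk ?ek ?prime_coprime // andbT /= add1n ltnS -eqn0Ngt.
    by rewrite lognE (negbTE pe) !andbF.
  rewrite (perm_big _ hper) big_map big_filter /= -big_split /= big_seq_cond big1 //.
  move=> d /andP[]; rewrite -dvdn_divisors // => /div0 d0 pd.
  by rewrite mobius_mul_prime // addNr.
by rewrite /divisors /= big_seq1.
Qed.

End Moebius.

Lemma sum_mobius_nat m X : (0 < m)%N -> (m <= X)%N ->
  \sum_(1 <= d < X.+1 | (d %| m)%N) mobius d = (m == 1%N)%:R.
Proof.
move=> m0 mX; rewrite -sum_mobius // -big_filter; apply: perm_big; apply: uniq_perm.
- by rewrite filter_uniq ?iota_uniq.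
- exact: divisors_uniq.
move=> d; rewrite mem_filter mem_index_iota -dvdn_divisors //.
case: (boolP (d %| m)%N) => //= dm; rewrite (dvdn_gt0 m0 dm) /= ltnS.
exact: leq_trans (dvdn_leq m0 dm) mX.
Qed.

Section MoebiusInversion.
Variable V : nzRingType.

(** With the cut-off at [k j <= X], grouping by [m = k j] leaves a complete divisor sum for each
    [m <= X]. It is applied to [F m = m ^ (- s)] and to [F m = max 0 (- ln (m x))]. *)
Lemma mobius_inversion (F : nat -> V) X : (0 < X)%N ->
  \sum_(1 <= k < X.+1) ((mobius k)%:~R * \sum_(1 <= j < X.+1 | (k * j <= X)%N) F (k * j)%N)
  = F 1%N.
Proof.
move=> X0.
have step k : (0 < k)%N -> \sum_(1 <= j < X.+1 | (k * j <= X)%N) F (k * j)%N =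
    \sum_(1 <= m < X.+1 | (k %| m)%N) F m.
  move=> k0; rewrite -[RHS]big_filter -[LHS]big_filter.
  rewrite -(big_map (fun j => k * j)%N xpredT F).
  apply: perm_big; apply: uniq_perm.
  - rewrite map_inj_uniq ?filter_uniq ?iota_uniq // => x y /eqP.
    by rewrite eqn_pmul2l // => /eqP.
  - by rewrite filter_uniq ?iota_uniq.
  move=> m; rewrite mem_filter mem_index_iota; apply/mapP/idP.
    move=> [j]; rewrite mem_filter mem_index_iota => /andP[kj /andP[j0 _] ->].
    by rewrite dvdn_mulr //= muln_gt0 k0 j0 ltnS kj.
  move=> /andP[km /andP[m0 mX]]; exists (m %/ k)%N; last by rewrite mulnC divnK.
  rewrite mem_filter mem_index_iota mulnC divnK // -ltnS mX /=.
  by rewrite divn_gt0 // dvdn_leq //= (leq_ltn_trans (leq_div _ _)).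
transitivity (\sum_(1 <= k < X.+1)
    \sum_(1 <= m < X.+1 | (k %| m)%N) ((mobius k)%:~R * F m)).
  by apply: eq_big_nat => k /andP[k0 _]; rewrite step // mulr_sumr.
rewrite (exchange_big_dep_nat xpredT) //=.
transitivity (\sum_(1 <= m < X.+1) ((m == 1%N)%:R * F m)).
  apply: eq_big_nat => m /andP[m0 mX]; rewrite -mulr_suml.
  rewrite (_ : \sum_(1 <= i < X.+1 | (i %| m)%N) (mobius i)%:~R =
    (\sum_(1 <= i < X.+1 | (i %| m)%N) mobius i)%:~R :> V); last by rewrite rmorph_sum.
  by rewrite sum_mobius_nat //; case: (m == 1%N).
rewrite big_ltn // eqxx mul1r big_nat big1 ?addr0 // => m /andP[m1 _].
by rewrite gtn_eqF // mul0r.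
Qed.

End MoebiusInversion.

(** * Complex powers of integers and series of Taylor remainders *)

Section PowersOfNaturals.
Variable R : realType.
Implicit Types (z w l s : R[i]) (rho x : R).

(* [cnp n w] is [(n + 1) ^ w]. *)
Definition cnp n w : R[i] := cexp (w * (ln (n.+1%:R : R))%:C).

Lemma cnpD n z w : cnp n (z + w) = cnp n z * cnp n w.
Proof. by rewrite /cnp mulrDl cexpD. Qed.

Lemma cabs_cnp n w : cabs (cnp n w) = n.+1%:R `^ complex.Re w.
Proof. by rewrite cabs_cexp cReM /= mulr0 subr0 powR_nat. Qed.

Lemma cnp_real n x : cnp n x%:C = (n.+1%:R `^ x)%:C.
Proof. by rewrite /cnp -rmorphM cexp_real powR_nat. Qed.

Lemma cnp1 n : cnp n 1 = n.+1%:R.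
Proof. by rewrite -[1]/(1%:C) cnp_real powRr1 // rmorph_nat. Qed.

Lemma cnpM n m w : cnp (n.+1 * m.+1).-1 w = cnp n w * cnp m w.
Proof.
by rewrite /cnp prednK ?muln_gt0 // natrM lnM ?posrE // rmorphD mulrDr cexpD.
Qed.

Lemma cnp_S n w : cnp n.+1 w = cnp n w * cexp (w * (ln (1 + n.+1%:R^-1 : R))%:C).
Proof.
rewrite /cnp -cexpD -mulrDr -rmorphD /= -lnM ?posrE ?addr_gt0 ?invr_gt0 //.
by rewrite mulrDr mulr1 divff ?natr1 // pnatr_eq0.
Qed.

Definition csum (a : nat -> R[i]) : R[i] := xget 0 [set l | hasS a l].

Lemma hasS_csum a l : hasS a l -> csum a = l.
Proof.
rewrite /csum => al; case: xgetP => [l' _ /= al'|/(_ l)//].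
exact: hasS_unique al' al.
Qed.

Lemma csumP a : (exists l, hasS a l) -> hasS a (csum a).
Proof. by move=> [l al]; rewrite (hasS_csum al). Qed.

(* The Taylor remainder of [x ^ w] between [N] and [N (1 + h n)], with
   [N = n + 1], weighted by [tau n]. *)
Definition fterm (tau h : nat -> R) w n : R[i] :=
  (tau n)%:C * (cnp n w * (cexp (w * (ln (1 + h n))%:C) - 1 - w * (h n)%:C)).

Section Family.
Variables (tau h : nat -> R) (K alpha : R).
Hypothesis tauK : forall n, `|tau n| <= K * n.+1%:R `^ alpha.
Hypothesis h_dom : forall n, - 2^-1 <= h n <= 1.
Hypothesis h_le : forall n, `|h n| <= n.+1%:R^-1.

Lemma h_sqr n : h n ^+ 2 <= n.+1%:R `^ (- 2).
Proof.
rewrite powRN powR_mulrn // -exprVn -(real_normK (num_real (h n))).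
by rewrite lerXn2r ?nnegrE // invr_ge0.
Qed.

Lemma K_ge0 : 0 <= K.
Proof. by have := tauK 0%N; rewrite powR1 mulr1; exact: le_trans. Qed.

(** Each term expands in [z] as a Cauchy product, [ecoef] for [(n + 1) ^ (w - z)] and [Ecoef] for
    the remainder. Its majorant is of order [alpha + Re w + rho - 2] in [n], the [- 2] coming from
    [h n ^ 2], and the double series theorem applies. *)
Lemma fterm_ps w rho : 0 < rho -> alpha + complex.Re w + rho < 1 ->
  exists A : nat -> R[i], ps_abs A rho /\
    forall z, cabs z <= rho -> exists2 G, hasS (fterm tau h (w - z)) G & ps_sum A z G.
Proof.
move=> r0 hr; have r0' := ltW r0.
pose c n := conv (ecoef (ln n.+1%:R) w) (Ecoef (h n) w).
pose u (n : nat) := K * Econst w rho * n.+1%:R `^ (- (2 - (alpha + complex.Re w + rho))).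
have l0 n : 0 <= ln n.+1%:R :> R by rewrite ln_ge0 // ler1n.
have Ec0 : 0 <= Econst w rho.
  rewrite /Econst; have := cabs_ge0 w; have := expR_ge0 (3 * cabs w).
  by have := expR_ge0 (3 * rho) => *; rewrite !addr_ge0 ?mulr_ge0 ?addr_ge0 ?mulr_ge0 ?exprn_ge0.
have cu n m : \sum_(k < m) cabs ((tau n)%:C * c n k) * rho ^+ k <= u n.
  under eq_bigr do rewrite cabsM cabs_real -mulrA.
  rewrite -mulr_sumr.
  apply: (@le_trans _ _ (`|tau n| * (n.+1%:R `^ (complex.Re w + rho) * (h n ^+ 2 * Econst w rho)))).
    apply: ler_wpM2l => //.
    have hk (b : nat -> R[i]) k : cabs (b k) * rho ^+ k = cabs (b k * rho%:C ^+ k).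
      by rewrite cabsM cabsX cabs_real ger0_norm.
    have := @conv_bsum_le R (fun k => ecoef (ln n.+1%:R) w k * rho%:C ^+ k)
      (fun k => Ecoef (h n) w k * rho%:C ^+ k)
      (n.+1%:R `^ (complex.Re w + rho)) (h n ^+ 2 * Econst w rho).
    move=> h2; apply: le_trans (h2 _ _ m).
    - rewrite le_eqVlt; apply/orP; left; apply/eqP; apply: eq_bigr => k _.
      rewrite hk /c /conv mulr_suml; congr cabs; apply: eq_bigr => i _.
      rewrite -[in rho%:C ^+ k](subnKC (_ : i <= k)%N) -1?ltnS // exprD; ring.
    - move=> q; under eq_bigr do rewrite -hk.
      apply: le_trans (ecoef_psum _ _ _ r0') _.
      by rewrite powR_nat ger0_norm // mulrDl.
    - by move=> q; under eq_bigr do rewrite -hk; exact: Ecoef_psum.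
  rewrite /u.
  have -> : n.+1%:R `^ (- (2 - (alpha + complex.Re w + rho))) =
     n.+1%:R `^ alpha * (n.+1%:R `^ (complex.Re w + rho) * n.+1%:R `^ (- 2)) :> R.
    by rewrite !powR_nat -!expRD; congr expR; ring.
  rewrite [leRHS](_ : _ = (K * n.+1%:R `^ alpha) *
    (n.+1%:R `^ (complex.Re w + rho) * (n.+1%:R `^ (- 2) * Econst w rho))); last by ring.
  apply: ler_pM => //; first by rewrite mulr_ge0 ?powR_ge0 // mulr_ge0 ?sqr_ge0.
  by rewrite ler_wpM2l ?powR_ge0 // ler_wpM2r // h_sqr.
have ub : bsum u by apply: bsumZ; [rewrite mulr_ge0 ?K_ge0|apply: bsum_zeta; lra].
have [A [hA _ hz]] := ps_double (c := fun n k => (tau n)%:C * c n k) r0 ub cu.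
exists A; split => // z zr; apply: hz => // n.
have h1 : ps_abs (ecoef (ln n.+1%:R) w) rho by eexists => m; exact: ecoef_psum.
have h2 : ps_abs (Ecoef (h n) w) rho by eexists => m; exact: Ecoef_psum.
have := ps_mul h1 h2 zr (ecoef_sum _ _ _) (Ecoef_sum _ _ _).
by move=> /(hasSZ (tau n)%:C); apply: hasS_ext => k; rewrite mulrA.
Qed.

Definition fconst (B : R) : R := 9 * (expR (3 * B) + expR 1 + 2) + 2.

Lemma fterm_le w B n : `|complex.Re w| <= B ->
  cabs (fterm tau h w n) <=
  fconst B * (1 + cabs w) ^+ 2 * (`|tau n| * n.+1%:R `^ (complex.Re w - 2)).
Proof.
move=> wB; rewrite /fterm !cabsM cabs_real cabs_cnp.
apply: (@le_trans _ _ (`|tau n| * (n.+1%:R `^ complex.Re w *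
    (n.+1%:R `^ (- 2) * ((1 + cabs w) ^+ 2 * fconst B))))).
  apply: ler_wpM2l => //; apply: ler_wpM2l; first exact: powR_ge0.
  apply: le_trans (E_bound (h_dom n) wB) _; apply: ler_wpM2r (h_sqr n).
  by rewrite mulr_ge0 ?sqr_ge0 // /fconst !addr_ge0 ?mulr_ge0 ?addr_ge0 ?expR_ge0.
rewrite (_ : n.+1%:R `^ (complex.Re w - 2) = n.+1%:R `^ complex.Re w * n.+1%:R `^ (- 2)).
  by rewrite le_eqVlt; apply/orP; left; apply/eqP; ring.
by rewrite !powR_nat -expRD; congr expR; ring.
Qed.

End Family.

End PowersOfNaturals.
Arguments cnp {R} n w : simpl never.

(** * The zeta function *)

Section ZetaFunction.
Variable R : realType.
Implicit Types (z w l s : R[i]) (rho x : R).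

Definition mu n : R[i] := (mobius n.+1)%:~R.

Lemma cabs_mu n : cabs (mu n) <= 1.
Proof.
rewrite /mu /mobius; case: all; last by rewrite cabs0.
by rewrite rmorphXn rmorphN1 cabsX cabsN cabs1 expr1n.
Qed.

Lemma bsum_cnp s : 1 < complex.Re s -> bsum (fun n => cabs (cnp n (- s))).
Proof.
by move=> s1; apply: bsum_le (bsum_zeta s1) => n; rewrite cabs_cnp cReN.
Qed.

Lemma hasS_one l : hasS (fun n => (n == 0%N)%:R * l) l.
Proof.
have := @hasS_fin R (fun n => (n == 0%N)%:R * l) 1; rewrite big_ord1 /= mul1r; apply.
by move=> -[//|k] _; rewrite mul0r.
Qed.

(** Moebius inversion of the terms [k ^ (- s)] with [k <= X] gives [sum_n F X n = 1] for each
    [X > 0] (and the empty sum for [X = 0]). As [X] grows the inner sums tend to [Z], dominated by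
    [U]. *)
Lemma mu_zeta s Z : 1 < complex.Re s -> hasS (fun n => cnp n (- s)) Z ->
  exists2 d, hasS (fun n => mu n * cnp n (- s)) d & Z * d = 1.
Proof.
move=> s1 hZ; have [U hU] := bsum_cnp s1.
pose u n := U * cabs (cnp n (- s)).
have U0 : 0 <= U by apply: le_trans (hU 0%N); rewrite big_ord0.
pose F X n := mu n * cnp n (- s) * \sum_(m < X | (n.+1 * m.+1 <= X)%N) cnp m (- s).
have [||||T hT hS] := @tannery R F (fun n => mu n * cnp n (- s) * Z) u (fun X => (0 < X)%:R).
- exact: bsumZ (ex_intro _ U hU).
- move=> X n; rewrite /F /u !cabsM mulrC; apply: ler_pM; rewrite ?cabs_ge0 ?mulr_ge0 ?cabs_ge0 //.
    apply: le_trans (cabs_sum _ _ _) _; apply: le_trans (hU X).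
    rewrite [leRHS](bigID (fun m : 'I_X => (n.+1 * m.+1 <= X)%N)) /= lerDl.
    apply: sumr_ge0 => m _. exact: cabs_ge0.
  by rewrite ler_piMl ?cabs_ge0 // cabs_mu.
- move=> n; apply: ctendsZ => e /hZ[N hN]; exists (n.+1 * N)%N => X hX.
  rewrite (_ : \sum_(m < X | _) _ = \sum_(m < X %/ n.+1) cnp m (- s)).
    by apply: hN; rewrite leq_divRL // mulnC.
  rewrite (big_ord_widen_cond X predT (fun m => cnp m (- s)) (leq_div X n.+1)) /=.
  by apply: eq_bigl => m; rewrite /= leq_divRL // mulnC.
- move=> X; rewrite (_ : (0 < X)%:R = \sum_(n < X) F X n).
    apply: hasS_fin => n Xn; rewrite /F big1 ?mulr0 // => m h.
    by have := leq_trans (leq_pmulr n.+1 (ltn0Sn m)) h; rewrite ltnNge Xn.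
  case: X => [|X]; first by rewrite big_ord0.
  have := @mobius_inversion _ (fun k => cnp k.-1 (- s)) X.+1 isT.
  rewrite [X in X = _](_ : _ = \sum_(n < X.+1) F X.+1 n).
    by move=> ->; rewrite /cnp ln1 mulr0 cexp0.
  rewrite big_add1 /= big_mkord; apply: eq_bigr => n _.
  rewrite /F /mu -mulrA; congr (_ * _); rewrite big_add1 /= big_mkord mulr_sumr.
  by apply: eq_bigr => m _; rewrite cnpM.
have [d hd] : exists d, hasS (fun n => mu n * cnp n (- s)) d.
  apply: abs_hasS; apply: bsum_le (ex_intro _ U hU) => n.
  by rewrite cabsM; apply: ler_piMl; rewrite ?cabs_ge0 ?cabs_mu.
exists d => //; have -> : Z * d = T.
  by apply: hasS_unique (hasSZ Z hd) _; apply: hasS_ext hT => n; rewrite mulrC.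
apply: ctends_unique hS _; apply: (ctends_eventually (N := 1)) (ctends_cst 1) => n n1.
by rewrite n1.
Qed.

Definition one_h n : R := n.+1%:R^-1.

Definition zterm s n : R[i] := fterm (fun=> 1) one_h (1 - s) n.

(* For [w = 1 - s], the differences [(N + 1) ^ w - N ^ w] telescope and
   [- w N ^ (w - 1)] sums to [(s - 1) zeta s]; the remainders [zterm] are
   summable for [Re s > 0]. *)
Definition zf s : R[i] := 1 + csum (zterm s).

Lemma tau1_le n : `|1 : R| <= 1 * n.+1%:R `^ 0.
Proof. by rewrite powRr0 mulr1 normr1. Qed.

Lemma one_h_dom n : - 2^-1 <= one_h n <= 1.
Proof.
rewrite /one_h invf_le1 ?ltr0n // ler1n andbT.
by apply: (@le_trans _ _ 0); [lra|rewrite invr_ge0].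
Qed.

Lemma one_h_le n : `|one_h n| <= n.+1%:R^-1.
Proof. by rewrite ger0_norm // invr_ge0. Qed.

Lemma ztermE s n : zterm s n = cnp n.+1 (1 - s) - cnp n (1 - s) + (s - 1) * cnp n (- s).
Proof.
rewrite /zterm /fterm /one_h mul1r cnp_S addrC cnpD cnp1.
have n0 : (n.+1%:R : R[i]) != 0 by rewrite pnatr_eq0.
by rewrite fmorphV rmorph_nat; field.
Qed.

Lemma zf_ps s0 rho : 0 < rho < complex.Re s0 ->
  exists A : nat -> R[i], ps_abs A rho /\
    forall z, cabs z <= rho -> ps_sum A z (zf (s0 + z)).
Proof.
move=> /andP[r0 rs]; have hr : 0 + complex.Re (1 - s0) + rho < 1.
  by rewrite cReD cReN /=; lra.
have [A [[U hU] hz]] := fterm_ps tau1_le one_h_dom one_h_le r0 hr.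
exists (fun k => A k + (k == 0%N)%:R * 1); split.
  exists (U + 1) => n.
  apply: (@le_trans _ _ (\sum_(k < n) (cabs (A k) * rho ^+ k + (k == 0 :> nat)%:R))).
    apply: ler_sum => -[[|k] /= kn] _; first by rewrite !expr0 !mulr1 (le_trans (cabsD _ _)) // cabs1.
    by rewrite mul0r !addr0.
  rewrite big_split /= lerD // => [|]; first exact: hU.
  case: n => [|n]; first by rewrite big_ord0.
  by rewrite big_ord_recl /= big1 ?addr0.
move=> z zr; have [G hG hA] := hz z zr.
have -> : zf (s0 + z) = G + 1.
  by rewrite /zf addrC /zterm opprD addrA (hasS_csum hG).
have := hasSD hA (hasS_one 1); apply: hasS_ext => k.
by case: k => [|k]; rewrite ?expr0 /=; ring.
Qed.

Lemma hasS_zterm s : 0 < complex.Re s -> hasS (zterm s) (zf s - 1).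
Proof.
move=> s0; rewrite /zf addrAC subrr add0r; apply: csumP.
have hr : 0 + complex.Re (1 - s) + complex.Re s / 2 < 1.
  by rewrite cReD cReN /=; lra.
have r0 : 0 < complex.Re s / 2 by lra.
have [A [_ hz]] := fterm_ps tau1_le one_h_dom one_h_le r0 hr.
have [|G hG _] := hz 0; first by rewrite cabs0 ltW.
by exists G; rewrite subr0 in hG.
Qed.

Lemma zf_zeta s Z : 1 < complex.Re s -> hasS (fun n => cnp n (- s)) Z ->
  zf s = (s - 1) * Z.
Proof.
move=> s1 hZ; have /hasS_zterm h : 0 < complex.Re s by lra.
have h2 : hasS (fun n => cnp n.+1 (1 - s) - cnp n (1 - s)) (- 1).
  have hc : ctends (fun n => cnp n (1 - s)) 0.
    move=> e e0; have s10 : 0 < complex.Re s - 1 by lra.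
    exists (Num.truncn (expR (- ln e / (complex.Re s - 1)))) => n hn.
    rewrite subr0 cabs_cnp powR_nat cReD cReN /=.
    rewrite -[ltRHS]lnK ?posrE // ltr_expR -opprB mulNr ltrNl mulrC -ltr_pdivrMr //.
    rewrite -ltr_expR lnK ?posrE //; apply: lt_le_trans (truncnS_gt _) _.
    by rewrite ler_nat.
  have := ctendsD hc (ctends_cst (-1)); rewrite add0r; apply: ctends_ext => n.
  elim: n => [|n IH]; first by rewrite big_ord0 /cnp ln1 mulr0 cexp0 subrr.
  by rewrite big_ord_recr /= -IH; ring.
have := hasSD h2 (hasSZ (s - 1) hZ).
move=> h3; apply: (addIr (- 1)); rewrite addrC [RHS]addrC.
rewrite [LHS]addrC; apply: hasS_unique h3; apply: hasS_ext h => n.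
by rewrite ztermE.
Qed.

Lemma zf1 : zf 1 = 1.
Proof.
have h0 : hasS (zterm 1) 0.
  have := @hasS_fin R (zterm 1) 0; rewrite big_ord0; apply => n _.
  by rewrite ztermE subrr /cnp !mul0r cexp0; ring.
by rewrite /zf (hasS_csum h0) addr0.
Qed.

(** Summing [fterm_le] over [n]. This is the growth in vertical strips whose logarithm enters
    [dk_bound]. *)
Lemma zf_bound (b B : R) : 0 < b -> exists2 K : R, 0 < K & forall s, b <= complex.Re s ->
  complex.Re s <= B -> cabs (zf s) <= K * (1 + cabs (1 - s)) ^+ 2.
Proof.
move=> b0; pose C := 1 + `|B|.
have b1 : 1 < b + 1 by lra.
exists (1 + fconst C * (1 + b^-1)).
  by rewrite ltr_pwDl // mulr_ge0 ?addr_ge0 ?invr_ge0 ?(ltW b0) // /fconst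
    !addr_ge0 ?mulr_ge0 ?addr_ge0 ?expR_ge0.
move=> s sb sB; have s0 : 0 < complex.Re s by lra.
have W : `|complex.Re (1 - s)| <= C.
  rewrite cReD cReN /= /C ler_norml; have := ler_norm B; lra.
have := hasS_le (hasS_zterm s0) (U := (1 + cabs (1 - s)) ^+ 2 * (fconst C * (1 + b^-1))).
move=> h; have {}h : cabs (zf s - 1) <= (1 + cabs (1 - s)) ^+ 2 * (fconst C * (1 + b^-1)).
  apply: h => n.
  apply: (@le_trans _ _ (\sum_(k < n) fconst C * (1 + cabs (1 - s)) ^+ 2 * k.+1%:R `^ (- (b + 1)))).
    apply: ler_sum => k _; apply: le_trans (fterm_le _ one_h_dom one_h_le _ W) _.
    rewrite normr1 mul1r; apply: ler_wpM2l.
      by rewrite mulr_ge0 ?sqr_ge0 // /fconst !addr_ge0 ?mulr_ge0 ?addr_ge0 ?expR_ge0.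
    by rewrite ler_powR ?ler1n // cReD cReN /=; lra.
  rewrite -mulr_sumr mulrA [fconst C * _]mulrC; apply: ler_wpM2l.
    by rewrite mulr_ge0 ?sqr_ge0 // /fconst !addr_ge0 ?mulr_ge0 ?addr_ge0 ?expR_ge0.
  by apply: le_trans (zeta_psum n b1) _; rewrite addrK.
have := cabsD (zf s - 1) 1; rewrite subrK cabs1.
have : 1 <= (1 + cabs (1 - s)) ^+ 2 by rewrite exprn_ege1 // lerDl cabs_ge0.
lra.
Qed.

Definition lin c k : R[i] := (k == 0%N)%:R * c + (k == 1%N)%:R.

Lemma lin_sum c z : ps_sum (lin c) z (c + z).
Proof.
have -> : c + z = \sum_(k < 2) lin c k * z ^+ k.
  by rewrite big_ord_recr big_ord1 /lin /=; ring.
by apply: hasS_fin => -[|[|k]] //= _; rewrite /lin /=; ring.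
Qed.

Lemma lin_abs c rho : 0 <= rho -> ps_abs (lin c) rho.
Proof.
move=> r0; exists (cabs c + rho) => n.
apply: (@le_trans _ _ (\sum_(k < n.+2) cabs (lin c k) * rho ^+ k)).
  apply: (psum_mono (u := fun k => cabs (lin c k) * rho ^+ k)) => [k|].
    by rewrite mulr_ge0 ?cabs_ge0 ?exprn_ge0.
  by rewrite -addn2 leq_addr.
rewrite 2!big_ord_recl /= /lin /= big1 => [|k _]; last by rewrite /= !mul0r addr0 cabs0 mul0r.
by rewrite /bump /= !mul0r !mul1r add0r !addr0 cabs1 expr0 expr1 mulr1 mul1r.
Qed.

Section Identification.
Variable zeta : R[i] -> R[i].
Hypothesis hzeta : is_riemann_zeta zeta.

Lemma hasS_zeta s : 1 < complex.Re s -> hasS (fun n => cnp n (- s)) (zeta s).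
Proof. by move=> s1; apply: series_hasS; exact: (proj1 hzeta). Qed.

(** A horizontal line with [t != 0] avoids the pole, so the difference of the two sides is analytic
    along it; it vanishes for [x > 1], and [identity_line] carries this to [x > 0]. *)
Lemma zf_eq_nonreal x t : 0 < x -> t != 0 ->
  zf (x +i* t) = (x +i* t - 1) * zeta (x +i* t).
Proof.
move=> x0 t0; apply/eqP; rewrite -subr_eq0; apply/eqP.
apply: (@identity_line R (fun x => zf (x +i* t) - (x +i* t - 1) * zeta (x +i* t))) x0.
  move=> {}x x0; have ht y : y +i* t = x +i* t + (y - x)%:C.
    by apply/eqP; rewrite eq_complex /=; apply/andP; split; apply/eqP; ring.
  have n1 : x +i* t != 1 by rewrite eq_complex /= (negbTE t0) andbF.
  have [a [d [d0 hd]]] := analytic_ps ((proj2 hzeta) _ n1).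
  have hx : 0 < x / 2 < complex.Re (x +i* t) by rewrite /=; lra.
  have [A [_ hA]] := zf_ps hx.
  have ha : ps_abs a (d / 4).
    apply: (@ps_abs_of_cvg _ a (d / 2)%:C (zeta (x +i* t + (d / 2)%:C))).
      by have := hd (x +i* t + (d / 2)%:C); rewrite addrAC subrr add0r cabs_real gtr0_norm; [apply; lra|lra].
    by rewrite cabs_real gtr0_norm; lra.
  exists (fun k => A k + (-1) * conv (lin (x +i* t - 1)) a k), (Num.min (x / 2) (d / 4)).
  split; first by rewrite lt_min; lra.
  move=> y; rewrite lt_min => /andP[h1 h2]; rewrite (ht y).
  rewrite [X in ps_sum _ _ X](_ : _ = zf (x +i* t + (y - x)%:C) +
    (-1) * ((x +i* t - 1 + (y - x)%:C) * zeta (x +i* t + (y - x)%:C))); last by ring.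
  have hy : cabs (y - x)%:C <= d / 4 by rewrite cabs_real ltW.
  have d40 : 0 <= d / 4 by lra.
  have az : ps_sum a (y - x)%:C (zeta (x +i* t + (y - x)%:C)).
    have := hd (x +i* t + (y - x)%:C).
    by rewrite [_ + _ - _]addrAC subrr add0r cabs_real; apply; lra.
  have hm := ps_mul (lin_abs (x +i* t - 1) d40) ha hy (lin_sum _ _) az.
  have hAy : cabs (y - x)%:C <= x / 2 by rewrite cabs_real ltW.
  have := hasSD (hA _ hAy) (hasSZ (-1) hm).
  by apply: hasS_ext => k; rewrite mulrDl mulrA.
move=> {}x x1; rewrite (@zf_zeta _ (zeta (x +i* t))) ?subrr //.
exact: hasS_zeta.
Qed.

End Identification.

End ZetaFunction.

Section ZetaIdentification.
Variable R : realType.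
Variable zeta : R[i] -> R[i].
Hypothesis hzeta : is_riemann_zeta zeta.
Implicit Types (z w l s : R[i]) (rho x : R).

Lemma zf_lip s0 : 0 < complex.Re s0 -> exists (K d : R), 0 < d /\
  forall s, cabs (s - s0) < d -> cabs (zf s - zf s0) <= K * cabs (s - s0).
Proof.
move=> s00; have r0 : 0 < complex.Re s0 / 2 by lra.
have [|A [[U hU] hA]] := @zf_ps _ s0 (complex.Re s0 / 2); first lra.
exists (U / (complex.Re s0 / 2)), (complex.Re s0 / 2); split=> // s hs.
have A0 : A 0%N = zf s0.
  have : ps_sum A 0 (zf (s0 + 0)) by apply: hA; rewrite cabs0 ltW.
  rewrite addr0 => h; apply: hasS_unique h.
  rewrite -[A 0%N](_ : \sum_(k < 1) A k * 0 ^+ k = _); last by rewrite big_ord1 expr0 mulr1.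
  by apply: hasS_fin => -[//|k] _; rewrite expr0n mulr0.
rewrite mulrC -A0; apply: (ps_cst_dist hU r0 (ltW hs)).
by have := hA _ (ltW hs); rewrite addrCA subrr addr0.
Qed.

(** On the real axis the pole separates [(0, 1)] from the half-line [x > 1], so real points are
    reached as limits of [s + i y], where both sides are Lipschitz. *)
Lemma zf_eq s : 0 < complex.Re s -> s != 1 -> zf s = (s - 1) * zeta s.
Proof.
case: s => x t /= x0; have [->|t0] := eqVneq t 0; last by move=> _; exact: zf_eq_nonreal.
rewrite complexr0 => x1; set s := x%:C in x1 *.
have s0 : 0 < complex.Re s by [].
have [K [d [d0 hK]]] := zf_lip s0.
have [L [d' [d0' hL]]] := analytic_lip ((proj2 hzeta) _ x1).
apply/eqP; rewrite -subr_eq0 -cabs_eq0 eq_le cabs_ge0 andbT leNgt; apply/negP => e0.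
set e := cabs _ in e0.
pose C := `|K| + (cabs (s - 1) + 1) * `|L| + cabs (zeta s) + 1.
have C0 : 0 < C.
  by rewrite /C ltr_wpDl // !addr_ge0 ?mulr_ge0 ?addr_ge0 ?cabs_ge0.
pose y := Num.min (Num.min (d / 2) (d' / 2)) (Num.min (e / C / 2) 1).
have y0 : 0 < y by rewrite !lt_min; apply/andP; split; apply/andP; split; rewrite ?divr_gt0.
have [yd yd' ye y1] : [/\ y <= d / 2, y <= d' / 2, y <= e / C / 2 & y <= 1].
  by rewrite /y !ge_min !lexx !orbT.
have hy : cabs (x +i* y - s) = y.
  rewrite (_ : _ - _ = 'i%C * y%:C) ?cabsM ?cabs_real; last first.
    by apply/eqP; rewrite eq_complex /=; apply/andP; split; apply/eqP; ring.
  by rewrite cabsE /= expr0n expr1n add0r sqrtr1 mul1r gtr0_norm.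
have := hK (x +i* y); have := hL (x +i* y); rewrite hy.
move=> /(_ ltac:(lra)) h1 /(_ ltac:(lra)) h2.
have h3 : zf (x +i* y) = (x +i* y - 1) * zeta (x +i* y).
  by apply: zf_eq_nonreal => //; rewrite gt_eqF.
have : e <= C * y.
  rewrite /e (_ : zf s - _ = - (zf (x +i* y) - zf s) +
    ((x +i* y - 1) * (zeta (x +i* y) - zeta s) + (x +i* y - s) * zeta s)); last first.
    by rewrite h3; ring.
  apply: le_trans (cabsD _ _) _; rewrite cabsN.
  have h4 : cabs (x +i* y - 1) <= cabs (s - 1) + 1.
    rewrite (_ : x +i* y - 1 = (s - 1) + (x +i* y - s)); last by ring.
    by apply: le_trans (cabsD _ _) _; rewrite hy lerD2l.
  have h5 := cabsD ((x +i* y - 1) * (zeta (x +i* y) - zeta s)) ((x +i* y - s) * zeta s).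
  rewrite !cabsM hy in h5.
  have h6 : cabs (x +i* y - 1) * cabs (zeta (x +i* y) - zeta s) <=
     (cabs (s - 1) + 1) * (`|L| * y).
    apply: ler_pM; rewrite ?cabs_ge0 //; apply: le_trans h1 _.
    by rewrite ler_wpM2r ?ler_norm // ltW.
  have h7 : K * y <= `|K| * y by rewrite ler_wpM2r ?ler_norm // ltW.
  rewrite /C; lra.
have : C * y <= e / 2.
  rewrite mulrC -ler_pdivlMr // (le_trans ye) // le_eqVlt; apply/orP; left; apply/eqP.
  by rewrite mulrAC.
lra.
Qed.

End ZetaIdentification.

(** * The reciprocal of zeta through a smoothed Mertens function *)

Section SmoothedMertens.
Variable R : realType.
Implicit Types (z w l s : R[i]) (rho x : R).

(* With [N = n + 1], this is [N c_N] for [c_N = sum_(k <= N) mu k (1/k - 1/N)]. *)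
Definition Tm n : R := \sum_(k < n.+1) (mobius k.+1)%:~R * (n.+1%:R / k.+1%:R - 1).

Definition neg_h n : R := if n is n'.+1 then - n.+1%:R^-1 else 0.

Lemma neg_h_dom n : - 2^-1 <= neg_h n <= 1.
Proof.
case: n => [|n] /=; first by apply/andP; split; [rewrite oppr_le0 invr_ge0|].
rewrite lerNl opprK lef_pV2 ?posrE ?ltr0n // ler_nat /=.
by apply: (@le_trans _ _ 0); rewrite // oppr_le0 invr_ge0.
Qed.

Lemma neg_h_le n : `|neg_h n| <= n.+1%:R^-1.
Proof.
case: n => [|n] /=; first by rewrite normr0 invr_ge0.
by rewrite normrN ger0_norm // invr_ge0.
Qed.

Lemma Tm0 : Tm 0 = 0.
Proof. by rewrite /Tm big_ord1 divr1 subrr mulr0. Qed.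

(* Two summations by parts turn [sum_N mu N N ^ (- s)] into the sum of
   [Tm] against the second differences of [x ^ (1 - s)]. *)
Definition dterm s n : R[i] := fterm Tm (@one_h R) (1 - s) n + fterm Tm neg_h (1 - s) n.

Definition Df s : R[i] := csum (dterm s).

Lemma dtermS s n : dterm s n.+1 = (Tm n.+1)%:C *
  (cnp n.+2 (1 - s) - 2 * cnp n.+1 (1 - s) + cnp n (1 - s)).
Proof.
rewrite /dterm /fterm -mulrDr; congr (_ * _).
have -> : cnp n (1 - s) = cnp n.+1 (1 - s) * cexp ((1 - s) * (ln (1 + neg_h n.+1))%:C).
  rewrite /cnp -cexpD -mulrDr -rmorphD /= -lnM ?posrE //; last first.
    by rewrite subr_gt0 invf_lt1 // ltr1n.
  rewrite mulrBr mulr1 divff ?pnatr_eq0 //; congr (cexp (_ * (ln _)%:C)).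
  by rewrite -[n.+2%:R]natr1 addrK.
rewrite (cnp_S n.+1) /one_h /= rmorphN; ring.
Qed.

(** Consequently the second differences of [Tm] are [mu N / N], which is why two summations by parts
    lead from [mu] to [Tm]. *)
Lemma TmS n : Tm n.+1 = Tm n + \sum_(k < n.+1) (mobius k.+1)%:~R / k.+1%:R.
Proof.
rewrite /Tm big_ord_recr /= divff ?pnatr_eq0 // subrr mulr0 addr0 -big_split /=.
apply: eq_bigr => k _; rewrite -[n.+2%:R]natr1; field.
by rewrite addrC natr1 pnatr_eq0.
Qed.

Lemma Tm_abel s n : \sum_(k < n.+1) dterm s k = \sum_(k < n.+1) mu R k * cnp k (- s)
  + ((Tm n)%:C * cnp n.+1 (1 - s) - (Tm n.+1)%:C * cnp n (1 - s)).
Proof.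
elim: n => [|n IH].
  rewrite !big_ord1 /dterm /fterm TmS Tm0 !mul0r add0r big_ord1 divr1 /mu /=.
  by rewrite /cnp ln1 !mulr0 cexp0; ring.
rewrite big_ord_recr /= IH [in RHS]big_ord_recr /= dtermS.
have hm : mu R n.+1 * cnp n.+1 (- s) = ((mobius n.+2)%:~R / n.+2%:R : R)%:C * cnp n.+1 (1 - s).
  rewrite addrC cnpD cnp1 rmorphM fmorphV rmorph_nat rmorph_int /= /mu.
  have : (n.+2%:R : R[i]) != 0 by rewrite pnatr_eq0.
  by move: n.+2%:R (mobius n.+2)%:~R => m q m0; field.
have := TmS n.+1; rewrite big_ord_recr /= addrA => h.
have := TmS n; set S := \sum_(k < _) _ => h2.
have hS : S = Tm n.+1 - Tm n by rewrite h2; ring.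
rewrite hm h -/S hS !rmorphD rmorphN /=; ring.
Qed.

Section Bounded.
Variables (K a : R).
Hypothesis a01 : 0 < a < 1.
Hypothesis TmK : forall n, `|Tm n| <= K * n.+1%:R `^ a.

Lemma Df_ps s0 rho : 0 < rho < complex.Re s0 - a ->
  exists A : nat -> R[i], ps_abs A rho /\
    forall z, cabs z <= rho -> hasS (dterm (s0 + z)) (Df (s0 + z)) /\
      ps_sum A z (Df (s0 + z)).
Proof.
move=> /andP[r0 rs]; have hr : a + complex.Re (1 - s0) + rho < 1.
  by rewrite cReD cReN /=; lra.
have [A [[U hU] hA]] := fterm_ps TmK (@one_h_dom R) (@one_h_le R) r0 hr.
have [B [[V hV] hB]] := fterm_ps TmK neg_h_dom neg_h_le r0 hr.
exists (fun k => A k + B k); split.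
  exists (U + V) => n.
  apply: (@le_trans _ _ (\sum_(k < n) (cabs (A k) * rho ^+ k + cabs (B k) * rho ^+ k))).
    by apply: ler_sum => k _; rewrite -mulrDl ler_wpM2r ?cabsD // exprn_ge0 // ltW.
  by rewrite big_split /= lerD ?hU ?hV.
move=> z zr; have [G1 h1 h1'] := hA z zr; have [G2 h2 h2'] := hB z zr.
have h3 : hasS (dterm (s0 + z)) (G1 + G2).
  have := hasSD h1 h2; apply: hasS_ext => n.
  by rewrite /dterm opprD addrA.
rewrite /Df (hasS_csum h3); split => //.
by have := hasSD h1' h2'; apply: hasS_ext => k; rewrite mulrDl.
Qed.

Lemma ctends0_pow (e : R) : e < 0 -> ctends (fun n => (n.+1%:R `^ e)%:C) (0 : R[i]).
Proof.
move=> e0 d d0; exists (Num.truncn (expR (ln d / e))) => n hn.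
rewrite subr0 cabs_real ger0_norm ?powR_ge0 // powR_nat.
rewrite -[ltRHS]lnK ?posrE // ltr_expR mulrC -ltr_ndivrMr //.
rewrite -ltr_expR lnK ?posrE //; apply: lt_le_trans (truncnS_gt _) _.
by rewrite ler_nat.
Qed.

(** The boundary terms of the summations by parts are [O(n ^ (1 + a - Re s))]. The half-plane where
    they vanish contains [2 + i t + x] for [x > 0], which is all that the uniqueness argument of
    [zf_Df] requires. *)
Lemma Df_eq s d : 1 + a < complex.Re s -> hasS (fun n => mu R n * cnp n (- s)) d ->
  hasS (dterm s) (Df s) -> Df s = d.
Proof.
move=> s1 hd hD; have K0 : 0 <= K by have := TmK 0; rewrite powR1 mulr1; exact: le_trans.
have h0 : ctends (fun n => (Tm n)%:C * cnp n.+1 (1 - s) - (Tm n.+1)%:C * cnp n (1 - s)) 0.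
  have hp : complex.Re (1 - s) + a < 0 by rewrite cReD cReN /=; lra.
  have := ctendsZ (3 * K)%:C (ctends0_pow hp); rewrite mulr0 => h e /h[N hN].
  exists N => n /hN; rewrite !subr0 cabsM !cabs_real !ger0_norm ?powR_ge0 ?mulr_ge0 //.
  apply: le_lt_trans; apply: le_trans (cabsB _ _) _.
  rewrite !cabsM !cabs_real !cabs_cnp.
  have E : n.+1%:R `^ (complex.Re (1 - s) + a) = n.+1%:R `^ complex.Re (1 - s) * n.+1%:R `^ a.
    by rewrite !powR_nat -expRD mulrDl.
  have h1 : n.+2%:R `^ complex.Re (1 - s) <= n.+1%:R `^ complex.Re (1 - s) :> R.
    rewrite !powR_nat ler_expR; apply: ler_wnM2l; first by have /andP[] := a01; rewrite cReD cReN /=; lra.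
    by rewrite ler_ln ?posrE // ler_nat.
  have h2 : n.+2%:R `^ a <= 2 * n.+1%:R `^ a :> R.
    apply: (@le_trans _ _ ((2 * n.+1%:R) `^ a)).
      apply: ge0_ler_powR; rewrite ?nnegrE ?mulr_ge0 //; first by case/andP: a01 => /ltW.
      by rewrite -natrM ler_nat; lia.
    rewrite powRM // ler_wpM2r ?powR_ge0 //.
    by rewrite -[leRHS]powRr1 // ler_powR ?ler1n //; case/andP: a01; lra.
  have h3 := TmK n; have h4 := TmK n.+1.
  have p1 : 0 <= n.+1%:R `^ complex.Re (1 - s) :> R by exact: powR_ge0.
  have p2 : 0 <= n.+2%:R `^ complex.Re (1 - s) :> R by exact: powR_ge0.
  have p3 : 0 <= n.+1%:R `^ a :> R by exact: powR_ge0.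
  rewrite E [leRHS](_ : _ = K * n.+1%:R `^ a * n.+1%:R `^ complex.Re (1 - s) +
    K * (2 * n.+1%:R `^ a) * n.+1%:R `^ complex.Re (1 - s)); last by ring.
  apply: lerD; first by apply: ler_pM; rewrite ?powR_ge0.
  apply: ler_wpM2r => //; apply: le_trans h4 _; exact: ler_wpM2l.
apply: hasS_unique hD _; have := ctendsD (ctends_shift 1 hd) h0.
rewrite addr0 => h e /h[N hN]; exists N.+1 => -[//|n] /hN; rewrite addn1.
by rewrite -Tm_abel.
Qed.

(** Both factors expand at [2 + i t] with any radius below [2 - a]. At small positive [x] the
    product is [(s - 1) zeta s] times [1 / zeta s], so by uniqueness its coefficients are those of
    [s - 1], and the identity holds in the whole disc. *)
Lemma zf_Df t z : cabs z < 2 - a ->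
  zf (2 +i* t + z) * Df (2 +i* t + z) = 1 +i* t + z.
Proof.
(* [1 - a] only keeps the radius positive when [z = 0]. *)
move=> za; pose rho := Num.max (cabs z) (1 - a).
have /andP[a0 a1] := a01.
have r0 : 0 < rho < 2 - a.
  apply/andP; split.
    by rewrite lt_max; apply/orP; right; lra.
  by rewrite gt_max za /=; lra.
have [|A [A1 hA]] := @zf_ps _ (2 +i* t) rho; first by rewrite /=; lra.
have [|B [B1 hB]] := @Df_ps (2 +i* t) rho; first by rewrite /=; lra.
have zr : cabs z <= rho by rewrite le_max lexx.
have hm y : cabs y <= rho ->
    ps_sum (conv A B) y (zf (2 +i* t + y) * Df (2 +i* t + y)).
  by move=> yr; have [_ hy] := hB _ yr; exact: ps_mul A1 B1 yr (hA _ yr) hy.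
have d0 : 0 < Num.min rho 1 by rewrite lt_min; lra.
have hAB : conv A B =1 lin (1 +i* t).
  apply: (@ps_uniq _ _ _ (Num.min rho 1) (fun x => 1 +i* t + x%:C)) => // [x|x _]; last first.
    exact: lin_sum.
  rewrite lt_min => /andP[x0 /andP[xr x1]].
  have xr' : cabs (x%:C : R[i]) <= rho by rewrite cabs_real gtr0_norm // ltW.
  have s1 : 1 < complex.Re (2 +i* t + x%:C) by rewrite /=; lra.
  have [Z hZ] : exists Z, hasS (fun n => cnp n (- (2 +i* t + x%:C))) Z.
    by apply: abs_hasS; exact: bsum_cnp.
  have [d hd Zd] := mu_zeta s1 hZ.
  have [hx _] := hB _ xr'.
  have -> : 1 +i* t + x%:C = zf (2 +i* t + x%:C) * Df (2 +i* t + x%:C).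
    rewrite (zf_zeta s1 hZ) (Df_eq _ hd hx); last by rewrite /=; lra.
    rewrite -mulrA Zd mulr1.
    by apply/eqP; rewrite eq_complex /=; apply/andP; split; apply/eqP; ring.
  exact: hm.
apply: hasS_unique (hm _ zr) _; have := lin_sum (1 +i* t) z.
by apply: hasS_ext => k; rewrite hAB.
Qed.

Lemma zf_neq0 s : a < complex.Re s < 4 - a -> s != 1 -> zf s != 0.
Proof.
case: s => x t /= xa s1; apply/negP => /eqP h0.
have := @zf_Df t (x - 2)%:C; rewrite cabs_real.
have -> : 2 +i* t + (x - 2)%:C = x +i* t.
  by apply/eqP; rewrite eq_complex /=; apply/andP; split; apply/eqP; ring.
rewrite h0 mul0r ltr_norml => /(_ ltac:(lra)) /esym/eqP.
rewrite (_ : 1 +i* t + (x - 2)%:C = x +i* t - 1) ?subr_eq0 ?(negbTE s1) //.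
by apply/eqP; rewrite eq_complex /=; apply/andP; split; apply/eqP; ring.
Qed.

(** At distance [d] from the line [Re s = a] the [n]-th term is [O(|Tm n| n ^ (- 1 - a - d))]. The
    first [N] terms are bounded uniformly in [d], the others add up to [e (1 + 1 / d)]; the leading
    factor 2 counts the two halves of [dterm]. *)
Lemma Df_bound (e : R) N (B : R) : 0 < e -> (forall n, (N <= n)%N -> `|Tm n| <= e * n.+1%:R `^ a) ->
  forall s d, complex.Re s = a + d -> 0 < d < 1 -> cabs (1 - s) <= B ->
   cabs (Df s) <= 2 * (fconst 2 * (1 + B) ^+ 2) * (\sum_(k < N) `|Tm k| + e * (1 + d^-1)).
Proof.
move=> e0 he s d sd d01 sB.
have [|A [_ hA]] := @Df_ps s (d / 2); first by rewrite sd; lra.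
have [|hD _] := hA 0; first by rewrite cabs0; lra.
rewrite addr0 in hD; apply: hasS_le hD _ => n.
have W : `|complex.Re (1 - s)| <= 2 by have /andP[] := a01; rewrite cReD cReN /= sd ler_norml; lra.
have f0 : 0 <= fconst 2 :> R by rewrite /fconst !addr_ge0 ?mulr_ge0 ?addr_ge0 ?expR_ge0.
have B0 : 0 <= B by exact: le_trans (cabs_ge0 _) sB.
have C0 : 0 <= 2 * (fconst 2 * (1 + B) ^+ 2) by rewrite !mulr_ge0 ?exprn_ge0 ?addr_ge0.
have d1 : 1 < 1 + d by lra.
apply: (@le_trans _ _ (\sum_(k < n) 2 * (fconst 2 * (1 + B) ^+ 2) *
   (`|Tm k| * (k < N)%:R + e * k.+1%:R `^ (- (1 + d))))).
  apply: ler_sum => k _; apply: le_trans (cabsD _ _) _.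
  have h1 := fterm_le Tm (@one_h_dom R) (@one_h_le R) k W.
  have h2 := fterm_le Tm neg_h_dom neg_h_le k W.
  apply: le_trans (lerD h1 h2) _; rewrite -[leLHS]mulr2n -[leLHS]mulr_natl -[leRHS]mulrA; apply: ler_wpM2l => //.
  have w0 : 0 <= 1 + cabs (1 - s) by rewrite addr_ge0 ?cabs_ge0.
  apply: ler_pM; do ?by rewrite mulr_ge0 ?powR_ge0 ?sqr_ge0.
    by apply: ler_wpM2l => //; rewrite lerXn2r ?nnegrE ?addr_ge0 ?cabs_ge0 // lerD2l.
  have -> : complex.Re (1 - s) - 2 = - (1 + d) - a by rewrite cReD cReN /= sd; ring.
  case: (leqP N k) => Nk.
    rewrite mulr0 add0r; apply: (@le_trans _ _ (e * k.+1%:R `^ a * k.+1%:R `^ (- (1 + d) - a))).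
      by rewrite ler_wpM2r ?powR_ge0 // he.
    rewrite -mulrA !powR_nat -expRD -mulrDl addrCA subrr addr0 //.
  rewrite mulr1; apply: (@le_trans _ _ (`|Tm k|)); last first.
    by rewrite lerDl mulr_ge0 ?powR_ge0 // ltW.
  rewrite ler_piMr // -[leRHS](powRr0 k.+1%:R) ler_powR ?ler1n //.
  by case/andP: a01; lra.
rewrite -mulr_sumr ler_wpM2l // big_split /= lerD //; last first.
  rewrite -mulr_sumr ler_wpM2l ?(ltW e0) //.
  by have := zeta_psum n d1; rewrite addrAC subrr add0r.
apply: (@le_trans _ _ (\sum_(k < n + N) `|Tm k| * (k < N)%:R)).
  by apply: (psum_mono (u := fun k => `|Tm k| * (k < N)%:R)) => [k|]; rewrite ?mulr_ge0 ?leq_addr.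
rewrite (psum_split (fun k => `|Tm k| * (k < N)%:R) (leq_addl n N)).
rewrite [X in _ + X]big_nat_cond [X in _ + X]big1 ?addr0 => [|k]; last first.
  by rewrite andbT => /andP[Nk _]; rewrite ltnNge Nk mulr0.
by apply: ler_sum => k _; rewrite ltn_ord mulr1.
Qed.

End Bounded.

End SmoothedMertens.

(** * Absence of zeros up to the boundary line *)

Section NoZeros.
Variable R : realType.
Variable zeta : R[i] -> R[i].
Hypothesis hzeta : is_riemann_zeta zeta.

Lemma zeta_neq0_gt1 (s : R[i]) : 1 < complex.Re s -> zeta s != 0.
Proof.
move=> s1; have [d _ h] := mu_zeta s1 (hasS_zeta hzeta s1).
by apply/negP => /eqP z0; move: h; rewrite z0 mul0r => /esym/eqP; rewrite oner_eq0.
Qed.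

(* On the line [Re s = a], a zero of [zeta] at [s] makes [zf (s + d)] of order
   [d], while [Df (s + d)] is [o(1 / d)], although their product is [s + d - 1]. *)
Lemma zeta_neq0_closed (a K : R) : 0 < a < 1 ->
  (forall n, `|Tm R n| <= K * n.+1%:R `^ a) ->
  (forall e, 0 < e -> exists N, forall n, (N <= n)%N -> `|Tm R n| <= e * n.+1%:R `^ a) ->
  forall s : R[i], s != 1 -> a <= complex.Re s -> zeta s != 0.
Proof.
move=> a01 TK Te s s1 sa; have /andP[a0 a1] := a01.
case: (ltP 1 (complex.Re s)) => [|s11]; first exact: zeta_neq0_gt1.
have s0 : 0 < complex.Re s by lra.
move: sa; rewrite le_eqVlt => /orP[/eqP sa|sa]; last first.
  have : zf s != 0 by apply: (zf_neq0 a01 TK) => //; rewrite sa /=; lra.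
  by rewrite (zf_eq hzeta s0 s1); apply: contraNneq => ->; rewrite mulr0.
apply/negP => /eqP zs0.
have [L [d' [d0 hL]]] := analytic_lip ((proj2 hzeta) _ s1).
pose B := cabs (1 - s) + 1; pose Q : R := 2 * (fconst 2 * (1 + B) ^+ 2).
have B0 : 0 <= B by rewrite addr_ge0 ?cabs_ge0.
have f0 : 0 <= fconst 2 :> R by rewrite /fconst !addr_ge0 ?mulr_ge0 ?addr_ge0 ?expR_ge0.
have Q0 : 0 <= Q by rewrite /Q mulr_ge0 // mulr_ge0 // sqr_ge0.
(* With this [e], and [d] so small that [d S <= e], the product [|zeta s'| |Df s'|], which is 1, is
   at most [3 P e = 3/4]. The other bounds on [d] keep [s'] away from 1 and inside the Lipschitz
   disc. *)
pose P := `|L| * Q + 1; have P0 : 0 < P by rewrite ltr_wpDl // mulr_ge0.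
pose e := (4 * P)^-1; have e0 : 0 < e by rewrite invr_gt0 mulr_gt0.
have [N hN] := Te e e0.
pose S := \sum_(k < N) `|Tm R k|; have S0 : 0 <= S by apply: sumr_ge0.
pose d := Num.min (Num.min ((1 - a) / 2) (d' / 2)) (e / (S + 1)).
have S1 : 0 < S + 1 by lra.
have dp : 0 < d by rewrite !lt_min !divr_gt0 // subr_gt0.
have [d1 dd de] : [/\ d <= (1 - a) / 2, d <= d' / 2 & d <= e / (S + 1)].
  by rewrite /d !ge_min !lexx !orbT.
pose s' := s + d%:C.
have sd : complex.Re s' = a + d by rewrite cReD sa.
have hs' : cabs (s' - s) = d by rewrite addrC addKr cabs_real gtr0_norm.
have := hL s'; rewrite hs' zs0 subr0 => /(_ ltac:(lra)) hz.
have s'1 : s' != 1.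
  apply/negP => /eqP/(congr1 (@complex.Re R)); rewrite sd /=; lra.
have s'B : cabs (1 - s') <= B.
  rewrite /B -[1 - s'](_ : (1 - s) - (s' - s) = _); last by ring.
  by apply: le_trans (cabsB _ _) _; rewrite hs' lerD2l; lra.
have dd1 : 0 < d < 1 by rewrite dp /=; lra.
have hD := Df_bound a01 TK e0 hN sd dd1 s'B; rewrite -/Q -/S in hD.
have hprod : zeta s' * Df s' = 1.
  have := @zf_Df R K a a01 TK (complex.Im s) (a + d - 2)%:C.
  rewrite (_ : _ + _ = s'); last first.
    rewrite /s'; move: sa; case: (s) => x y /= <-.
    by apply/eqP; rewrite eq_complex /=; apply/andP; split; apply/eqP; ring.
  rewrite (_ : _ + (a + d - 2)%:C = s' - 1); last first.
    rewrite /s'; move: sa; case: (s) => x y /= <-.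
    by apply/eqP; rewrite eq_complex /=; apply/andP; split; apply/eqP; ring.
  rewrite (zf_eq hzeta) //; last by rewrite sd; lra.
  rewrite cabs_real ltr_norml => /(_ ltac:(lra)).
  rewrite -mulrA -[X in _ = X -> _]mulr1; apply: mulfI.
  by rewrite subr_eq0.
have := congr1 (@cabs R) hprod; rewrite cabsM cabs1 => h1.
have : cabs (zeta s') * cabs (Df s') <= (`|L| * d) * (Q * (S + e * (1 + d^-1))).
  apply: ler_pM; rewrite ?cabs_ge0 //.
  by apply: le_trans hz _; rewrite ler_wpM2r ?ler_norm // ltW.
rewrite h1; have -> : (`|L| * d) * (Q * (S + e * (1 + d^-1))) =
    (`|L| * Q) * (d * S + d * e + e) by field; rewrite gt_eqF.
have dS : d * S <= e.
  apply: (@le_trans _ _ (d * (S + 1))); first by rewrite ler_wpM2l ?(ltW dp) // lerDl.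
  by rewrite -ler_pdivlMr.
have eP : P * e = 4^-1 by rewrite /e; field; rewrite gt_eqF.
have : (`|L| * Q) * (d * S + d * e + e) <= P * (3 * e).
  have q0 : 0 <= d * S + d * e + e.
    have := mulr_ge0 (ltW dp) S0; have := mulr_ge0 (ltW dp) (ltW e0); lra.
  have q1 : d * e <= e by rewrite ger_pMl //; lra.
  apply: ler_pM => //; [exact: mulr_ge0|by rewrite /P lerDl|lra].
rewrite [P * (3 * e)]mulrCA eP; lra.
Qed.

End NoZeros.

(** * Coefficients of the reciprocal of a power series *)

Section SymmetricFunctions.
Variable C : comNzRingType.
Implicit Types (xs : seq C) (x z : C).

Definition prodX xs z := \prod_(x <- xs) (1 - x * z).

Definition psumX xs k := \sum_(x <- xs) x ^+ k.

(** The complete homogeneous symmetric functions, that is, the coefficients of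
    [1 / prod_x (1 - x z)]. *)
Fixpoint hX xs k : C :=
  if xs is x :: xs' then \sum_(i < k.+1) x ^+ (k - i) * hX xs' i else (k == 0%N)%:R.

Lemma hX0 xs : hX xs 0 = 1.
Proof. by elim: xs => [//|x xs IH] /=; rewrite big_ord1 subnn mul1r. Qed.

Lemma hXS x xs k : hX (x :: xs) k.+1 = hX xs k.+1 + x * hX (x :: xs) k.
Proof.
rewrite /= big_ord_recr /= subnn mul1r addrC mulr_sumr; congr (_ + _).
by apply: eq_bigr => i _; rewrite mulrA -exprS subSn // -ltnS.
Qed.

Lemma hX_nil k : hX [::] k = (k == 0%N)%:R.
Proof. by []. Qed.

#[local] Arguments hX xs k : simpl never.

Lemma psumX_cons x xs k : psumX (x :: xs) k = x ^+ k + psumX xs k.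
Proof. by rewrite /psumX big_cons. Qed.

(** Newton's identities: the logarithmic derivative of [1 / prod_x (1 - x z)] read off coefficient
    by coefficient. *)
Lemma hX_rec xs k : k.+1%:R * hX xs k.+1 = \sum_(j < k.+1) psumX xs j.+1 * hX xs (k - j)%N.
Proof.
elim: xs k => [|x xs IH] k.
  by rewrite hX_nil mulr0 big1 // => j _; rewrite /psumX big_nil mul0r.
elim: k => [|k IHk].
  have := IH 0%N; rewrite !big_ord1 hXS !hX0 !mulr1 !mul1r psumX_cons expr1 => ->.
  by rewrite addrC.
have -> : \sum_(j < k.+2) psumX (x :: xs) j.+1 * hX (x :: xs) (k.+1 - j)%N =
    \sum_(j < k.+2) psumX xs j.+1 * hX (x :: xs) (k.+1 - j)%N +
    \sum_(j < k.+2) x ^+ j.+1 * hX (x :: xs) (k.+1 - j)%N.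
  by rewrite -big_split; apply: eq_bigr => j _; rewrite psumX_cons mulrDl addrC.
have -> : \sum_(j < k.+2) x ^+ j.+1 * hX (x :: xs) (k.+1 - j)%N =
    x * hX (x :: xs) k.+1 + x * \sum_(j < k.+1) x ^+ j.+1 * hX (x :: xs) (k - j)%N.
  rewrite big_ord_recl /= subn0 expr1 [X in _ = _ + X]mulr_sumr; congr (_ + _).
  by apply: eq_bigr => j _; rewrite /bump /= ?add1n subSS [in LHS]exprS mulrA.
have -> : \sum_(j < k.+2) psumX xs j.+1 * hX (x :: xs) (k.+1 - j)%N =
    \sum_(j < k.+2) psumX xs j.+1 * hX xs (k.+1 - j)%N +
    x * \sum_(j < k.+1) psumX xs j.+1 * hX (x :: xs) (k - j)%N.
  rewrite big_ord_recr [in RHS]big_ord_recr /= subnn !hX0 addrAC mulr_sumr -big_split /=.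
  congr (_ + _); apply: eq_bigr => j _; rewrite subSn -1?ltnS // hXS mulrDr; ring.
rewrite -IH.
have -> : forall a b c d : C, a + x * b + (c + x * d) = a + c + x * (d + b) by move=> *; ring.
rewrite -big_split /=.
rewrite (eq_bigr (fun j : 'I_k.+1 => psumX (x :: xs) j.+1 * hX (x :: xs) (k - j)%N)); last first.
  by move=> j _; rewrite psumX_cons mulrDl.
by rewrite -IHk hXS -[k.+2%:R]natr1; ring.
Qed.

Definition polX xs : {poly C} := \prod_(x <- xs) (1 - x *: 'X).

Lemma polX_horner xs z : (polX xs).[z] = prodX xs z.
Proof.
rewrite /polX /prodX horner_prod; apply: eq_bigr => x _.
by rewrite hornerE hornerE !hornerE.
Qed.

Lemma coef_polX_cons x xs k : (polX (x :: xs))`_k.+1 = (polX xs)`_k.+1 - x * (polX xs)`_k.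
Proof.
rewrite /polX big_cons mulrBl mul1r coefB; congr (_ - _).
by rewrite -scalerAl coefZ coefXM.
Qed.

Lemma coef_polX0 xs : (polX xs)`_0 = 1.
Proof. by rewrite -horner_coef0 polX_horner /prodX big1 // => x _; rewrite mulr0 subr0. Qed.

Lemma hX_conv xs k : \sum_(i < k.+1) hX xs i * (polX xs)`_(k - i) = (k == 0%N)%:R.
Proof.
elim: xs k => [|x xs IH] [|k]; try by rewrite big_ord1 hX0 coef_polX0 mulr1.
  rewrite big_ord_recl /= /polX big_nil coef1 /= mulr0 add0r big1 // => i _.
  by rewrite hX_nil mul0r.
rewrite -[RHS](IH k.+1) [LHS]big_ord_recr [RHS]big_ord_recr /= !subnn !coef_polX0 !mulr1.
have h (i : 'I_k.+1) : (polX (x :: xs))`_(k.+1 - i) =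
    (polX xs)`_(k.+1 - i) - x * (polX xs)`_(k - i).
  by rewrite subSn -1?ltnS // coef_polX_cons.
under eq_bigr do rewrite h mulrBr.
rewrite sumrB hXS addrACA.
have -> : \sum_(i < k.+1) hX (x :: xs) i * (polX xs)`_(k.+1 - i) =
    \sum_(i < k.+1) hX xs i * (polX xs)`_(k.+1 - i) +
    x * \sum_(i < k) hX (x :: xs) i * (polX xs)`_(k - i).
  rewrite big_ord_recl [in RHS]big_ord_recl !hX0 -addrA; congr (_ + _).
  rewrite mulr_sumr -big_split; apply: eq_bigr => i _; rewrite /bump /= ?add1n subSS.
  by rewrite hXS mulrDl mulrA.
have -> : \sum_(i < k.+1) hX (x :: xs) i * (x * (polX xs)`_(k - i)) =
    x * (\sum_(i < k) hX (x :: xs) i * (polX xs)`_(k - i) + hX (x :: xs) k).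
  transitivity (\sum_(i < k.+1) x * (hX (x :: xs) i * (polX xs)`_(k - i))).
    by apply: eq_bigr => i _; ring.
  by rewrite -mulr_sumr big_ord_recr /= subnn coef_polX0 mulr1.
ring.
Qed.

(** The coefficients of [1 / f] up to [N] depend only on those of [f] up to [N], so a polynomial
    truncation may stand for [f]. *)
Lemma recip_uniq (e f : nat -> C) xs N : f 0%N = 1 ->
  (forall k, \sum_(i < k.+1) e i * f (k - i)%N = (k == 0%N)%:R) ->
  (forall k, (k <= N)%N -> f k = (polX xs)`_k) ->
  forall k, (k <= N)%N -> e k = hX xs k.
Proof.
move=> f0 ef fP; elim/ltn_ind => k IH kN.
have := ef k; rewrite -(hX_conv xs k) !big_ord_recr /= !subnn f0 coef_polX0 !mulr1.
rewrite (eq_bigr (fun i : 'I_k => hX xs i * (polX xs)`_(k - i))) => [/addrI //|i _].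
by rewrite IH ?fP // ?(leq_trans (leq_subr _ _)) // (leq_trans (ltnW (ltn_ord i))).
Qed.

End SymmetricFunctions.
Arguments hX {C} xs k : simpl never.

(** * Averages over roots of unity and trigonometric polynomials bounded below *)

Section TrigonometricCoefficients.
Variable R : realType.
Implicit Types (z w v : R[i]) (A : R).

Lemma cexp_imagX (x : R) j : cexp (0 +i* x) ^+ j = cexp (0 +i* (x * j%:R)).
Proof.
rewrite -cexpMn; congr cexp; rewrite -(rmorph_nat (real_complex R)).
by apply/eqP; rewrite eq_complex cReM cImM /=; apply/andP; split; apply/eqP; ring.
Qed.

Lemma unity_cexp m (z := cexp (0 +i* (pi *+ 2 / m%:R : R))) : (0 < m)%N ->
  z ^+ m = 1 /\ forall j, (0 < j < m)%N -> z ^+ j != 1.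
Proof.
move=> m0; have m0' : 0 < (m%:R : R) by rewrite ltr0n.
rewrite /z; split.
  rewrite cexp_imagX divfK ?gt_eqF // /cexp /= cos2pi sin2pi expR0 mulr1 mulr0.
  by apply/eqP; rewrite eq_complex /= !eqxx.
move=> j /andP[j0 jm]; rewrite cexp_imagX; apply: cexp_lt_pi2.
have p2 : 0 < (pi *+ 2 : R) by rewrite pmulrn_rgt0 // pi_gt0.
by rewrite mulrAC ltr_pdivrMr // divr_gt0 ?mulr_gt0 ?ltr0n //= ltr_pM2l ?ltr_nat.
Qed.

Lemma unity_root m : (0 < m)%N -> exists zeta : R[i], [/\ cabs zeta = 1, zeta ^+ m = 1 &
  forall j, (0 < j < m)%N -> zeta ^+ j != 1].
Proof.
move=> /unity_cexp[h1 h2]; exists (cexp (0 +i* (pi *+ 2 / m%:R : R))); split => //.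
by rewrite cabs_cexp /= expR0.
Qed.

(** Exponents up to [2 m] occur because conjugates are written as powers [m - i]; in this range [m]
    is the only multiple of [m]. *)
Lemma unity_sum (zeta : R[i]) m : zeta ^+ m = 1 -> (forall j, (0 < j < m)%N -> zeta ^+ j != 1) ->
  forall j, (0 < j < m + m)%N -> j != m -> \sum_(l < m) (zeta ^+ l) ^+ j = 0.
Proof.
move=> zm zn j /andP[j0 jm] jnm.
have hj : zeta ^+ j != 1.
  case: (ltngtP j m) => h; first by apply: zn; rewrite j0.
    by rewrite -(subnK (ltnW h)) exprD zm mulr1 zn // subn_gt0 h /=; lia.
  by rewrite h eqxx in jnm.
have : (zeta ^+ j - 1) * \sum_(l < m) (zeta ^+ j) ^+ l = 0.
  by rewrite -subrX1 -exprM mulnC exprM zm expr1n subrr.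
move/eqP; rewrite mulf_eq0 subr_eq0 (negbTE hj) /= => /eqP h.
by rewrite -[RHS]h; apply: eq_bigr => l _; rewrite -!exprM mulnC.
Qed.

Lemma conjc_unit z : cabs z = 1 -> conjc z = z^-1.
Proof.
by move=> z1; rewrite invc_norm normC_cabs z1 expr1n invr1 mul1r.
Qed.

Lemma cRe_scale (x : R) z : complex.Re (x%:C * z) = x * complex.Re z.
Proof. by rewrite cReM /= mul0r subr0. Qed.

Lemma ReM_conj z w : complex.Re z * complex.Re w =
  2^-1 * (complex.Re (z * w) + complex.Re (z * conjc w)).
Proof. by case: z => a b; case: w => c d /=; field. Qed.

(* Test against the positive kernel [1 + Re (v w ^ - (k + 1))] at roots of unity. *)
Lemma trig_coef (b : nat -> R[i]) n A :
  (forall w, cabs w = 1 -> 0 <= A + complex.Re (\sum_(i < n) b i * w ^+ i.+1)) ->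
  forall k, (k < n)%N -> cabs (b k) <= 2 * A.
Proof.
move=> hb k kn; pose m := (n + n).+1.
have [zeta [z1 zm zn]] := @unity_root m isT.
have hS := unity_sum zm zn.
have zl l : cabs (zeta ^+ l) = 1 by rewrite cabsX z1 expr1n.
have key v : cabs v = 1 -> 0 <= A + 2^-1 * complex.Re (b k * v).
  move=> v1.
  have pos l : 0 <= (A + complex.Re (\sum_(i < n) b i * (zeta ^+ l) ^+ i.+1)) *
      (1 + complex.Re (v * (zeta ^+ l) ^+ (m - k.+1))).
    apply: mulr_ge0; first exact: hb.
    have := normr_Re_cabs (v * (zeta ^+ l) ^+ (m - k.+1)).
    by rewrite cabsM cabsX v1 zl expr1n mulr1 ler_norml => /andP[]; lra.
  have : 0 <= \sum_(l < m) ((A + complex.Re (\sum_(i < n) b i * (zeta ^+ l) ^+ i.+1)) *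
      (1 + complex.Re (v * (zeta ^+ l) ^+ (m - k.+1)))) by apply: sumr_ge0.
  have E l : (A + complex.Re (\sum_(i < n) b i * (zeta ^+ l) ^+ i.+1)) *
      (1 + complex.Re (v * (zeta ^+ l) ^+ (m - k.+1))) =
      A + complex.Re (A%:C * v * (zeta ^+ l) ^+ (m - k.+1) +
        \sum_(i < n) b i * (zeta ^+ l) ^+ i.+1 +
        2^-1%:C * (\sum_(i < n) b i * v * (zeta ^+ l) ^+ (i.+1 + (m - k.+1)) +
          \sum_(i < n) b i * conjc v * (zeta ^+ l) ^+ (i.+1 + k.+1))).
    set c := v * _; set S := \sum_(i < n) b i * _.
    have e0 : A%:C * v * (zeta ^+ l) ^+ (m - k.+1) = A%:C * c by rewrite /c mulrA.
    have e1 : \sum_(i < n) b i * v * (zeta ^+ l) ^+ (i.+1 + (m - k.+1)) = S * c.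
      by rewrite /S mulr_suml; apply: eq_bigr => i _; rewrite exprD /c; ring.
    have e2 : \sum_(i < n) b i * conjc v * (zeta ^+ l) ^+ (i.+1 + k.+1) = S * conjc c.
      rewrite /S mulr_suml; apply: eq_bigr => i _; rewrite exprD.
      have -> : conjc c = conjc v * (zeta ^+ l) ^+ k.+1; last by ring.
      have z0 : (zeta ^+ l) ^+ (m - k.+1) != 0 by rewrite -cabs_gt0 cabsX zl expr1n.
      rewrite /c rmorphM rmorphXn /= [conjc (zeta ^+ l)]conjc_unit //; congr (_ * _).
      rewrite exprVn; apply: (mulfI z0); rewrite divff // -exprD subnK; last by rewrite /m; lia.
      by rewrite -exprM mulnC exprM zm expr1n.
    rewrite e0 e1 e2.
    transitivity (A + A * complex.Re c + complex.Re S + complex.Re S * complex.Re c); first by ring.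
    by rewrite ReM_conj !cReD !cRe_scale !cReD; ring.
  rewrite (eq_bigr _ (fun (l : 'I_m) _ => E l)) big_split /= sumr_const card_ord -cRe_sum.
  rewrite !big_split /= -!mulr_sumr big_split /=.
  rewrite hS ?mulr0 ?add0r; [|rewrite /m; lia|rewrite /m; lia].
  rewrite exchange_big /= big1 ?add0r; last first.
    by move=> i _; rewrite -mulr_sumr hS ?mulr0 //; rewrite /m; have := ltn_ord i; lia.
  rewrite [X in _ * (_ + X)]exchange_big /= [X in _ * (_ + X)]big1 ?addr0; last first.
    by move=> i _; rewrite -mulr_sumr hS ?mulr0 //; rewrite /m; have := ltn_ord i; lia.
  rewrite exchange_big /= (bigD1 (Ordinal kn)) //= [X in _ * (_ + X)]big1 ?addr0; last first.
    move=> i ik; rewrite -mulr_sumr hS ?mulr0 //.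
      by rewrite /m; have := ltn_ord i; lia.
    by have : (i : nat) != k by []; rewrite /m; lia.
  rewrite (_ : k.+1 + (m - k.+1) = m)%N; last by rewrite /m; lia.
  rewrite (eq_bigr (fun=> b k * v)); last first.
    by move=> l _; rewrite -exprM mulnC exprM zm expr1n mulr1.
  rewrite sumr_const card_ord -[_ *+ m]mulr_natl -[X in 0 <= _ + complex.Re (_ * X)]mulr_natl.
  rewrite -(rmorph_nat (real_complex R)) mulrCA cReM /= mul0r subr0 cReM /= mul0r subr0.
  by rewrite -mulrDr pmulr_rge0 // ltr0n.
have [bk|bk] := eqVneq (b k) 0.
  have /hb : cabs (1 : R[i]) = 1 by exact: cabs1.
  have := key 1 (cabs1 _); rewrite bk mul0r cabs0 /= mulr0 addr0; lra.
(* The phase for which [b k * v = - |b k|]; [key] then reads [|b k| <= 2 A]. *)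
pose v := - conjc (b k) / (cabs (b k))%:C.
have bk0 : 0 < cabs (b k) by rewrite cabs_gt0.
have cj : cabs (conjc (b k)) = cabs (b k).
  by rewrite !cabsE; case: (b k) => x y /=; rewrite sqrrN.
have v1 : cabs v = 1.
  by rewrite /v cabsM cabsN cj cabsV cabs_real gtr0_norm // divff // gt_eqF.
have := key v v1.
have -> : b k * v = (- cabs (b k))%:C.
  rewrite /v mulrA mulrN -sqr_normc normC_cabs expr2 mulNr mulfK ?rmorphN //.
  by rewrite eq_complex /= gt_eqF.
rewrite /=; lra.
Qed.

End TrigonometricCoefficients.

(** * The truncated series of [ln |1 - w|] *)

Section LogarithmBound.
Variable R : realType.
Implicit Types (z w : R[i]) (A t : R).

Lemma mvt01 (f df : R -> R) : (forall x : R, 0 <= x <= 1 -> is_derive x 1 f (df x)) ->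
  exists2 c, 0 <= c <= 1 & f 1 - f 0 = df c.
Proof.
move=> hf; have [||c] := @MVT_segment R f df 0 1 ler01.
- by move=> x; rewrite in_itv /= => /andP[x0 x1]; apply: hf; rewrite !ltW.
- apply: derivable_within_continuous => x; rewrite in_itv /= => /hf h.
  exact: ex_derive.
by rewrite in_itv /= subr0 mulr1 => c01 ->; exists c.
Qed.

Lemma cabs1B_sqr w t : cabs (1 - t%:C * w) ^+ 2 =
  1 - t * (complex.Re w *+ 2) + t ^+ 2 * (complex.Re w ^+ 2 + complex.Im w ^+ 2).
Proof. by rewrite cabs_sqr; case: w => x y /=; ring. Qed.

(** The mean value theorem on [[0, 1]] for [t -> ln |1 - t w| + Re sum_i (t w) ^ i / i], which is 0
    at 0: its derivative telescopes to [- Re (w (t w) ^ n / (1 - t w))]. The logarithm is taken of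
    the polynomial [Q = |1 - t w| ^ 2]. *)
Lemma ln1_lower w n : cabs w < 1 ->
  - complex.Re (\sum_(i < n) w ^+ i.+1 / i.+1%:R) - cabs w ^+ n.+1 / (1 - cabs w)
  <= ln (cabs (1 - w)).
Proof.
move=> w1; set r := cabs w; have r0 : 0 <= r := cabs_ge0 w; rewrite -/r in w1.
pose Q : {poly R} := 1%:P - (complex.Re w *+ 2) *: 'X + (complex.Re w ^+ 2 + complex.Im w ^+ 2) *: 'X^2.
pose P : {poly R} := \sum_(i < n) (complex.Re (w ^+ i.+1) / i.+1%:R) *: 'X^(i.+1).
have QE t : Q.[t] = cabs (1 - t%:C * w) ^+ 2.
  rewrite cabs1B_sqr /Q hornerD hornerD hornerN hornerC !hornerZ hornerX hornerXn; ring.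
have pos t : 0 <= t <= 1 -> 1 - r <= cabs (1 - t%:C * w).
  move=> /andP[t0 t1]; have := cabs_subr_ge 1 (t%:C * w).
  by rewrite cabs1 cabsM cabs_real ger0_norm // -/r; nra.
have Q0 t : 0 <= t <= 1 -> 0 < Q.[t].
  by move=> /pos h; rewrite QE exprn_gt0 //; lra.
pose f t := 2^-1 * ln Q.[t] + P.[t].
pose df t := 2^-1 * (Q^`().[t] * Q.[t]^-1) + P^`().[t].
have hf t : 0 <= t <= 1 -> is_derive t 1 f (df t).
  move=> ht; have q0 := Q0 _ ht.
  have h1 : is_derive t 1 (fun t => ln Q.[t]) (Q^`().[t] * Q.[t]^-1).
    apply: (is_derive_eq (@is_derive1_comp R (@ln R) (horner Q) t _ _ (is_derive1_ln q0)
      (is_derive_poly Q t))).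
    by rewrite mulrC.
  by apply: is_deriveD.
have [c c01] := mvt01 hf.
have -> : f 1 - f 0 = ln (cabs (1 - w)) + complex.Re (\sum_(i < n) w ^+ i.+1 / i.+1%:R).
  rewrite /f; have -> : P.[1] = complex.Re (\sum_(i < n) w ^+ i.+1 / i.+1%:R).
    rewrite /P horner_sum cRe_sum; apply: eq_bigr => i _.
    rewrite hornerZ hornerXn expr1n mulr1 -(rmorph_nat (real_complex R)) -fmorphV.
    by rewrite [X in _ = complex.Re X]mulrC cRe_scale mulrC.
  have -> : P.[0] = 0.
    by rewrite /P horner_sum big1 // => i _; rewrite hornerZ hornerXn expr0n mulr0.
  rewrite !QE mul0r subr0 cabs1 expr1n ln1 mulr0 addr0 subr0 mul1r lnXn; last first.
    by have := pos 1; rewrite mul1r ler01 lexx => /(_ isT); lra.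
  by congr (_ + _); move: (ln _) => y; field.
move=> hfc; suff : - (r ^+ n.+1 / (1 - r)) <= df c by rewrite -hfc; lra.
have c0 := pos _ c01; case/andP: c01 => c00 c1.
have n0 : 1 - c%:C * w != 0 by rewrite -cabs_gt0; apply: lt_le_trans c0; lra.
have -> : df c = complex.Re (- (w * (c%:C * w) ^+ n / (1 - c%:C * w))).
  have -> : - (w * (c%:C * w) ^+ n / (1 - c%:C * w)) =
     - w / (1 - c%:C * w) + w * \sum_(i < n) (c%:C * w) ^+ i.
    have := @subrX1 _ (c%:C * w) n => h.
    have -> : \sum_(i < n) (c%:C * w) ^+ i = (1 - (c%:C * w) ^+ n) / (1 - c%:C * w).
      apply: (mulfI n0); rewrite [RHS]mulrC divfK // -[LHS]opprK -mulNr opprB -h; ring.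
    by field.
  rewrite cReD /df; congr (_ + _).
    have -> : - w / (1 - c%:C * w) = (Q.[c]^-1)%:C * (- w * conjc (1 - c%:C * w)).
      rewrite QE fmorphV rmorphXn /= -normC_cabs sqr_normc.
      have : conjc (1 - c%:C * w) != 0 by rewrite conjc_eq0.
      move: n0; set u := 1 - _; move: (conjc u) => v u0 v0; field.
      by rewrite u0 v0.
    rewrite cRe_scale mulrA mulrC; congr (_ * _).
    rewrite /Q derivD derivB derivC !derivZ derivX derivXn /= hornerD hornerD hornerN horner0.
    by rewrite !hornerZ hornerC hornerMn hornerX /=; case: (w) => x y /=; field.
  rewrite /P raddf_sum horner_sum /= mulr_sumr cRe_sum; apply: eq_bigr => i _.
  rewrite derivZ derivXn hornerZ hornerMn hornerXn /=.
  rewrite [c ^+ i *+ i.+1](_ : _ = c ^+ i * i.+1%:R); last by rewrite mulr_natr.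
  rewrite mulrACA mulVf ?pnatr_eq0 // mulr1.
  by rewrite exprMn mulrCA -exprS -rmorphXn cRe_scale mulrC.
apply: (@le_trans _ _ (- cabs (w * (c%:C * w) ^+ n / (1 - c%:C * w)))); last first.
  rewrite cReN lerN2; exact: Re_le_cabs.
rewrite lerN2 !cabsM cabsV cabsX cabsM cabs_real ger0_norm // -/r exprS -!mulrA.
apply: ler_wpM2l => //; apply: ler_pM; rewrite ?exprn_ge0 ?mulr_ge0 ?invr_ge0 ?cabs_ge0 //.
  by rewrite lerXn2r ?nnegrE ?mulr_ge0 // ler_piMl.
by rewrite lef_pV2 ?posrE //; lra.
Qed.

End LogarithmBound.

(** * The inequality of Borel and Caratheodory, and reciprocals *)

Section BorelCaratheodory.
Variable R : realType.
Implicit Types (z w : R[i]) (A r t : R) (xs : seq R[i]).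

Lemma geom_small r e : 0 <= r < 1 -> 0 < e -> exists N, forall n, (N <= n)%N -> r ^+ n < e.
Proof.
move=> /andP[r0 r1] e0.
have /cvgrPdist_lt/(_ _ e0)[N _ hN] : (fun n => r ^+ n) @ \oo --> (0 : R).
  by apply: cvg_expr; rewrite ger0_norm.
by exists N => n /hN /=; rewrite sub0r normrN ger0_norm // exprn_ge0.
Qed.

Lemma ln_prodX xs z : (forall x, x \in xs -> cabs (x * z) < 1) ->
  ln (cabs (prodX xs z)) = \sum_(x <- xs) ln (cabs (1 - x * z)).
Proof.
have pos x : cabs (x * z) < 1 -> 0 < cabs (1 - x * z).
  by move=> h; have := cabs_subr_ge 1 (x * z); rewrite cabs1; lra.
elim: xs => [|x xs IH] h; first by rewrite /prodX !big_nil cabs1 ln1.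
have hx : forall y, y \in xs -> cabs (y * z) < 1 by move=> y hy; apply: h; rewrite inE hy orbT.
rewrite big_cons -IH // /prodX big_cons cabsM lnM ?posrE //.
  by apply: pos; apply: h; rewrite inE eqxx.
rewrite cabs_prod; elim: xs hx {IH h} => [|y ys IH] h; first by rewrite big_nil.
rewrite big_cons mulr_gt0 ?IH // => [|u hu]; last by apply: h; rewrite inE hu orbT.
by apply: pos; apply: h; rewrite inE eqxx.
Qed.

Lemma tails_small xs (rho : R) e : (forall x, x \in xs -> cabs x * rho < 1) -> 0 <= rho -> 0 < e ->
  exists N, forall n, (N <= n)%N ->
   \sum_(x <- xs) (cabs x * rho) ^+ n.+1 / (1 - cabs x * rho) < e.
Proof.
move=> + r0; elim: xs e => [|x xs IH] e h e0.
  by exists 0%N => n _; rewrite big_nil.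
have e2 : 0 < e / 2 by rewrite divr_gt0.
have [|N hN] := IH _ _ e2; first by move=> y hy; apply: h; rewrite inE hy orbT.
have x1 : cabs x * rho < 1 by apply: h; rewrite inE eqxx.
have [||N' hN'] := @geom_small (cabs x * rho) (e / 2 * (1 - cabs x * rho)).
- by rewrite mulr_ge0 ?cabs_ge0.
- by rewrite mulr_gt0 // subr_gt0.
exists (maxn N N') => n; rewrite geq_max => /andP[/hN h1 h2].
have := hN' n.+1 (leqW h2); rewrite -ltr_pdivrMr ?subr_gt0 // => h3.
by rewrite big_cons; lra.
Qed.

(** By [ln1_lower], [ln |prodX xs z|] is at least [- Re sum_i p_i z ^ i / i] up to a small tail,
    with [p_i] the power sums. So the upper bound [A] bounds a trigonometric polynomial from below,
    and [trig_coef] bounds its coefficients. If the claim failed, the gap would leave room for the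
    tail. *)
Lemma borel_caratheodory xs (rho A : R) : 0 < rho ->
  (forall x, x \in xs -> cabs x * rho < 1) ->
  (forall z, cabs z = rho -> cabs (prodX xs z) <= expR A) ->
  forall k, cabs (psumX xs k.+1) * rho ^+ k.+1 <= 2 * A * k.+1%:R.
Proof.
move=> r0 hx hA k.
pose b i := psumX xs i.+1 * rho%:C ^+ i.+1 / i.+1%:R.
have k0 : 0 < (k.+1%:R : R) by [].
have hb : cabs (b k) = cabs (psumX xs k.+1) * rho ^+ k.+1 / k.+1%:R.
  by rewrite /b !cabsM cabsX cabs_real gtr0_norm // cabsV cabs_nat.
rewrite -ler_pdivrMr // -hb leNgt; apply/negP => hlt.
have e0 : 0 < (cabs (b k) - 2 * A) / 2 by rewrite divr_gt0 // subr_gt0.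
have [N hN] := tails_small hx (ltW r0) e0.
pose n := maxn N k.+1; pose tau := \sum_(x <- xs) (cabs x * rho) ^+ n.+1 / (1 - cabs x * rho).
have htau : tau < (cabs (b k) - 2 * A) / 2 by apply: hN; rewrite leq_maxl.
have : cabs (b k) <= 2 * (A + tau).
  apply: (@trig_coef _ b n); last by rewrite leq_maxr.
  move=> w w1; have zr : cabs (rho%:C * w) = rho by rewrite cabsM w1 cabs_real mulr1 gtr0_norm.
  have := hA _ zr => h1.
  have xz x : x \in xs -> cabs (x * (rho%:C * w)) < 1 by move=> /hx; rewrite cabsM zr.
  have : \sum_(x <- xs) (- complex.Re (\sum_(i < n) (x * (rho%:C * w)) ^+ i.+1 / i.+1%:R)
      - (cabs x * rho) ^+ n.+1 / (1 - cabs x * rho)) <= ln (cabs (prodX xs (rho%:C * w))).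
    rewrite ln_prodX // !big_seq; apply: ler_sum => x xs_x.
    by have := ln1_lower n (xz x xs_x); rewrite cabsM zr.
  rewrite big_split /= !sumrN -/tau -cRe_sum exchange_big /=.
  rewrite (eq_bigr (fun i : 'I_n => b i * w ^+ i.+1)); last first.
    move=> i _; rewrite /b /psumX !mulr_suml; apply: eq_bigr => x _.
    by rewrite !exprMn; ring.
  have : ln (cabs (prodX xs (rho%:C * w))) <= A.
    case: (ltP 0 (cabs (prodX xs (rho%:C * w)))) => h2.
      by rewrite -ler_expR lnK ?posrE.
    have := ln_prodX xz; have : prodX xs (rho%:C * w) != 0.
      rewrite /prodX prodf_seq_neq0; apply/allP => x /xz h3 /=.
      rewrite subr_eq0; apply/negP => /eqP h4; move: h3; rewrite -h4 cabs1; lra.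
    by rewrite -cabs_gt0 ltNge h2.
  lra.
lra.
Qed.

(** For [p = sum E k x ^ k] up to degree [n] and [q = sum g j x ^ (j + 1) / (j + 1)], the recurrence
    gives [p' <= q' p] on [[0, 1]]. Hence [p exp (- q)] is at 1 at most its value at 0, which is
    [E 0], and [E n <= p 1]. *)
Lemma gronwall (E g : nat -> R) : (forall k, 0 <= E k) -> (forall k, 0 <= g k) ->
  E 0%N <= 1 -> (forall k, k.+1%:R * E k.+1 <= \sum_(j < k.+1) g j * E (k - j)%N) ->
  forall k, E k <= expR (\sum_(j < k) g j / j.+1%:R).
Proof.
move=> E0 g0 E01 hE n.
pose p : {poly R} := \sum_(k < n.+1) E k *: 'X^k.
pose q : {poly R} := \sum_(j < n) (g j / j.+1%:R) *: 'X^(j.+1).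
have p'E x : p^`().[x] = \sum_(k < n) k.+1%:R * E k.+1 * x ^+ k.
  rewrite /p raddf_sum horner_sum big_ord_recl /= derivZ derivXn mulr0n scaler0 horner0 add0r.
  apply: eq_bigr => k _; rewrite derivZ derivXn hornerZ hornerMn hornerXn /bump /=.
  by rewrite -[x ^+ _ *+ _]mulr_natr; ring.
have q'E x : q^`().[x] = \sum_(j < n) g j * x ^+ j.
  rewrite /q raddf_sum horner_sum /=; apply: eq_bigr => j _.
  rewrite derivZ derivXn hornerZ hornerMn hornerXn /= -[x ^+ _ *+ _]mulr_natr.
  by field; rewrite addrC natr1 pnatr_eq0.
have pE x : p.[x] = \sum_(k < n.+1) E k * x ^+ k.
  by rewrite /p horner_sum; apply: eq_bigr => k _; rewrite hornerZ hornerXn.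
have q1 : q.[1] = \sum_(j < n) g j / j.+1%:R.
  by rewrite /q horner_sum; apply: eq_bigr => k _; rewrite hornerZ hornerXn expr1n mulr1.
have q0 : q.[0] = 0.
  by rewrite /q horner_sum big1 // => k _; rewrite hornerZ hornerXn expr0n mulr0.
pose h x := p.[x] * expR (- q.[x]).
pose dh x := p^`().[x] * expR (- q.[x]) - p.[x] * (q^`().[x] * expR (- q.[x])).
have hh (x : R) : 0 <= x <= 1 -> is_derive x 1 h (dh x).
  move=> _; have h1 : is_derive x 1 (fun x => expR (- q.[x])) (- (q^`().[x] * expR (- q.[x]))).
    apply: (is_derive_eq (@is_derive1_comp R (@expR R) (fun x => - q.[x]) x _ _
      (is_derive_expR _) (is_deriveN (is_derive_poly q x)))).
    by rewrite mulrN mulrC.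
  apply: (is_derive_eq (is_deriveM (is_derive_poly p x) h1)).
  by rewrite /GRing.scale /= /dh; ring.
have [c /andP[c0 c1]] := mvt01 hh.
have : dh c <= 0.
  rewrite /dh mulrA -mulrBl pmulr_lle0 ?expR_gt0 // subr_le0 p'E q'E pE mulrC.
  have h1 : (\sum_(j < n) g j * c ^+ j) * (\sum_(k < n) E k * c ^+ k) <=
      (\sum_(j < n) g j * c ^+ j) * \sum_(k < n.+1) E k * c ^+ k.
    apply: ler_wpM2l; first by apply: sumr_ge0 => j _; rewrite mulr_ge0 ?exprn_ge0.
    by rewrite big_ord_recr /= lerDl mulr_ge0 ?exprn_ge0.
  apply: le_trans h1.
  apply: le_trans (@conv_le R (fun j => g j * c ^+ j) (fun k => E k * c ^+ k) n _ _); last 2 first.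
  - by move=> k; rewrite mulr_ge0 ?exprn_ge0.
  - by move=> k; rewrite mulr_ge0 ?exprn_ge0.
  apply: ler_sum => k _; apply: (@le_trans _ _ ((\sum_(j < k.+1) g j * E (k - j)%N) * c ^+ k)).
    by rewrite ler_wpM2r ?exprn_ge0.
  rewrite mulr_suml; apply: ler_sum => j _.
  have jk : (j <= k)%N by rewrite -ltnS.
  by rewrite -[in c ^+ k](subnKC jk) exprD le_eqVlt; apply/orP; left; apply/eqP; ring.
have h0 : h 0 <= 1.
  rewrite /h q0 oppr0 expR0 mulr1 pE big_ord_recl /= expr0 mulr1 big1 ?addr0 // => k _.
  by rewrite expr0n /= mulr0.
move=> d0 hc; have : h 1 <= 1 by lra.
rewrite /h expRN ler_pdivrMr ?expR_gt0 // mul1r q1; apply: le_trans.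
rewrite pE big_ord_recr /= expr1n mulr1 lerDr.
by apply: sumr_ge0 => k _; rewrite mulr_ge0 ?exprn_ge0.
Qed.

(** Compactness of the enclosing square: around a point of the disc the Lipschitz bound keeps [|F|]
    above half its value, and around a point outside the claim is vacuous. *)
Lemma disc_min (F : R[i] -> R[i]) (rho : R) :
  (forall z, cabs z <= rho -> exists (K d : R), 0 < d /\
     forall w, cabs (w - z) < d -> cabs (F w - F z) <= K * cabs (w - z)) ->
  (forall z, cabs z <= rho -> F z != 0) ->
  exists2 m : R, 0 < m & forall z, cabs z <= rho -> m <= cabs (F z).
Proof.
move=> Flip F0.
pose D := `[- rho, rho]%classic `*` `[- rho, rho]%classic : set (R * R).
have cD : compact D by apply: compact_setX; exact: segment_compact.
have : \forall m \near (0 : R)^'+, forall x, D x ->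
    (cabs (x.1 +i* x.2) <= rho -> m <= cabs (F (x.1 +i* x.2))).
  have /compact_near_coveringP cD' := cD.
  apply: (cD' _ _ (fun m x => cabs (x.1 +i* x.2) <= rho -> m <= cabs (F (x.1 +i* x.2)))) => -[x y] _ /=.
  have dist (u v : R) : cabs (u +i* v - x +i* y) <= `|x - u| + `|y - v|.
    apply: le_trans (cabs_le_ReIm _) _.
    by rewrite cReD cImD cReN cImN /= distrC [X in _ + X <= _]distrC.
  have key d : 0 < d -> \forall p \near (x, y), cabs (p.1 +i* p.2 - x +i* y) < d.
    move=> d0; have d2 : 0 < d / 2 by rewrite divr_gt0.
    exists (ball x (d / 2), ball y (d / 2)).
      by split; exact: nbhsx_ballx.
    move=> [u v] [/= h1 h2]; apply: le_lt_trans (dist _ _) _.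
    by move: h1 h2; rewrite /ball /=; lra.
  case: (leP (cabs (x +i* y)) rho) => hz.
    have [K [d [d0 hK]]] := Flip _ hz.
    have Fz : 0 < cabs (F (x +i* y)) by rewrite cabs_gt0 F0.
    pose d' := Num.min d (cabs (F (x +i* y)) / 2 / (`|K| + 1)).
    have d'0 : 0 < d' by rewrite lt_min d0 !divr_gt0 // ltr_wpDl.
    exists ([set p : R * R | cabs (p.1 +i* p.2 - x +i* y) < d'], [set m | m <= cabs (F (x +i* y)) / 2]).
      split; first exact: key.
      apply: nbhs_right_le; by rewrite divr_gt0.
    move=> [[u v] m] [/= h1 h2] _; apply: le_trans h2 _.
    have h3 : cabs (u +i* v - x +i* y) < d by apply: lt_le_trans h1 _; rewrite ge_min lexx.
    have h4 : cabs (u +i* v - x +i* y) < cabs (F (x +i* y)) / 2 / (`|K| + 1).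
      by apply: lt_le_trans h1 _; rewrite ge_min lexx orbT.
    rewrite ltr_pdivlMr ?ltr_wpDl // in h4.
    have := hK _ h3; have := cabs_subr_ge (F (x +i* y)) (F (u +i* v)).
    rewrite [cabs (F _ - F _)]cabs_distC.
    have := ler_wpM2r (cabs_ge0 (u +i* v - x +i* y)) (ler_norm K).
    have := cabs_ge0 (u +i* v - x +i* y); lra.
  have d0 : 0 < cabs (x +i* y) - rho by lra.
  exists ([set p : R * R | cabs (p.1 +i* p.2 - x +i* y) < cabs (x +i* y) - rho], setT).
    by split; [exact: key|exact: filterT].
  move=> [[u v] m] [/= h1 _] h2; exfalso.
  have := cabs_subr_ge (x +i* y) (u +i* v); rewrite cabs_distC; lra.
move=> h; near ((0 : R)^'+) => m.
have hm : forall x, D x -> cabs (x.1 +i* x.2) <= rho -> m <= cabs (F (x.1 +i* x.2)).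
  by near: m; exact: h.
exists m; first by near: m; exact: nbhs_right_gt.
move=> z zr; have := hm (complex.Re z, complex.Im z) => /=.
rewrite (_ : complex.Re z +i* complex.Im z = z); last by case: (z).
apply => //; split => /=; rewrite in_itv /= -ler_norml.
  exact: le_trans (normr_Re_cabs _) zr.
exact: le_trans (normr_Im_cabs _) zr.
Unshelve. all: by end_near. Qed.

(* A truncation of [f] is a product of factors [1 - x z]; the power sums of the
   [x] play the role of the Taylor coefficients of the logarithm of [f]. *)
Lemma recip_bound (f e : nat -> R[i]) (F : R[i] -> R[i]) (R1 R2 A1 A2 r : R) :
  f 0%N = 1 -> (forall k, conv e f k = (k == 0%N)%:R) -> ps_abs f R2 -> 0 < R1 <= R2 ->
  (forall z, cabs z <= R2 -> ps_sum f z (F z)) ->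
  (forall z, cabs z <= R2 -> exists (K d : R), 0 < d /\
     forall w, cabs (w - z) < d -> cabs (F w - F z) <= K * cabs (w - z)) ->
  (forall z, cabs z <= R2 -> F z != 0) ->
  (forall z, cabs z <= R1 -> cabs (F z) <= expR A1) ->
  (forall z, cabs z <= R2 -> cabs (F z) <= expR A2) -> 0 < r ->
  forall k, cabs (e k) * r ^+ k <= expR (\sum_(j < k)
    Num.min (2 * (A1 + ln 2) * (r / R1) ^+ j.+1) (2 * (A2 + ln 2) * (r / R2) ^+ j.+1)).
Proof.
move=> f0 ef fabs /andP[R10 R12] hF Flip F0 FA1 FA2 r0 k.
have R20 : 0 < R2 by exact: lt_le_trans R12.
have F1 : F 0 = 1.
  have h0 : ps_sum f 0 (F 0) by apply: hF; rewrite cabs0 ltW.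
  rewrite -f0; apply: hasS_unique h0 _.
  rewrite -[f 0%N](_ : \sum_(k < 1) f k * 0 ^+ k = _); last by rewrite big_ord1 expr0 mulr1.
  by apply: hasS_fin => -[//|j] _; rewrite expr0n mulr0.
have A10 : 1 <= expR A1 by have := FA1 0; rewrite cabs0 F1 cabs1; apply; exact: ltW.
have A20 : 1 <= expR A2 by have := FA2 0; rewrite cabs0 F1 cabs1; apply; exact: ltW.
have [m m0 hm] := disc_min Flip F0.
(* Within [m / 2] of [F] the truncation has no zero in the disc; within [1/2] its modulus at most
   doubles, which is the origin of [ln 2]. *)
have e0 : 0 < Num.min 1 m / 2 by rewrite divr_gt0 // lt_min ltr01.
have u0 j : 0 <= cabs (f j) * R2 ^+ j by rewrite mulr_ge0 ?cabs_ge0 // exprn_ge0 // ltW.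
have [N0 hN0] := bsum_tail u0 fabs e0.
(* [N >= k], so that [e k] is also a coefficient of the reciprocal of the truncation. *)
pose N := maxn N0 k; pose P : {poly R[i]} := \poly_(i < N.+1) f i.
have Pz z : cabs z <= R2 -> cabs (F z - P.[z]) <= Num.min 1 m / 2.
  move=> zR; rewrite horner_poly; apply: hasS_tail (hF z zR) _ => n.
  apply: (@le_trans _ _ (\sum_(N.+1 <= j < n) cabs (f j) * R2 ^+ j)).
    apply: ler_sum => j _; rewrite cabsM cabsX ler_wpM2l ?cabs_ge0 //.
    by rewrite lerXn2r ?nnegrE ?cabs_ge0 // ltW.
  by apply/ltW/hN0; rewrite leqW // leq_maxl.
have m1 : Num.min 1 m <= 1 by rewrite ge_min lexx.
have mm : Num.min 1 m <= m by rewrite ge_min lexx orbT.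
have P0 z : cabs z <= R2 -> P.[z] != 0.
  move=> zR; have := Pz z zR; have := hm z zR.
  have := cabs_subr_ge (F z) P.[z]; rewrite -cabs_gt0; lra.
have PA z B : cabs z <= R2 -> cabs (F z) <= expR B -> 1 <= expR B ->
    cabs P.[z] <= expR (B + ln 2).
  move=> zR FB B1; rewrite expRD lnK ?posrE //; have := Pz z zR.
  by have := cabs_subr_ge P.[z] (F z); rewrite cabs_distC; lra.
have [zs Pzs] := closed_field_poly_normal P.
have P00 : P.[0] = 1 by rewrite horner_poly big_ord_recl /= f0 expr0 mulr1 big1 ?addr0 // => i _;
  rewrite expr0n /= mulr0.
have lc0 : lead_coef P != 0.
  by rewrite lead_coef_eq0; apply/eqP => P_0; move: P00; rewrite P_0 horner0 => /esym/eqP;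
    rewrite oner_eq0.
have zsR z : z \in zs -> R2 < cabs z.
  move=> zz; rewrite ltNge; apply/negP => /P0; rewrite Pzs hornerZ horner_prod.
  rewrite (big_rem z zz) /= hornerXsubC subrr mul0r mulr0 eqxx //.
pose xs := [seq z^-1 | z <- zs].
have PX : P = polX xs.
  have zs0 z : z \in zs -> z != 0 by move=> /zsR h; rewrite -cabs_gt0; exact: lt_trans h.
  have hprod (ys : seq R[i]) : (forall z, z \in ys -> z != 0) ->
      \prod_(z <- ys) ('X - z%:P) = (\prod_(z <- ys) (- z)) *: polX [seq z^-1 | z <- ys].
    elim: ys => [|y ys IH] h; first by rewrite /polX !big_nil scale1r.
    rewrite /polX /= !big_cons IH => [|z hz]; last by apply: h; rewrite inE hz orbT.
    have y0 : y != 0 by apply: h; rewrite inE eqxx.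
    rewrite -[RHS]scalerA [in RHS]scalerAr scalerAl; congr (_ * _).
    by rewrite scalerBr scalerA mulNr divff // scaleN1r opprK -alg_polyC scaleNr addrC.
  rewrite Pzs hprod // scalerA.
  have h : P.[0] = lead_coef P * \prod_(z <- zs) - z.
    rewrite [in LHS]Pzs hornerZ horner_prod; congr (_ * _).
    by apply: eq_bigr => z _; rewrite hornerXsubC sub0r.
  by rewrite -h P00 scale1r.
have eN j : (j <= N)%N -> e j = hX xs j.
  move: j; apply: (@recip_uniq _ e f xs N) => // j jN.
  by rewrite -PX coef_poly ltnS jN.
have xsR rho : rho <= R2 -> 0 < rho -> forall x, x \in xs -> cabs x * rho < 1.
  move=> rR rho0 x /mapP[z /zsR hz ->]; rewrite cabsV mulrC ltr_pdivrMr ?mul1r.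
    exact: le_lt_trans hz.
  exact: lt_trans hz.
have xsP B rho : rho <= R2 -> 0 < rho -> (forall z, cabs z <= rho -> cabs (F z) <= expR B) ->
    1 <= expR B -> forall j, cabs (psumX xs j.+1) * rho ^+ j.+1 <= 2 * (B + ln 2) * j.+1%:R.
  move=> rR rho0 hB B1; apply: borel_caratheodory => //; first exact: xsR.
  move=> z zr; rewrite -polX_horner -PX; apply: PA => //; first by rewrite zr.
  by apply: hB; rewrite zr.
rewrite eN ?leq_maxr //.
pose E j := cabs (hX xs j) * r ^+ j; pose g j := cabs (psumX xs j.+1) * r ^+ j.+1.
have hg : E k <= expR (\sum_(j < k) g j / j.+1%:R).
  apply: gronwall.
  - by move=> j; rewrite mulr_ge0 ?cabs_ge0 // exprn_ge0 // ltW.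
  - by move=> j; rewrite mulr_ge0 ?cabs_ge0 // exprn_ge0 // ltW.
  - by rewrite /E hX0 cabs1 expr0 mulr1.
  move=> j; rewrite /E mulrA -(cabs_nat R) -cabsM hX_rec.
  rewrite -ler_pdivlMr ?exprn_gt0 //; apply: le_trans (cabs_sum _ _ _) _.
  rewrite ler_pdivlMr ?exprn_gt0 // mulr_suml; apply: ler_sum => i _.
  have ij : (i <= j)%N by rewrite -ltnS.
  rewrite /g cabsM (_ : r ^+ j.+1 = r ^+ i.+1 * r ^+ (j - i)); last by rewrite -exprD addSn subnKC.
  by rewrite le_eqVlt; apply/orP; left; apply/eqP; ring.
apply: le_trans hg _; rewrite ler_expR; apply: ler_sum => j _.
have conv_r rho B : 0 < rho -> cabs (psumX xs j.+1) * rho ^+ j.+1 <= 2 * B * j.+1%:R ->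
    g j / j.+1%:R <= 2 * B * (r / rho) ^+ j.+1.
  move=> rho0 h; rewrite expr_div_n mulrA ler_pdivlMr ?exprn_gt0 // mulrAC.
  rewrite ler_pdivrMr // /g.
  have := ler_wpM2r (exprn_ge0 j.+1 (ltW r0)) h.
  by move=> h2; rewrite mulrAC (le_trans h2) // le_eqVlt; apply/orP; left; apply/eqP; ring.
rewrite le_min; apply/andP; split; apply: conv_r => //; first exact: xsP.
by apply: xsP => //.
Qed.

End BorelCaratheodory.

(** * Taylor coefficients of the reciprocal of zeta *)

Section TaylorOfInverseZeta.
Variable R : realType.
Implicit Types (z w s : R[i]) (t r rho x : R).

(** The coefficients of [1 / f] for [f 0 = 1], kept as a growing list because each depends on all
    the earlier ones. *)
Fixpoint conv_inv_seq (f : nat -> R[i]) n : seq R[i] :=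
  if n is n'.+1 then let s := conv_inv_seq f n' in
    rcons s ((n' == 0%N)%:R - \sum_(i < n') s`_i * f (n' - i)%N)
  else [::].

Lemma size_conv_inv_seq f n : size (conv_inv_seq f n) = n.
Proof. by elim: n => //= n IH; rewrite size_rcons IH. Qed.

Lemma nth_conv_inv_seq f n k : (k < n)%N ->
  (conv_inv_seq f n)`_k = (conv_inv_seq f k.+1)`_k.
Proof.
elim: n => // n IH; rewrite ltnS leq_eqVlt => /orP[/eqP -> //|kn].
by rewrite -IH // /= nth_rcons size_conv_inv_seq kn.
Qed.

Lemma conv_inv (f : nat -> R[i]) : f 0%N = 1 ->
  exists e : nat -> R[i], forall k, conv e f k = (k == 0%N)%:R.
Proof.
move=> f0; exists (fun k => (conv_inv_seq f k.+1)`_k) => k.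
rewrite /conv big_ord_recr /= subnn f0 mulr1 nth_rcons size_conv_inv_seq ltnn eqxx.
rewrite addrC -[RHS]addr0 -addrA; congr (_ + _).
rewrite addrC; apply/eqP; rewrite subr_eq0; apply/eqP; apply: eq_bigr => i _.
by congr (_ * _); rewrite (nth_conv_inv_seq f (ltn_ord i)).
Qed.

(** For [r < rho] the second bound decays geometrically, and from some index [N] on it sums to at
    most [eps * B2]; the first [N] terms are bounded independently of [B2]. With [B2] of order
    [ln |t|], the exponent of [|t|] is as small as desired. *)
Lemma min_sum_bound r rho B1 eps : 0 < r < rho -> 0 <= B1 -> 0 < eps ->
  exists2 C : R, 0 <= C & forall B2 k, 0 <= B2 ->
   \sum_(j < k) Num.min (B1 * (r / 2^-1) ^+ j.+1) (B2 * (r / rho) ^+ j.+1) <= C + eps * B2.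
Proof.
move=> /andP[r0 rr] B10 e0; have rho0 : 0 < rho by exact: lt_trans rr.
set q := r / rho; have q0 : 0 < q by rewrite divr_gt0.
have q1 : q < 1 by rewrite ltr_pdivrMr ?mul1r.
have [||N hN] := @geom_small _ q (eps * (1 - q)); first by rewrite ltW.
  by rewrite mulr_gt0 // subr_gt0.
pose u j := B1 * (r / 2^-1) ^+ j.+1.
have u0 j : 0 <= u j by rewrite mulr_ge0 // exprn_ge0 // divr_ge0 // ltW.
exists (\sum_(j < N) u j); first by apply: sumr_ge0.
move=> B2 k B20; pose v j := Num.min (u j) (B2 * q ^+ j.+1).
have v0 j : 0 <= v j by rewrite le_min u0 mulr_ge0 // exprn_ge0 // ltW.
apply: (@le_trans _ _ (\sum_(j < k + N) v j)).
  by apply: psum_mono => //; exact: leq_addr.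
rewrite (psum_split v (leq_addl k N)); apply: lerD.
  by apply: ler_sum => j _; rewrite ge_min lexx.
rewrite psum_shift; apply: (@le_trans _ _ (\sum_(j < k) B2 * q ^+ N * q ^+ j)).
  apply: ler_sum => j _; rewrite /v ge_min; apply/orP; right.
  rewrite -addnS exprD [q ^+ j * _]mulrC exprSr -mulrA; apply: ler_wpM2l => //.
  rewrite -mulrA; apply: ler_wpM2l; first by rewrite exprn_ge0 // ltW.
  by apply: ler_piMl; [rewrite exprn_ge0 // ltW|exact: ltW].
rewrite -mulr_sumr.
have g : \sum_(j < k) q ^+ j <= (1 - q)^-1.
  rewrite -[leRHS]mul1r ler_pdivlMr ?subr_gt0 // mulrC.
  have := @subrX1 R q k => h; have := exprn_ge0 k (ltW q0).
  have -> : (1 - q) * \sum_(j < k) q ^+ j = - ((q - 1) * \sum_(j < k) q ^+ j) by ring.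
  by rewrite -h; lra.
apply: (@le_trans _ _ (B2 * q ^+ N * (1 - q)^-1)).
  by apply: ler_wpM2l; rewrite ?mulr_ge0 // exprn_ge0 // ltW.
rewrite ler_pdivrMr ?subr_gt0 // [eps * B2]mulrC -mulrA; apply: ler_wpM2l => //.
exact/ltW/hN.
Qed.

Lemma lin_convS (c : R[i]) e k : conv (lin c) e k.+1 = c * e k.+1 + e k.
Proof.
rewrite /conv 2!big_ord_recl /= big1 ?addr0 => [|i _]; last by rewrite /lin /= !mul0r addr0 mul0r.
by rewrite /lin /= subn0 subn1 /= !mul0r !mul1r add0r addr0 mul1r.
Qed.

Lemma lin_conv0 (c : R[i]) e : conv (lin c) e 0 = c * e 0%N.
Proof. by rewrite /conv big_ord1 /lin /= mul1r addr0. Qed.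

(* The Taylor coefficients of [1 / zeta] at [2 + i t]. *)
Definition dk t k : R[i] := csum (fun n => mu R n * ecoef (ln n.+1%:R) (- (2 +i* t)) k).

Definition lnk (k n : nat) : R := (ln n.+1%:R) ^+ k / k`!%:R.

Lemma lnk_ge0 k n : 0 <= lnk k n.
Proof. by rewrite divr_ge0 // exprn_ge0 // ln_ge0 // ler1n. Qed.

Lemma cabs_dterm t n k :
  cabs (mu R n * ecoef (ln n.+1%:R) (- (2 +i* t)) k) <= n.+1%:R `^ (- 2) * lnk k n.
Proof.
rewrite cabsM -[leRHS]mul1r; apply: ler_pM; rewrite ?cabs_ge0 ?cabs_mu //.
rewrite /ecoef cabsM cabs_cexp cabs_real cReM /= mulr0 subr0 powR_nat.
rewrite normrM normfV normr_nat normrX normrN ger0_norm //.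
by rewrite ln_ge0 // ler1n.
Qed.

(** [(ln n) ^ k / k! <= 2 ^ k n ^ (1/2)], as a single term of the exponential series at
    [(ln n) / 2]. *)
Lemma bsum_lnk k : bsum (fun n => n.+1%:R `^ (- 2) * lnk k n).
Proof.
apply: (@bsum_le _ _ (fun n => 2 ^+ k * n.+1%:R `^ (- (3 / 2)))); last first.
  by apply: bsumZ; [exact: exprn_ge0|apply: bsum_zeta; lra].
move=> n; have l0 : 0 <= ln n.+1%:R :> R by rewrite ln_ge0 // ler1n.
have h : lnk k n <= 2 ^+ k * n.+1%:R `^ (2^-1).
  have l2 : 0 <= 2^-1 * ln n.+1%:R :> R by rewrite mulr_ge0.
  have := expR_psum_le k.+1 l2; rewrite big_ord_recr /= -powR_nat => h.
  have h2 : (2^-1 * ln n.+1%:R) ^+ k / k`!%:R <= n.+1%:R `^ (2^-1) :> R.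
    apply: le_trans h; rewrite lerDr; apply: sumr_ge0 => j _.
    by rewrite divr_ge0 // exprn_ge0.
  rewrite /lnk -[ln _](@mulVKf _ 2%:R) ?pnatr_eq0 // exprMn -mulrA ler_wpM2l ?exprn_ge0 //.
apply: (@le_trans _ _ (n.+1%:R `^ (- 2) * (2 ^+ k * n.+1%:R `^ (2^-1)))).
  by rewrite ler_wpM2l ?powR_ge0.
rewrite mulrCA ler_wpM2l ?exprn_ge0 // !powR_nat -expRD ler_expR -mulrDl.
by rewrite le_eqVlt; apply/orP; left; apply/eqP; congr (_ * _); field.
Qed.

Lemma hasS_dk t k : hasS (fun n => mu R n * ecoef (ln n.+1%:R) (- (2 +i* t)) k) (dk t k).
Proof.
apply: csumP; apply: abs_hasS; apply: bsum_le (bsum_lnk k) => n; exact: cabs_dterm.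
Qed.

Lemma dk_ps t z : cabs z <= 2^-1 ->
  exists2 G, hasS (fun n => mu R n * cnp n (- (2 +i* t + z))) G & ps_sum (dk t) z G.
Proof.
have r0 : 0 < (2^-1 : R) by rewrite invr_gt0.
pose u (n : nat) := n.+1%:R `^ (- (3 / 2)) : R.
have ub : bsum u by apply: bsum_zeta; lra.
have cu n m : \sum_(k < m) cabs (mu R n * ecoef (ln n.+1%:R) (- (2 +i* t)) k) * 2^-1 ^+ k <= u n.
  apply: (@le_trans _ _ (\sum_(k < m) cabs (ecoef (ln n.+1%:R) (- (2 +i* t)) k) * 2^-1 ^+ k)).
    apply: ler_sum => k _; rewrite ler_wpM2r ?exprn_ge0 // cabsM.
    by apply: ler_piMl; rewrite ?cabs_ge0 ?cabs_mu.
  apply: le_trans (ecoef_psum _ _ _ (ltW r0)) _.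
  rewrite /u powR_nat ger0_norm ?ln_ge0 ?ler1n // -mulrDl ler_expR /=.
  by rewrite le_eqVlt; apply/orP; left; apply/eqP; congr (_ * _); field.
have [A [_ hA hz]] := ps_double (c := fun n k => mu R n * ecoef (ln n.+1%:R) (- (2 +i* t)) k) r0 ub cu.
have AE k : A k = dk t k by exact: hasS_unique (hA k) (hasS_dk t k).
move=> zr; have [|G h1 h2] := hz z (fun n => mu R n * cnp n (- (2 +i* t + z))) zr.
  move=> n; have := hasSZ (mu R n) (ecoef_sum (ln n.+1%:R) (- (2 +i* t)) z).
  by rewrite -opprD; apply: hasS_ext => k; rewrite mulrA.
exists G => //; apply: hasS_ext h2 => k; by rewrite AE.
Qed.

Lemma zeta_abs_le s Z : 1 < complex.Re s -> hasS (fun n => cnp n (- s)) Z ->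
  cabs Z <= 1 + (complex.Re s - 1)^-1.
Proof.
move=> s1 hZ; apply: hasS_le hZ _ => n; apply: le_trans (zeta_psum n s1).
by apply: ler_sum => k _; rewrite cabs_cnp cReN.
Qed.

Lemma mu_abs_le s d : 1 < complex.Re s -> hasS (fun n => mu R n * cnp n (- s)) d ->
  cabs d <= 1 + (complex.Re s - 1)^-1.
Proof.
move=> s1 hd; apply: hasS_le hd _ => n; apply: le_trans (zeta_psum n s1).
apply: ler_sum => k _; rewrite cabsM cabs_cnp cReN.
by apply: ler_piMl; rewrite ?powR_ge0 ?cabs_mu.
Qed.

(** The quotient [F z = zf (s0 + z) / zf s0] has no zeros for [|z| <= R2]; it is bounded there
    polynomially in [t], and by a constant for [|z| <= 1/2]. So [recip_bound] and [min_sum_bound]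
    control the coefficients [e] of [1 / F]. Since [1 / zeta s = (s - 1) / zf s], [dk t] is the
    product of [e] and [lin (s0 - 1)], divided by [zf s0]. *)
Lemma dk_bound a r : 0 < a < 1 -> 0 < r < 2 - a ->
  (forall s, a < complex.Re s -> zf s != 0) ->
  exists2 C : R, 0 < C & forall t k, cabs (dk t k) * r ^+ k <= C * (4 + `|t|) `^ (4^-1).
Proof.
move=> /andP[a0 a1] /andP[r0 ra] nz.
(* Strictly between [r] and [2 - a], or [1/2] if that is larger, so that the small disc is contained
   in the large one. *)
pose R2 := Num.max ((r + (2 - a)) / 2) 2^-1.
have [R2r R2a R2h R22] : [/\ r < R2, R2 < 2 - a, 2^-1 <= R2 & R2 < 2].
  rewrite /R2 !lt_max !gt_max le_max lexx orbT; split => //.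
  - by apply/orP; left; lra.
  - by apply/andP; split; lra.
  - by apply/andP; split; lra.
have R20 : 0 < R2 by exact: lt_trans R2r.
have b0 : 0 < 2 - R2 by lra.
have [K K0 hK] := zf_bound 4 b0.
(* [A2] contains [2 ln (4 + |t|)] and enters doubled; [4 / 16] is the exponent [1/4]. *)
have e0 : 0 < 16^-1 :> R by [].
have B10 : 0 <= 2 * (ln 9 + ln 2) :> R by rewrite mulr_ge0 ?addr_ge0 ?ln_ge0 ?ler1n.
have rR2 : 0 < r < R2 by rewrite r0.
have [C1 C10 hC1] := min_sum_bound rR2 B10 e0.
pose L := ln (4 * K + 1).
exists ((2 + 2 * r) * expR (C1 + L)); first by rewrite mulr_gt0 ?expR_gt0 //; lra.
move=> t k; pose s0 : R[i] := 2 +i* t.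
have hR2 : 0 < R2 < complex.Re s0 by rewrite R20.
have [f [fabs hf]] := zf_ps hR2.
have s01 : 1 < complex.Re s0 by rewrite /=; lra.
have [Z hZ] : exists Z, hasS (fun n => cnp n (- s0)) Z.
  by apply: abs_hasS; exact: bsum_cnp.
have [d hd Zd] := mu_zeta s01 hZ.
have d2 : cabs d <= 2 by apply: le_trans (mu_abs_le s01 hd) _; rewrite /= (_ : 2 - 1 = 1 :> R) ?invr1; lra.
have s0n : s0 - 1 != 0 by rewrite subr_eq0 eq_complex /=; apply/negP => /andP[/eqP]; lra.
have s0n1 : 1 <= cabs (s0 - 1).
  apply: le_trans (Re_le_cabs _); rewrite cReD cReN /=; lra.
pose f0 := zf s0; have f0E : f0 = (s0 - 1) * Z by exact: zf_zeta.
have Z0 : Z != 0 by apply/negP => /eqP Z0; move: Zd; rewrite Z0 mul0r => /esym/eqP; rewrite oner_eq0.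
have f00 : f0 != 0 by rewrite f0E mulf_neq0.
have f0i : (cabs f0)^-1 * cabs (s0 - 1) <= 2.
  rewrite f0E cabsM invfM mulrAC mulVf ?mul1r; last by rewrite cabs_eq0.
  rewrite -cabsV; have -> : Z^-1 = d by apply: (mulfI Z0); rewrite divff.
  by [].
have f0i1 : (cabs f0)^-1 <= 2.
  by apply: le_trans f0i; rewrite ler_peMr // invr_ge0 cabs_ge0.
have f_0 : f 0%N = f0.
  have h0 : ps_sum f 0 (zf (s0 + 0)) by apply: hf; rewrite cabs0 ltW.
  rewrite addr0 in h0; apply: hasS_unique h0.
  rewrite -[f 0%N](_ : \sum_(k < 1) f k * 0 ^+ k = _); last by rewrite big_ord1 expr0 mulr1.
  by apply: hasS_fin => -[//|j] _; rewrite expr0n mulr0.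
pose g k := f0^-1 * f k; pose F z := f0^-1 * zf (s0 + z).
have g0 : g 0%N = 1 by rewrite /g f_0 mulVf.
have [e he] := conv_inv g0.
have hF z : cabs z <= R2 -> ps_sum g z (F z).
  by move=> /hf/(hasSZ f0^-1); apply: hasS_ext => j; rewrite mulrA.
have gabs : ps_abs g R2.
  have := bsumZ (_ : 0 <= cabs f0^-1) fabs; rewrite cabs_ge0 => /(_ isT).
  by apply: bsum_le => j; rewrite /g cabsM mulrA.
have res z : cabs z <= R2 -> a < complex.Re (s0 + z).
  by move=> zr; have := normr_Re_cabs z; rewrite cReD /= ler_norml; lra.
pose A2 := ln (2 * K * (4 + `|t|) ^+ 2).
have t4 : 1 <= 4 + `|t| by rewrite (_ : 4 = 1 + 3) -?addrA ?lerDl ?addr_ge0 //; ring.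
have P0 : 0 < 2 * K * (4 + `|t|) ^+ 2.
  by rewrite !mulr_gt0 // exprn_gt0 //; lra.
have FA2 z : cabs z <= R2 -> cabs (F z) <= expR A2.
  move=> zr; rewrite /A2 lnK ?posrE // /F cabsM cabsV -mulrA.
  apply: ler_pM; rewrite ?invr_ge0 ?cabs_ge0 //.
  have hre : `|complex.Re z| <= R2 by exact: le_trans (normr_Re_cabs z) zr.
  apply: le_trans (hK _ _ _) _.
  - by rewrite cReD /=; move: hre; rewrite ler_norml; lra.
  - by rewrite cReD /=; move: hre; rewrite ler_norml; lra.
  apply: ler_wpM2l; first exact: ltW.
  rewrite lerXn2r ?nnegrE ?addr_ge0 ?cabs_ge0 //.
  rewrite (_ : 1 - (s0 + z) = - ((1 +i* t) + z)); last first.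
    by rewrite /s0; apply/eqP; rewrite eq_complex; case: (z) => u v /=; apply/andP; split; apply/eqP; ring.
  rewrite cabsN; have := cabsD (1 +i* t) z; have := cabs_le_ReIm (1 +i* t).
  rewrite /= normr1; lra.
(* [9 = 3 * 2 * (3/2)]: [|zeta| <= 3] on [Re s >= 3/2], [1 / |zeta s0| <= 2], and
   [|s - 1| <= (3/2) |s0 - 1|]. *)
have FA1 z : cabs z <= 2^-1 -> cabs (F z) <= expR (ln 9).
  move=> zr; rewrite lnK ?posrE // /F.
  have s1 : 1 < complex.Re (s0 + z).
    by have := normr_Re_cabs z; rewrite cReD /= ler_norml; lra.
  have [Y hY] : exists Y, hasS (fun n => cnp n (- (s0 + z))) Y.
    by apply: abs_hasS; exact: bsum_cnp.
  rewrite (zf_zeta s1 hY) !cabsM cabsV.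
  have Y3 : cabs Y <= 3.
    apply: le_trans (zeta_abs_le s1 hY) _.
    have h2 : 2^-1 <= complex.Re (s0 + z) - 1.
      by have := normr_Re_cabs z; rewrite cReD /= ler_norml; lra.
    have : (complex.Re (s0 + z) - 1)^-1 <= (2^-1)^-1 by rewrite lef_pV2 ?posrE; lra.
    rewrite invrK; lra.
  have h3 : cabs (s0 + z - 1) <= 3 / 2 * cabs (s0 - 1).
    rewrite addrAC; have := cabsD (s0 - 1) z; lra.
  rewrite mulrA; apply: (@le_trans _ _ (3 * 3)); last lra.
  apply: ler_pM; rewrite ?mulr_ge0 ?invr_ge0 ?cabs_ge0 //.
  apply: (@le_trans _ _ ((cabs f0)^-1 * (3 / 2 * cabs (s0 - 1)))).
    by rewrite ler_wpM2l // invr_ge0 cabs_ge0.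
  rewrite mulrCA; lra.
have Fn z : cabs z <= R2 -> F z != 0.
  by move=> zr; rewrite /F mulf_neq0 ?invr_eq0 // nz // res.
have Flip z : cabs z <= R2 -> exists (K d : R), 0 < d /\
     forall w, cabs (w - z) < d -> cabs (F w - F z) <= K * cabs (w - z).
  move=> zr; have [|K' [d' [d0 hd']]] := @zf_lip R (s0 + z); first by have := res z zr; lra.
  exists (cabs f0^-1 * K'), d'; split => // w hw.
  rewrite /F -mulrBr cabsM -mulrA ler_wpM2l ?cabs_ge0 //.
  have := hd' (s0 + w); rewrite opprD addrACA subrr add0r; exact.
have R1R2 : 0 < (2^-1 : R) <= R2 by apply/andP; split; [rewrite invr_gt0 ltr0n|].
have A20 : 0 <= A2 + ln 2.
  rewrite -lnM ?posrE // ln_ge0 //.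
  have := FA2 0; rewrite cabs0 /F addr0 mulVf // cabs1 /A2 lnK ?posrE // => /(_ (ltW R20)); lra.
pose W := expR (C1 + L) * (4 + `|t|) `^ (4^-1).
have heW j : cabs (e j) * r ^+ j <= W.
  apply: le_trans (recip_bound g0 he gabs R1R2 hF Flip Fn FA1 FA2 r0 j) _.
  have B20 : 0 <= 2 * (A2 + ln 2) by rewrite mulr_ge0.
  have t40 : 0 < 4 + `|t| by lra.
  rewrite /W /powR gt_eqF // -expRD ler_expR; apply: le_trans (hC1 _ j B20) _.
  rewrite -addrA lerD2l.
  have -> : A2 + ln 2 = ln (4 * K) + 2 * ln (4 + `|t|).
    rewrite /A2 lnM ?posrE ?mulr_gt0 ?exprn_gt0 //.
    rewrite lnXn // (_ : 4 * K = 2 * K * 2); last by ring.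
    rewrite [ln (2 * K * 2)]lnM ?posrE ?mulr_gt0 // mulr2n; ring.
  have l1 : ln (4 * K) <= L by rewrite /L ler_ln ?posrE ?ltr_wpDl ?mulr_ge0 ?mulr_gt0 ?(ltW K0) // lerDl.
  have L0 : 0 <= L by rewrite ln_ge0 // lerDr mulr_ge0 // ltW.
  lra.
have W0 : 0 <= W by rewrite mulr_ge0 ?expR_ge0 ?powR_ge0.
have dkE : dk t =1 fun j => f0^-1 * conv (lin (s0 - 1)) e j.
  pose rho := Num.min (r / 2) 2^-1.
  have rho0 : 0 < rho by rewrite lt_min divr_gt0 //= invr_gt0.
  have rhor : rho <= r / 2 by rewrite ge_min lexx.
  have rhoh : rho <= 2^-1 by rewrite ge_min lexx orbT.
  have eabs : ps_abs e rho.
    have [U hU] : bsum (fun j : nat => W * (2^-1 : R) ^+ j).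
      apply: bsumZ => //; exists 2 => n; have := @subrX1 R 2^-1 n.
      have : 0 <= (2^-1 : R) ^+ n by rewrite exprn_ge0 // invr_ge0.
      lra.
    apply: bsum_le (ex_intro _ U hU) => j.
    apply: (@le_trans _ _ (cabs (e j) * (r * 2^-1) ^+ j)).
      by rewrite ler_wpM2l ?cabs_ge0 // lerXn2r ?nnegrE ?(ltW rho0) // divr_ge0 // ltW.
    by rewrite exprMn mulrA; apply: ler_wpM2r; rewrite ?exprn_ge0 ?invr_ge0.
  have gabs' : ps_abs g rho by apply: ps_abs_leR gabs; rewrite (ltW rho0) /= (le_trans rhoh).
  pose Gx (x : R) := csum (fun n => mu R n * cnp n (- (s0 + x%:C))).
  apply: (@ps_uniq _ _ _ rho Gx) => // x /andP[x0 xr].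
    have xc : cabs (x%:C : R[i]) <= 2^-1 by rewrite cabs_real gtr0_norm //; lra.
    have [G hG hG'] := dk_ps t xc.
    by rewrite /Gx (hasS_csum hG).
  have xc : cabs (x%:C : R[i]) <= rho by rewrite cabs_real gtr0_norm // ltW.
  have xR : cabs (x%:C : R[i]) <= R2 by lra.
  have [E hE] := ps_abs_ex eabs xc.
  have EF : E * F x%:C = 1.
    apply: hasS_unique (ps_mul eabs gabs' xc hE (hF _ xR)) _.
    have := hasS_one (1 : R[i]); apply: hasS_ext => j; rewrite he mulr1.
    by case: j => [|j]; rewrite ?expr0 ?mul1r //= mul0r.
  have hl := ps_mul (lin_abs (s0 - 1) (ltW rho0)) eabs xc (lin_sum (s0 - 1) x%:C) hE.
  have s1 : 1 < complex.Re (s0 + x%:C) by rewrite cReD /=; lra.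
  have [Y hY] : exists Y, hasS (fun n => cnp n (- (s0 + x%:C))) Y.
    by apply: abs_hasS; exact: bsum_cnp.
  have [dx hdx Yd] := mu_zeta s1 hY.
  have Y0 : Y != 0 by apply/negP => /eqP Y0; move: Yd; rewrite Y0 mul0r => /esym/eqP; rewrite oner_eq0.
  rewrite /Gx (hasS_csum hdx).
  have -> : dx = f0^-1 * ((s0 - 1 + x%:C) * E).
    apply: (mulfI Y0); transitivity (E * F x%:C); first by rewrite EF Yd.
    by rewrite /F (zf_zeta s1 hY); ring.
  by apply: hasS_ext (hasSZ f0^-1 hl) => j; rewrite mulrA.
have WE : (2 + 2 * r) * expR (C1 + L) * (4 + `|t|) `^ (4^-1) = 2 * W + 2 * (r * W).
  by rewrite /W; ring.
rewrite dkE cabsM cabsV WE; case: k => [|k].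
  rewrite lin_conv0 expr0 mulr1 cabsM mulrA.
  have := heW 0%N; rewrite expr0 mulr1 => h.
  apply: (@le_trans _ _ (2 * W)); first by apply: ler_pM; rewrite ?mulr_ge0 ?invr_ge0 ?cabs_ge0.
  by rewrite lerDl !mulr_ge0 // ltW.
rewrite lin_convS.
apply: (@le_trans _ _ (((cabs f0)^-1 * cabs (s0 - 1)) * (cabs (e k.+1) * r ^+ k.+1) +
   (cabs f0)^-1 * (r * (cabs (e k) * r ^+ k)))).
  rewrite -[X in _ <= X + _]mulrA -mulrDr -mulrA ler_wpM2l ?invr_ge0 ?cabs_ge0 //.
  rewrite [leRHS](_ : _ = (cabs (s0 - 1) * cabs (e k.+1) + cabs (e k)) * r ^+ k.+1); last first.
    by rewrite exprS; ring.
  rewrite ler_wpM2r ?exprn_ge0 ?(ltW r0) //.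
  by apply: le_trans (cabsD _ _) _; rewrite cabsM.
apply: lerD; apply: ler_pM; rewrite ?mulr_ge0 ?invr_ge0 ?cabs_ge0 ?exprn_ge0 ?(ltW r0) //.
by rewrite ler_wpM2l // ltW.
Qed.

End TaylorOfInverseZeta.

(** * A mean square inequality for Dirichlet polynomials *)

Section SineBounds.
Variable R : realType.
Implicit Types x y : R.

Lemma sin_scale_mvt (x : R) : exists2 c, 0 <= c <= 1 & sin x = x * cos (c * x).
Proof.
have hf (u : R) : 0 <= u <= 1 -> is_derive u 1 (fun u => sin (u * x)) (x * cos (u * x)).
  move=> _; have h : is_derive u 1 (fun u : R => u * x) x.
    by apply: (is_derive_eq (is_deriveM _ _)); rewrite scaler0 add0r [LHS]mulr1.
  apply: (is_derive_eq (@is_derive1_comp R (@sin R) (fun u => u * x) u _ _ (is_derive_sin _) h)).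
  by rewrite mulrC.
by have [c c01] := mvt01 hf; rewrite mul1r mul0r sin0 subr0 => h; exists c.
Qed.

Lemma sin_abs_le x : `|sin x| <= `|x|.
Proof.
have [c _ ->] := sin_scale_mvt x.
by rewrite normrM ler_piMr // cos_max.
Qed.

Lemma cos_dbl x : cos x = 1 - (sin (x / 2)) ^+ 2 *+ 2.
Proof. by rewrite -[in LHS](@divfK _ 2 _ x) // mulr_natr cos_mulr2n cos2sin2; ring. Qed.

Lemma cos_lower x : 1 - x ^+ 2 / 2 <= cos x.
Proof.
rewrite cos_dbl; have := sin_abs_le (x / 2).
rewrite -(ler_pXn2r (ltn0Sn 1)) ?nnegrE // !real_normK ?num_real //; nra.
Qed.

Lemma sin_lower x : 0 <= x -> x - x ^+ 3 / 6 <= sin x.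
Proof.
move=> x0.
pose f u := sin (u * x) - u * x + (u * x) ^+ 3 / 6.
pose df u := x * (cos (u * x) - 1 + (u * x) ^+ 2 / 2).
have hf (u : R) : 0 <= u <= 1 -> is_derive u 1 f (df u).
  move=> _; have h : is_derive u 1 (fun u : R => u * x) x.
    by apply: (is_derive_eq (is_deriveM _ _)); rewrite scaler0 add0r [LHS]mulr1.
  have h1 := @is_derive1_comp R (@sin R) (fun u => u * x) u _ _ (is_derive_sin _) h.
  pose P : {poly R} := 6^-1 *: 'X^3.
  have h2 := @is_derive1_comp R (horner P) (fun u => u * x) u _ _ (is_derive_poly P _) h.
  have -> : f = (@sin R \o (fun u => u * x)) - (fun u => u * x) + (horner P \o (fun u => u * x)).
    by apply/funext => v; rewrite /f !fctE /= /P hornerZ hornerXn [_ / 6]mulrC.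
  apply: (is_derive_eq (is_deriveD (is_deriveB h1 h) h2)).
  rewrite /df /P derivZ derivXn hornerZ hornerMn hornerXn /=.
  by rewrite -mulr_natr; field; rewrite ?pnatr_eq0.
have [c c01] := mvt01 hf.
have dfc : 0 <= df c by rewrite /df mulr_ge0 //; have := cos_lower (c * x); lra.
by rewrite /f !mul1r !mul0r sin0 expr0n /= mul0r; lra.
Qed.

(** For [y = x / 2 <= 2] one has [sin y >= y - y ^ 3 / 6 >= y / 3], and
    [2 (x / 6) ^ 2 = x ^ 2 / 18]. *)
Lemma cos_upper x : 0 <= x <= pi -> cos x <= 1 - x ^+ 2 / 18.
Proof.
move=> /andP[x0 xp]; rewrite cos_dbl.
have h2 : x / 2 <= 2 by apply: le_trans (ltW (pihalf_lt2 R)); rewrite ler_pM2r.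
have := @sin_lower (x / 2); have y0 : 0 <= x / 2 by rewrite divr_ge0.
move=> /(_ y0) h.
have h3 : x / 2 / 3 <= sin (x / 2).
  apply: le_trans h; rewrite -subr_ge0; move: y0 h2; set y := x / 2 => y0 y2.
  have -> : y - y ^+ 3 / 6 - y / 3 = y * ((2 - y) * (2 + y)) / 6 by field.
  by rewrite divr_ge0 ?mulr_ge0 // ?subr_ge0 // addr_ge0.
have h4 : (x / 2 / 3) ^+ 2 <= sin (x / 2) ^+ 2.
  by rewrite ler_pXn2r ?nnegrE // ?divr_ge0 //; apply: le_trans h3; rewrite divr_ge0.
nra.
Qed.

End SineBounds.

Section MeanSquare.
Variable R : realType.
Implicit Types (x t : R) (a : nat -> R).

Lemma cabs_sqr_conj (z : R[i]) : (cabs z ^+ 2)%:C = z * conjc z.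
Proof.
rewrite cabs_sqr; case: z => x y; apply/eqP.
by rewrite eq_complex cReM cImM /=; apply/andP; split; apply/eqP; ring.
Qed.

Lemma conjc_expn (z : R[i]) j m : cabs z = 1 -> z ^+ m = 1 -> (j <= m)%N ->
  conjc (z ^+ j) = z ^+ (m - j).
Proof.
move=> z1 zm jm; have h : z ^+ j * conjc (z ^+ j) = 1.
  by rewrite -cabs_sqr_conj cabsX z1 !expr1n.
have zj : z ^+ j != 0 by rewrite -cabs_eq0 cabsX z1 expr1n oner_eq0.
by apply: (mulfI zj); rewrite h -exprD subnKC.
Qed.

Lemma conjc_scale x (z : R[i]) : conjc (x%:C * z) = x%:C * conjc z.
Proof. by rewrite rmorphM /= oppr0. Qed.

Lemma parseval (z : R[i]) m (f : nat -> R) : cabs z = 1 -> z ^+ m = 1 ->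
  (forall j, (0 < j < m)%N -> z ^+ j != 1) ->
  \sum_(l < m) cabs (\sum_(j < m) (f j)%:C * (z ^+ l) ^+ j) ^+ 2 = m%:R * \sum_(j < m) f j ^+ 2.
Proof.
move=> z1 zm zn; have hS := unity_sum zm zn.
apply: (@complexI R); rewrite rmorph_sum /=.
transitivity (\sum_(l < m) \sum_(j < m) \sum_(i < m)
    (f j * f i)%:C * (z ^+ l) ^+ (j + (m - i))).
  apply: eq_bigr => l _; rewrite cabs_sqr_conj rmorph_sum /= big_distrlr /=.
  apply: eq_bigr => j _; apply: eq_bigr => i _.
  rewrite conjc_scale (@conjc_expn _ _ m) ?(ltnW (ltn_ord i)) //.
  - by rewrite exprD rmorphM; ring.
  - by rewrite cabsX z1 expr1n.
  - by rewrite -exprM mulnC exprM zm expr1n.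
rewrite exchange_big /= mulr_sumr rmorph_sum /=; apply: eq_bigr => j _.
rewrite exchange_big /= (bigD1 j) //= [X in _ + X]big1 ?addr0.
  rewrite -mulr_sumr subnKC ?(ltnW (ltn_ord j)) //.
  rewrite (eq_bigr (fun=> 1)); last by move=> l _; rewrite -exprM mulnC exprM zm expr1n.
  by rewrite sumr_const card_ord [in RHS]rmorphM rmorph_nat mulrC expr2.
move=> i ij; rewrite -mulr_sumr hS ?mulr0 //; have := ltn_ord i; have := ltn_ord j.
  lia.
by move/eqP: ij => ij _ _; apply/eqP => h; apply: ij; apply: val_inj => /=; have := ltn_ord i; lia.
Qed.

Lemma one_sub_lower (q phi : R) : 2^-1 <= q -> 0 <= phi <= pi ->
  (1 - q) ^+ 2 + phi ^+ 2 / 18 <= cabs (1 - q%:C * cexp (0 +i* phi)) ^+ 2.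
Proof.
move=> q2 /cos_upper h.
have -> : cabs (1 - q%:C * cexp (0 +i* phi)) ^+ 2 = (1 - q) ^+ 2 + 2 * q * (1 - cos phi).
  have := cos2Dsin2 phi; rewrite cabs_sqr cReD cImD cReN cImN cReM cImM /= expR0 => e.
  apply/eqP; rewrite -subr_eq0; apply/eqP.
  transitivity (q ^+ 2 * (cos phi ^+ 2 + sin phi ^+ 2 - 1)); first by ring.
  by rewrite e subrr mulr0.
nra.
Qed.

Lemma cexp_imag_dist x y : cabs (cexp (0 +i* x) - cexp (0 +i* y)) <= `|x - y|.
Proof.
have -> : cexp (0 +i* x) = cexp (0 +i* y) * cexp (0 +i* (x - y)).
  by rewrite -cexpD; congr cexp; apply/eqP; rewrite eq_complex /= addr0 eqxx addrC subrK eqxx.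
rewrite -{2}(mulr1 (cexp (0 +i* y))) -mulrBr cabsM cabs_cexp /= expR0 mul1r.
rewrite -(@ler_pXn2r _ 2) ?nnegrE ?cabs_ge0 // cabs_sqr !cReD !cImD !cReN !cImN /= expR0 !mul1r.
rewrite oppr0 addr0 real_normK ?num_real //.
have := cos2Dsin2 (x - y); have := cos_lower (x - y); nra.
Qed.

(** The trivial bound 2 and the Lipschitz bound [(4 + |t|) (v - u)] are interpolated to the exponent
    [1/4], so that rounding errors grow in [t] no faster than the Dirichlet polynomial itself
    may. *)
Lemma cexp_line_dist t (u v : R) : 0 <= u <= v ->
  cabs (cexp ((- 2 +i* t) * u%:C) - cexp ((- 2 +i* t) * v%:C)) <=
  2 * ((4 + `|t|) * (v - u)) `^ (4^-1).
Proof.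
move=> /andP[u0 uv].
have E x : cexp ((- 2 +i* t) * x%:C) = (expR (- 2 * x))%:C * cexp (0 +i* (t * x)).
  rewrite -cexp_real -cexpD; congr cexp; apply/eqP.
  by rewrite eq_complex cReM cImM /=; apply/andP; split; apply/eqP; ring.
have e1 x : 0 <= x -> expR (- 2 * x) <= 1 by move=> x0; rewrite -[leRHS]expR0 ler_expR; lra.
have c1 x : cabs (cexp (0 +i* (t * x))) = 1 by rewrite cabs_cexp /= expR0.
set d := (4 + `|t|) * (v - u); have d0 : 0 <= d by rewrite mulr_ge0 ?subr_ge0 // addr_ge0.
have v0 := le_trans u0 uv.
have b2 : cabs (cexp ((- 2 +i* t) * u%:C) - cexp ((- 2 +i* t) * v%:C)) <= 2.
  apply: le_trans (cabsB _ _) _; rewrite !E !cabsM !c1 !cabs_real !ger0_norm ?expR_ge0 //.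
  by have := e1 _ u0; have := e1 _ v0; lra.
have [d1|d1] := leP 1 d.
  apply: le_trans b2 _; rewrite ler_peMr //.
  by rewrite -[leLHS](congr1 (@^~ (4^-1)) (@powR1 R)) ge0_ler_powR ?nnegrE.
apply: (@le_trans _ _ d); last first.
  apply: (@le_trans _ _ (d `^ (4^-1))); last by rewrite ler_peMl ?powR_ge0 // ler1n.
  have [->|dn] := eqVneq d 0; first exact: powR_ge0.
  rewrite -[leLHS]powRr1 // ger_powR ?invf_le1 ?ler1n // (ltW d1) andbT.
  by rewrite lt_neqAle eq_sym dn.
rewrite !E.
have -> : (expR (- 2 * u))%:C * cexp (0 +i* (t * u)) - (expR (- 2 * v))%:C * cexp (0 +i* (t * v)) =
    (expR (- 2 * u))%:C * (cexp (0 +i* (t * u)) - cexp (0 +i* (t * v))) +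
    (expR (- 2 * u) - expR (- 2 * v))%:C * cexp (0 +i* (t * v)).
  by rewrite rmorphB; ring.
apply: le_trans (cabsD _ _) _; rewrite !cabsM c1 !cabs_real mulr1 ger0_norm ?expR_ge0 //.
have uv2 : expR (- 2 * v) <= expR (- 2 * u) by rewrite ler_expR; lra.
rewrite ger0_norm ?subr_ge0 // /d.
have h1 : cabs (cexp (0 +i* (t * u)) - cexp (0 +i* (t * v))) <= `|t| * (v - u).
  apply: le_trans (cexp_imag_dist _ _) _; by rewrite -mulrBr normrM (distrC u) [`|v - u|]ger0_norm // subr_ge0.
have h2 : expR (- 2 * u) - expR (- 2 * v) <= 2 * (v - u).
  rewrite (_ : - 2 * v = - 2 * u + - (2 * (v - u))); last by ring.
  rewrite expRD -{1}[expR (- 2 * u)]mulr1 -mulrBr.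
  have := expR_ge1Dx (- (2 * (v - u))); have := e1 _ u0; have := expR_ge0 (- 2 * u); nra.
have h3 := e1 _ u0; have h4 := expR_ge0 (- 2 * u).
have h5 : expR (- 2 * u) * cabs (cexp (0 +i* (t * u)) - cexp (0 +i* (t * v))) <= `|t| * (v - u).
  by apply: le_trans h1; rewrite ler_piMl ?cabs_ge0.
nra.
Qed.

(** A Riemann sum for [(4 + x) ^ (- 3/2)], telescoped against the primitive
    [- 2 (4 + x) ^ (- 1/2)]. *)
Lemma quarter_sum (d : R) n : 0 < d <= 1 ->
  d * \sum_(i < n.+1) (((4 + d * i%:R) `^ (4^-1)) ^+ 6)^-1 <= 2.
Proof.
move=> /andP[d0 d1]; pose y (i : nat) := (4 + d * i%:R) `^ (4^-1).
have b0 (i : nat) : 0 < 4 + d * i%:R by rewrite ltr_pwDl // mulr_ge0 // ltW.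
have y0 i : 0 < y i by rewrite powR_gt0.
have y4 i : y i ^+ 4 = 4 + d * i%:R.
  by rewrite /y -powR_mulrn ?powR_ge0 // -powRrM mulVf // powRr1 ?ltW.
have y02 : y 0%N ^+ 2 = 2.
  by apply/eqP; rewrite -(@eqrXn2 _ 2) ?exprn_ge0 ?(ltW (y0 _)) // -exprM y4 mulr0 addr0 expr2 -natrM.
suff : d * \sum_(i < n.+1) ((y i) ^+ 6)^-1 <= 2 - 2 * (y n ^+ 2)^-1.
  move=> h; apply: le_trans h _; rewrite gerBl mulr_ge0 // invr_ge0 exprn_ge0 // ltW //.
elim: n => [|n IH].
  rewrite big_ord1 (exprM _ 2 3) y02 divff // -natrX.
  by rewrite ler_pdivrMr //; lra.
rewrite big_ord_recr /= mulrDr; apply: le_trans (lerD IH (lexx _)) _.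
set a := y n ^+ 2; set b := y n.+1 ^+ 2.
have a0 : 0 < a by rewrite exprn_gt0. have b1 : 0 < b by rewrite exprn_gt0.
have ab : b ^+ 2 - a ^+ 2 = d by rewrite /a /b -!exprM !y4 -[in LHS]natr1; ring.
have lab : a <= b by rewrite -(@ler_pXn2r _ 2) ?nnegrE ?(ltW a0) ?(ltW b1) // -subr_ge0 ab ltW.
rewrite (exprM _ 2 3) -/b.
suff : d / b ^+ 3 <= 2 * (a^-1 - b^-1) by lra.
rewrite -ab ler_pdivrMr ?exprn_gt0 //.
have -> : 2 * (a^-1 - b^-1) * b ^+ 3 = 2 * (b - a) * b ^+ 2 / a.
  by field; rewrite !gt_eqF.
rewrite ler_pdivlMr //.
suff : 0 <= (b - a) * ((2 * b + a) * (b - a)) by nra.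
by rewrite !mulr_ge0 ?subr_ge0 // addr_ge0 ?ltW // mulr_gt0.
Qed.

Lemma geo_range (w : R[i]) k L : (k <= L)%N ->
  (1 - w) * \sum_(j < L) (k <= j)%N%:R * w ^+ j = w ^+ k - w ^+ L.
Proof.
move=> /subnKC <-; elim: (L - k)%N => [|n IH].
  rewrite addn0 subrr big1 ?mulr0 // => j _.
  by rewrite leqNgt ltn_ord mul0r.
rewrite addnS big_ord_recr /= mulrDr IH leq_addr mul1r exprS; ring.
Qed.

Section Sampling.
Variables (X : nat) (a : nat -> R) (B h : R) (L : nat).
Hypothesis B0 : 0 < B.
Hypothesis h0 : 0 < h <= 4^-1.
Hypothesis L0 : (0 < L)%N.
Hypothesis dle1 : pi *+ 2 / (L%:R * h) <= 1.
Hypothesis hS : forall t,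
  cabs (\sum_(n < X) (a n)%:C * cnp n (- (2 +i* t))) <= B * (4 + `|t|) `^ (4^-1).

Let A := \sum_(n < X) `|a n|.
(** Keeps the effect of rounding the logarithms to multiples of [h] below [B], as [hL] does for the
    truncation at index [L]; together with [hS] this gives the [3 * B] of [F_bound]. *)
Hypothesis hA : 2 * A * h `^ (4^-1) <= B.
Hypothesis hL : A * expR (- 2 * (h * L%:R)) <= B.

Let k n := Num.truncn (ln (n.+1%:R : R) / h).
Hypothesis kL : (k X <= L)%N.

Let q := expR (- 2 * h).
Let th : R := pi *+ 2 / L%:R.
Let z := cexp (0 +i* th).
Let d : R := pi *+ 2 / (L%:R * h).
(** Samples at [u = j h] of [exp (- 2 u)] times the sum of the [a n] with [ln (n + 1) <= u], the
    logarithms being rounded down to multiples of [h]. [F] is the discrete Fourier transform of [f],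
    and [d] the spacing of its frequencies on the scale of [t]. *)
Let f (j : nat) := q ^+ j * \sum_(n < X) (k n <= j)%N%:R * a n.
Let F (l : nat) := \sum_(j < L) (f j)%:C * (z ^+ l) ^+ j.
Let y (i : nat) : R := (4 + d * i%:R) `^ (4^-1).

Let hp : 0 < h. Proof. by case/andP: h0. Qed.

Let Lp : 0 < (L%:R : R). Proof. by rewrite ltr0n. Qed.

Let pi2 : 0 < (pi *+ 2 : R). Proof. by rewrite pmulrn_rgt0 // pi_gt0. Qed.

Let d0 : 0 < d. Proof. by rewrite divr_gt0 // mulr_gt0. Qed.

Let dh : d * h = th.
Proof. by rewrite /d /th; field; rewrite !gt_eqF. Qed.

Let k_itv n : (k n)%:R * h <= ln (n.+1%:R : R) < (k n).+1%:R * h.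
Proof.
rewrite -ler_pdivlMr // -ltr_pdivrMr //; apply: truncn_itv.
by rewrite divr_ge0 ?(ltW hp) // ln_ge0 // ler1n.
Qed.

Let k_mono m n : (m <= n)%N -> (k m <= k n)%N.
Proof.
move=> mn; rewrite /k truncn_ge_nat; last by rewrite divr_ge0 ?(ltW hp) // ln_ge0 // ler1n.
apply: le_trans (_ : ln m.+1%:R / h <= _).
  by apply: (andP (truncn_itv _)).1; rewrite divr_ge0 ?(ltW hp) // ln_ge0 // ler1n.
by rewrite ler_pM2r ?invr_gt0 // ler_ln ?posrE // ler_nat.
Qed.

Let q12 : 2^-1 <= q <= 1.
Proof.
case/andP: h0 => _ h4; rewrite /q; apply/andP; split.
  have := expR_ge1Dx (- 2 * h); lra.
have h1 := hp; by rewrite -[leRHS]expR0 ler_expR; lra.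
Qed.

Let qX j : q ^+ j = expR (- 2 * (h * j%:R)).
Proof. by rewrite /q -expRM_natr; congr expR; ring. Qed.

(* Replacing [ln n.+1] by the nearest lower multiple of [h] moves the
   Dirichlet polynomial by little, and makes it a trigonometric polynomial. *)
Let F_bound l : th * l%:R <= pi -> cabs (F l) ^+ 2 <= (3 * B) ^+ 2 * 36 / h ^+ 2 / y l ^+ 6.
Proof.
move=> lpi; pose t := d * l%:R; pose w := q%:C * z ^+ l.
have t0 : 0 <= t by rewrite mulr_ge0 // ltW.
have phi : 0 <= th * l%:R <= pi by rewrite lpi andbT mulr_ge0 // divr_ge0 // ltW.
have zl : z ^+ l = cexp (0 +i* (th * l%:R)) by rewrite cexp_imagX.
have wX j : w ^+ j = cexp ((- 2 +i* t) * (j%:R * h)%:C).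
  rewrite /w exprMn -rmorphXn /= qX zl cexp_imagX -cexp_real -cexpD; congr cexp; apply/eqP.
  rewrite eq_complex cReM cImM /=; apply/andP; split; apply/eqP; first by ring.
  by rewrite -dh /t; ring.
have wL : w ^+ L = (expR (- 2 * (h * L%:R)))%:C.
  rewrite /w exprMn -rmorphXn /= qX -exprM mulnC exprM.
  by rewrite (unity_cexp R L0).1 expr1n mulr1.
(* The factor [1 - w] turns each step function [k n <= j] back into a power, up to the end term
   [w ^ L]. *)
have FE : (1 - w) * F l = \sum_(n < X) (a n)%:C * (w ^+ k n - w ^+ L).
  have -> : F l = \sum_(n < X) (a n)%:C * \sum_(j < L) (k n <= j)%N%:R * w ^+ j.
    under [RHS]eq_bigr do rewrite mulr_sumr.
    rewrite exchange_big /=; apply: eq_bigr => j _.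
    rewrite /f rmorphM rmorph_sum /= rmorphXn /= mulr_sumr mulr_suml; apply: eq_bigr => n _.
    by rewrite rmorphM rmorph_nat /w exprMn; ring.
  rewrite mulr_sumr; apply: eq_bigr => n _; rewrite mulrCA geo_range //.
  by apply: leq_trans kL; apply: k_mono; exact: ltnW.
have y1 : 1 <= y l.
  rewrite -[leLHS](congr1 (@^~ (4^-1)) (@powR1 R)) ge0_ler_powR ?nnegrE //.
    by rewrite addr_ge0 //.
  by rewrite -/t; lra.
have P : cabs ((1 - w) * F l) <= 3 * B * y l.
  rewrite FE (_ : \sum_(n < X) _ = \sum_(n < X) (a n)%:C * cnp n (- (2 +i* (- t))) +
     \sum_(n < X) (a n)%:C * (w ^+ k n - cnp n (- (2 +i* (- t)))) -
     \sum_(n < X) (a n)%:C * w ^+ L); last first.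
    rewrite -big_split -sumrB; apply: eq_bigr => n _ /=.
    by move: (w ^+ k n) (w ^+ L) (cnp n _) => u v c; ring.
  apply: le_trans (cabsB _ _) _; rewrite (_ : 3 * B * y l = B * y l + B * y l + B * y l); last by ring.
  apply: lerD; last first.
    apply: le_trans (cabs_sum _ _ _) _; apply: (@le_trans _ _ B); last by rewrite ler_peMr // ltW.
    apply: le_trans hL; rewrite /A mulr_suml ler_sum // => n _.
    by rewrite cabsM cabs_real wL cabs_real [`|expR _|]ger0_norm ?expR_ge0.
  apply: le_trans (cabsD _ _) _; apply: lerD.
    by have := hS (- t); rewrite normrN ger0_norm.
  apply: le_trans (cabs_sum _ _ _) _; rewrite -/A.
  apply: (@le_trans _ _ (\sum_(n < X) `|a n| * (2 * (h `^ (4^-1) * y l)))); last first.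
    rewrite -mulr_suml -/A (_ : A * _ = 2 * A * h `^ (4^-1) * y l); last by ring.
    by rewrite ler_pM2r // (lt_le_trans ltr01).
  apply: ler_sum => n _; rewrite cabsM cabs_real ler_wpM2l //.
  have -> : cnp n (- (2 +i* - t)) = cexp ((- 2 +i* t) * (ln (n.+1%:R : R))%:C).
    have -> : - (2 +i* - t) = - 2 +i* t by apply/eqP; rewrite eq_complex cReN cImN /= opprK !eqxx.
    by [].
  have /andP[k1 k2] := k_itv n.
  rewrite wX; apply: le_trans (@cexp_line_dist t _ _ _) _.
    by rewrite mulr_ge0 ?(ltW hp) //= .
  rewrite ler_pM2l // mulrC -powRM ?(ltW hp) //; last by rewrite addr_ge0.
  have s1 : 0 <= 4 + t by rewrite addr_ge0.
  have s2 : 0 <= ln n.+1%:R - (k n)%:R * h by rewrite subr_ge0.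
  rewrite ger0_norm //; apply: ge0_ler_powR; rewrite ?nnegrE //.
  - by rewrite mulr_ge0.
  - by rewrite mulr_ge0 // ltW.
  apply: (ler_wpM2r s1); rewrite lerBlDr; move: k2.
  by rewrite -[(k n).+1%:R]natr1 mulrDl mul1r addrC => /ltW.
have /andP[q2 q1] := q12.
(* [|1 - w|] plays the role of [h |s|]: it is at least [h (4 + t) / 6]. *)
have lw : h ^+ 2 * y l ^+ 8 / 36 <= cabs (1 - w) ^+ 2.
  apply: le_trans (_ : _ <= (1 - q) ^+ 2 + (th * l%:R) ^+ 2 / 18) _; last first.
    by rewrite /w zl one_sub_lower.
  have -> : y l ^+ 8 = (4 + t) ^+ 2.
    have y4 : y l ^+ 4 = 4 + t.
      by rewrite /y -powR_mulrn ?powR_ge0 // -powRrM mulVf // powRr1 // addr_ge0.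
    by rewrite (exprM _ 4 2) y4.
  have -> : th * l%:R = h * t by rewrite -dh /t; ring.
  have q3 : h <= 1 - q.
    have h4 : h <= 4^-1 by case/andP: h0.
    rewrite /q mulNr expRN lerBrDr -lerBrDl; have e := expR_ge1Dx (2 * h).
    have e0 := expR_gt0 (2 * h).
    rewrite -[_^-1]mul1r ler_pdivrMr //; apply: le_trans (_ : 1 <= (1 - h) * (1 + 2 * h)) _.
      by have := hp; nra.
    by rewrite ler_wpM2l //; lra.
  have hq : h ^+ 2 <= (1 - q) ^+ 2 by rewrite ler_pXn2r ?nnegrE ?(ltW hp) //; have := hp; lra.
  have h2 : 0 < h ^+ 2 by rewrite exprn_gt0.
  have e : h ^+ 2 * (4 + t) ^+ 2 <= h ^+ 2 * (36 + 2 * t ^+ 2).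
    by rewrite ler_pM2l //; have := sqr_ge0 (t - 4); lra.
  rewrite exprMn; lra.
have yp : 0 < y l by apply: lt_le_trans y1.
have den : 0 < h ^+ 2 * y l ^+ 8 / 36 by rewrite !mulr_gt0 ?exprn_gt0 ?invr_gt0.
rewrite -(ler_pM2l den).
apply: (@le_trans _ _ (cabs ((1 - w) * F l) ^+ 2)).
  by rewrite cabsM exprMn ler_wpM2r // exprn_ge0 ?cabs_ge0.
apply: (@le_trans _ _ ((3 * B * y l) ^+ 2)).
  by rewrite ler_pXn2r ?nnegrE ?cabs_ge0 // !mulr_ge0 // ltW.
by rewrite le_eqVlt; apply/orP; left; apply/eqP; field; rewrite !gt_eqF.
Qed.

(** [f] is real, so frequencies above [pi] are conjugate to frequencies below, where [F_bound]
    holds. *)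
Let F_sym l : (l <= L)%N -> cabs (F (L - l)%N) = cabs (F l).
Proof.
move=> lL; have -> : cabs (F l) = cabs (conjc (F l)) by rewrite !cabsE; case: (F l) => u v /=; rewrite sqrrN.
congr cabs; rewrite /F rmorph_sum /=; apply: eq_bigr => j _.
rewrite conjc_scale rmorphXn /= (@conjc_expn _ _ L) //; first by rewrite cabs_cexp /= expR0.
exact: (unity_cexp R L0).1.
Qed.

Let f_sum : h * \sum_(j < L) f j ^+ 2 <= 324 * B ^+ 2.
Proof.
have pz : cabs z = 1 by rewrite cabs_cexp /= expR0.
have [zL zn] := unity_cexp R L0.
have := parseval f pz zL zn; rewrite -/(F _) => P.
pose H (l : nat) := (3 * B) ^+ 2 * 36 / h ^+ 2 / y l ^+ 6.
have H0 l : 0 <= H l.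
  by rewrite /H !mulr_ge0 ?invr_ge0 ?exprn_ge0 ?mulr_ge0 ?powR_ge0 // ltW.
have FH (l : 'I_L) : cabs (F l) ^+ 2 <= H l + H (L - l)%N.
  have [le|lt] := leP (th * l%:R) pi.
    by apply: le_trans (F_bound le) _; rewrite lerDl.
  rewrite -F_sym ?(ltnW (ltn_ord l)) //; apply: le_trans (F_bound _) _; last by rewrite lerDr.
  rewrite natrB ?(ltnW (ltn_ord l)) // mulrBr /th divfK ?gt_eqF // -/th.
  by move: lt; rewrite mulr2n; lra.
have S2 : \sum_(l < L) (H l + H (L - l)%N) <= 2 * \sum_(l < L.+1) H l.
  rewrite big_split /= mulr_natl mulr2n; apply: lerD.
    by rewrite big_ord_recr /= lerDl.
  rewrite big_ord_recl /= (reindex_inj rev_ord_inj) /=.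
  rewrite (eq_bigr (fun i : 'I_L => H i.+1)); last first.
    by move=> i _; rewrite subKn.
  by rewrite lerDr.
have S3 : d * \sum_(l < L.+1) H l <= (3 * B) ^+ 2 * 36 / h ^+ 2 * 2.
  rewrite -mulr_sumr mulrCA ler_wpM2l //.
    by rewrite !mulr_ge0 ?invr_ge0 ?exprn_ge0 ?mulr_ge0 // ltW.
  by apply: quarter_sum; rewrite d0 dle1.
have S4 : d * (L%:R * \sum_(j < L) f j ^+ 2) <= (3 * B) ^+ 2 * 36 / h ^+ 2 * 4.
  rewrite -P.
  apply: (@le_trans _ _ (d * (2 * \sum_(l < L.+1) H l))).
    rewrite ler_wpM2l ?(ltW d0) //; apply: le_trans S2; apply: ler_sum => l _; exact: FH.
  by rewrite mulrCA; lra.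
have dL : d * L%:R = pi *+ 2 / h by rewrite /d; field; rewrite !gt_eqF.
move: S4; rewrite mulrA dL.
set S := \sum_(j < L) f j ^+ 2; have S0 : 0 <= S by apply: sumr_ge0 => j _; exact: sqr_ge0.
have h2 : 0 < h ^+ 2 by rewrite exprn_gt0.
rewrite -(ler_pM2l h2) (_ : h ^+ 2 * (_ / h * S) = pi *+ 2 * (h * S)); last by field; rewrite gt_eqF.
rewrite (_ : h ^+ 2 * _ = 1296 * B ^+ 2); last by field; rewrite gt_eqF.
(* [1296 / (2 pi) <= 324]. *)
have := pi_ge2 R; have : 0 <= h * S by rewrite mulr_ge0 // ltW.
rewrite -mulr_natr; nra.
Qed.

Hypothesis hX : 2 * h <= X.+1%:R^-1.

(** For [k N <= j < k N.+1], [f j] is [q ^ j] times the partial sum up to [N]. Such a block has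
    length at least [1 / (2 h (N + 2))] by [hX], and [q ^ (2 j) >= (N + 2) ^ (- 4)] on it; this
    makes the exponent 5. *)
Lemma sampled_mean_square :
  \sum_(N < X) (\sum_(n < N.+1) a n) ^+ 2 / N.+2%:R ^+ 5 <= 648 * B ^+ 2.
Proof.
have k0 : k 0%N = 0%N by rewrite /k ln1 mul0r truncn0.
have part M : \sum_(N < M) \sum_(k N <= j < k N.+1) f j ^+ 2 = \sum_(0 <= j < k M) f j ^+ 2.
  elim: M => [|M IH]; first by rewrite big_ord0 k0 big_geq.
  by rewrite big_ord_recr /= IH -big_cat_nat // k_mono.
have le1 : h * \sum_(N < X) \sum_(k N <= j < k N.+1) f j ^+ 2 <= 324 * B ^+ 2.
  apply: le_trans f_sum; rewrite ler_wpM2l ?(ltW hp) // part -(big_mkord xpredT (fun j => f j ^+ 2)).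
  by rewrite [leRHS](big_cat_nat (n := k X)) //= lerDl sumr_ge0 // => j _; exact: sqr_ge0.
suff le2 : \sum_(N < X) (\sum_(n < N.+1) a n) ^+ 2 / N.+2%:R ^+ 5 <=
    2 * (h * \sum_(N < X) \sum_(k N <= j < k N.+1) f j ^+ 2) by lra.
rewrite mulrA mulr_sumr; apply: ler_sum => N _.
set AN := \sum_(n < N.+1) a n.
have fj j : (k N <= j < k N.+1)%N -> f j ^+ 2 = AN ^+ 2 * expR (- 4 * (h * j%:R)).
  move=> /andP[j1 j2]; rewrite /f exprMn mulrC; congr (_ * _).
    congr (_ ^+ 2); rewrite (bigID (fun n : 'I_X => (n < N.+1)%N)) /= [X in _ + X]big1 ?addr0.
      rewrite -(big_ord_widen _ (fun n => (k n <= j)%N%:R * a n)) //.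
      apply: eq_bigr => n _; rewrite (leq_trans _ j1) ?mul1r // k_mono // -ltnS //.
    move=> n; rewrite -leqNgt => nN; rewrite leqNgt (leq_trans j2) ?mul0r //=; exact: k_mono.
  by rewrite qX -expRM_natr; congr expR; ring.
rewrite (eq_big_nat _ _ fj) -mulr_sumr.
have low j : (k N <= j < k N.+1)%N -> (N.+2%:R ^+ 4)^-1 <= expR (- 4 * (h * j%:R)).
  move=> /andP[_ j2]; rewrite mulNr expRN lef_pV2 ?posrE ?expR_gt0 ?exprn_gt0 //.
  rewrite mulrC expRM_natr ler_pXn2r ?nnegrE ?expR_ge0 //.
  rewrite -[leRHS]lnK ?posrE // ler_expR; apply: le_trans (andP (k_itv N.+1)).1.
  by rewrite mulrC ler_wpM2r ?(ltW hp) // ler_nat ltnW.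
have cnt : (k N.+1 - k N)%N%:R * (N.+2%:R ^+ 4)^-1 <=
    \sum_(k N <= j < k N.+1) expR (- 4 * (h * j%:R)).
  rewrite -[leLHS](_ : \sum_(k N <= j < k N.+1) (N.+2%:R ^+ 4)^-1 = _); last first.
    by rewrite sumr_const_nat mulr_natl.
  rewrite big_nat [leRHS]big_nat; exact: ler_sum.
have step : (N.+2%:R)^-1 <= 2 * h * (k N.+1 - k N)%N%:R.
  rewrite natrB ?k_mono //.
  have /andP[a1 a2] := k_itv N; have /andP[b1 b2] := k_itv N.+1.
  have lnN : (N.+2%:R)^-1 <= ln (N.+2%:R : R) - ln (N.+1%:R : R).
    have n2 : (N.+2%:R : R)^-1 <= 2^-1 by rewrite lef_pV2 ?posrE // ler_nat.
    have E : 1 - N.+2%:R^-1 = N.+1%:R / N.+2%:R :> R.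
      have n0 : N.+2%:R != 0 :> R by rewrite pnatr_eq0.
      by apply: (mulIf n0); rewrite mulrBl mulVf // mul1r divfK // -[N.+2%:R]natr1 addrK.
    have := @ln1D_bounds R (- N.+2%:R^-1); rewrite lerN2 => /(_ n2)/andP[_].
    by rewrite E ln_div ?posrE // => h'; rewrite -[leRHS]opprB lerNr.
  have hX2 : 2 * h <= (N.+2%:R)^-1.
    by apply: le_trans hX _; rewrite lef_pV2 ?posrE // ler_nat !ltnS.
  move: a2 b1; rewrite -[(k N).+1%:R]natr1 mulrDl mul1r => a2 b1.
  move: b2; rewrite -[(k N.+1).+1%:R]natr1 mulrDl mul1r.
  move=> b2; have E3 : (k N.+1)%:R * h - (k N)%:R * h >= N.+2%:R^-1 - h.
    apply: le_trans (lerB (ltW _) a1); last by rewrite -ltrBlDr in b2; exact: b2.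
    by apply: le_trans (lerB lnN (lexx h)) _; rewrite addrAC.
  rewrite -mulrA mulrBr ![h * _]mulrC; move: hX2 E3.
  move: (N.+2%:R^-1) ((k N.+1)%:R * h) ((k N)%:R * h) => u v w h1 h2; lra.
apply: (@le_trans _ _ (2 * h * (AN ^+ 2 * ((k N.+1 - k N)%N%:R * (N.+2%:R ^+ 4)^-1)))); last first.
  by rewrite ler_wpM2l ?mulr_ge0 ?(ltW hp) // ler_wpM2l // sqr_ge0.
rewrite (_ : 2 * h * _ = AN ^+ 2 * (2 * h * (k N.+1 - k N)%N%:R) / N.+2%:R ^+ 4); last by ring.
rewrite (_ : AN ^+ 2 / _ = AN ^+ 2 * N.+2%:R^-1 / N.+2%:R ^+ 4); last first.
  by field; rewrite gt_eqF.
by rewrite ler_wpM2r ?invr_ge0 ?exprn_ge0 // ler_wpM2l ?sqr_ge0.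
Qed.

End Sampling.

(** The discrete counterpart of [2 pi] times the integral of [|A x| ^ 2 x ^ (- 5)] being that of
    [|S (2 + i t)| ^ 2 / |2 + i t| ^ 2], where [S] is the Dirichlet polynomial and [A] the summatory
    function of its coefficients. It remains to choose a step [h] and a length [L] that satisfy the
    sampling hypotheses. *)
Lemma dirichlet_mean_square X a (B : R) : 0 < B ->
  (forall t, cabs (\sum_(n < X) (a n)%:C * cnp n (- (2 +i* t))) <= B * (4 + `|t|) `^ (4^-1)) ->
  \sum_(N < X) (\sum_(n < N.+1) a n) ^+ 2 / N.+2%:R ^+ 5 <= 648 * B ^+ 2.
Proof.
move=> B0 hS; pose A := \sum_(n < X) `|a n|.
have A0 : 0 <= A by apply: sumr_ge0.
pose s := (2 * X.+2%:R + 2 * A / B)^-1.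
have iA : 0 <= 2 * A / B by rewrite divr_ge0 ?mulr_ge0 // ltW.
have X2 : 2 <= X.+2%:R :> R by rewrite ler_nat.
have s0 : 0 < s by rewrite invr_gt0; lra.
have s1 : 2 * s <= X.+2%:R^-1.
  rewrite -[leRHS](_ : 2 * (2 * X.+2%:R)^-1 = _); last by rewrite invfM mulrA divff ?mul1r.
  by rewrite ler_pM2l // lef_pV2 ?posrE; lra.
have s2 : s <= 4^-1 by rewrite lef_pV2 ?posrE; lra.
(* A fourth power, as the rounding error involves [h ^ (1/4)]. *)
pose h := s ^+ 4.
have h0 : 0 < h by rewrite exprn_gt0.
have hs : h <= s by rewrite /h exprS ler_piMr ?(ltW s0) // exprn_ile1 // ?ltW //; lra.
(* The first summand bounds the frequency spacing by 1, the second makes [exp (- 2 h L)] small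
   through [y <= exp y], and the third places every logarithm below [h L]. *)
pose L := (Num.truncn (pi *+ 2 / h + A / (2 * h * B)) + Num.truncn (ln (X.+1%:R : R) / h)).+1.
have p0 : 0 <= pi *+ 2 / h by rewrite divr_ge0 ?(ltW h0) // mulrn_wge0 // pi_ge0.
have Ah : 0 <= A / (2 * h * B) by rewrite divr_ge0 // ltW // !mulr_gt0.
have LE : pi *+ 2 / h + A / (2 * h * B) <= L%:R.
  apply: ltW; apply: lt_le_trans (truncnS_gt _) _; rewrite ler_nat ltnS; exact: leq_addr.
have L0 : 0 < (L%:R : R) by rewrite ltr0n.
apply: (@sampled_mean_square X a B h L) => //.
- by rewrite h0 (le_trans hs).
- rewrite ler_pdivrMr ?mulr_gt0 // mul1r -ler_pdivrMr //; lra.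
- rewrite /h -powR_mulrn ?(ltW s0) // -powRrM divff // powRr1 ?(ltW s0) //.
  rewrite -/A /s ler_pdivrMr; last by lra.
  rewrite mulrDr [B * (2 * A / B)]mulrC divfK ?gt_eqF // lerDr mulr_ge0 ?ltW //; lra.
- rewrite -/A mulNr expRN ler_pdivrMr ?expR_gt0 //.
  apply: (@le_trans _ _ (B * (2 * (h * L%:R)))); last first.
    by rewrite ler_pM2l //; have := expR_ge1Dx (2 * (h * L%:R)); lra.
  rewrite (_ : B * _ = L%:R * (2 * h * B)); last by ring.
  rewrite -ler_pdivrMr ?mulr_gt0 //; lra.
- by rewrite /L leqW // leq_addl.
- apply: le_trans (_ : 2 * s <= _); first by rewrite ler_pM2l.
  by apply: le_trans s1 _; rewrite lef_pV2 ?posrE // ler_nat.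
Qed.

End MeanSquare.

(** * The Mertens function on average *)

Section MertensMean.
Variable R : realType.
Implicit Types (a r s : R).

Definition mobR n : R := (mobius n.+1)%:~R.

Lemma mu_mobR n : mu R n = (mobR n)%:C.
Proof. by rewrite /mobR rmorph_int. Qed.

Definition Ak k N : R := \sum_(n < N.+1) mobR n * lnk R k n.

(** The mean square inequality takes a polynomial, so the series of [dk t k] is cut at some [X >= Y]
    so large that the tail is below [C / r ^ k] for every [t] at once. This doubles the constant. *)
Lemma mean_square_Ak a r : 0 < a < 1 -> 0 < r < 2 - a ->
  (forall s : R[i], a < complex.Re s -> zf s != 0) ->
  exists2 C : R, 0 < C & forall k Y,
    \sum_(N < Y) Ak k N ^+ 2 / N.+2%:R ^+ 5 <= C / (r ^+ k) ^+ 2.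
Proof.
move=> a01 hr nz; have [C C0 hC] := dk_bound a01 hr nz; have /andP[r0 _] := hr.
exists (648 * (2 * C) ^+ 2).
  have c2 : 0 < 2 * C by rewrite mulr_gt0.
  rewrite pmulr_rgt0; [exact: exprn_gt0|by rewrite ltr0n].
move=> k Y; have rk : 0 < r ^+ k by rewrite exprn_gt0.
have e0 : 0 < C / r ^+ k by rewrite divr_gt0.
have t0 n : 0 <= n.+1%:R `^ (- 2) * lnk R k n by rewrite mulr_ge0 ?powR_ge0 ?lnk_ge0.
have [N0 hN0] := bsum_tail t0 (bsum_lnk R k) e0.
pose X := maxn Y N0.
have -> : 648 * (2 * C) ^+ 2 / (r ^+ k) ^+ 2 = 648 * (2 * (C / r ^+ k)) ^+ 2.
  by field; rewrite gt_eqF.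
apply: le_trans (@dirichlet_mean_square R X (fun n => mobR n * lnk R k n) _ _ _).
- apply: (@psum_mono R (fun N => Ak k N ^+ 2 / N.+2%:R ^+ 5)); last exact: leq_maxl.
  by move=> N; rewrite divr_ge0 ?sqr_ge0 ?exprn_ge0.
- by rewrite mulr_gt0.
move=> t; set D := 4 + `|t|.
have D1 : 1 <= D `^ (4^-1).
  rewrite -[leLHS](congr1 (@^~ (4^-1)) (@powR1 R)) ge0_ler_powR ?nnegrE ?addr_ge0 //.
  by rewrite /D -[leLHS]addr0 lerD // ler1n.
have E n : (mobR n * lnk R k n)%:C * cnp n (- (2 +i* t)) =
    (-1) ^+ k * (mu R n * ecoef (ln n.+1%:R) (- (2 +i* t)) k).
  rewrite mu_mobR /ecoef /lnk /cnp (_ : (- ln n.+1%:R) ^+ k = (-1) ^+ k * ln n.+1%:R ^+ k); last first.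
    by rewrite -exprMn mulN1r.
  rewrite !rmorphM !rmorphXn !rmorphN !rmorph1.
  have : ((-1) ^+ k : R[i]) * (-1) ^+ k = 1 by rewrite -exprMn mulrNN mulr1 expr1n.
  set u := (-1) ^+ k; set v := cexp _; move=> uu; rewrite -[LHS]mul1r -uu; ring.
under eq_bigr do rewrite E.
rewrite -mulr_sumr cabsM cabsX cabsN cabs1 expr1n mul1r.
have tail : cabs (dk t k - \sum_(n < X) (mu R n * ecoef (ln n.+1%:R) (- (2 +i* t)) k)) <= C / r ^+ k.
  apply: hasS_tail (hasS_dk t k) _ => n; apply: ltW; apply: le_lt_trans (hN0 X n (leq_maxr _ _)).
  by apply: ler_sum => i _; exact: cabs_dterm.
have := hC t k; rewrite -ler_pdivlMr // -/D => h.
apply: (@le_trans _ _ (cabs (dk t k) + C / r ^+ k)).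
  by rewrite -lerBlDl; apply: le_trans tail; rewrite cabs_distC; exact: cabs_subr_ge.
move: h tail D1; rewrite mulrAC; set W := D `^ _; set c := C / r ^+ k => h _ D1.
have : c <= c * W by rewrite ler_peMr // ltW.
lra.
Qed.

Lemma zeta_psum2 s m : 1 < s -> \sum_(n < m) (n.+2%:R : R) `^ (- s) <= (s - 1)^-1.
Proof.
move=> s1; have := zeta_psum m.+1 s1.
by rewrite big_ord_recl powR1 lerD2l.
Qed.

(** Cauchy-Schwarz with the splitting [N ^ (- (3 + e)) = N ^ (- 5/2) N ^ (- (1/2 + e))], in the form
    [2 x v <= q x ^ 2 + v ^ 2 / q]. The choice [q = r ^ k] makes both sums of order [r ^ (- k)]. The
    power of 2 pays for the shift from [N + 1] to [N + 2]. *)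
Lemma mean_Ak a r e : 0 < a < 1 -> 0 < r < 2 - a -> 0 < e ->
  (forall s : R[i], a < complex.Re s -> zf s != 0) ->
  exists2 C : R, 0 < C & forall k Y,
    \sum_(N < Y) `|Ak k N| * N.+1%:R `^ (- (3 + e)) <= C / r ^+ k.
Proof.
move=> a01 hr e0 nz; have [C C0 hC] := mean_square_Ak a01 hr nz; have /andP[r0 _] := hr.
have e1 : 1 < 1 + 2 * e by rewrite ltrDl mulr_gt0.
exists (2 `^ (3 + e) * (C + (2 * e)^-1)).
  by rewrite mulr_gt0 ?powR_gt0 // addr_gt0 // invr_gt0 mulr_gt0.
move=> k Y; have rk : 0 < r ^+ k by rewrite exprn_gt0.
apply: (@le_trans _ _ (2 `^ (3 + e) * \sum_(N < Y) (r ^+ k * (Ak k N ^+ 2 / N.+2%:R ^+ 5) +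
    (r ^+ k)^-1 * N.+2%:R `^ (- (1 + 2 * e))))); last first.
  rewrite -mulrA ler_wpM2l ?powR_ge0 // big_split /= -!mulr_sumr [leRHS]mulrDl; apply: lerD.
    apply: le_trans (ler_wpM2l (ltW rk) (hC k Y)) _.
    by rewrite le_eqVlt; apply/orP; left; apply/eqP; field; rewrite gt_eqF.
  rewrite [leRHS]mulrC ler_pM2l ?invr_gt0 //; apply: le_trans (zeta_psum2 _ e1) _.
  by rewrite addrAC subrr add0r.
rewrite mulr_sumr; apply: ler_sum => N _.
have w : (N.+1%:R : R) `^ (- (3 + e)) <= 2 `^ (3 + e) * N.+2%:R `^ (- (3 + e)).
  rewrite -[N.+2%:R](@divfK _ 2) // [_ / 2 * 2]mulrC powRM // mulrA -powRD ?subrr ?powRr0 ?mul1r; last first.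
    by rewrite pnatr_eq0 implybT.
  rewrite !powRN lef_pV2 ?posrE ?powR_gt0 ?divr_gt0 //.
  have h2 : (N.+2%:R : R) / 2 <= N.+1%:R by rewrite ler_pdivrMr // -natrM ler_nat; lia.
  have e3 : 0 <= 3 + e by rewrite addr_ge0 // ltW.
  by apply: ge0_ler_powR; rewrite ?nnegrE ?divr_ge0.
apply: le_trans (ler_wpM2l (normr_ge0 _) w) _.
rewrite mulrCA ler_wpM2l ?powR_ge0 //.
set A := Ak k N; set n : R := N.+2%:R.
have n0 : 0 < n by [].
pose v := n `^ (- (2^-1 + e)); pose u := n `^ (- (5 / 2)).
have -> : n `^ (- (3 + e)) = u * v.
  rewrite (_ : - (3 + e) = - (5 / 2) + - (2^-1 + e)); last by field.
  by rewrite powRD // (gt_eqF n0) implybT.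
have -> : (n ^+ 5)^-1 = u ^+ 2.
  rewrite -[RHS]powR_mulrn ?powR_ge0 // -powRrM (_ : - (5 / 2) * 2 = - 5%:R); last by field.
  by rewrite powRN powR_mulrn // ltW.
have -> : n `^ (- (1 + 2 * e)) = v ^+ 2.
  by rewrite /v -powR_mulrn ?powR_ge0 // -powRrM; congr (_ `^ _); field.
set q := r ^+ k; have q0 : 0 < q by [].
rewrite -(real_normK (num_real A)); have := normr_ge0 A; set B := `|A| => B0.
have : 0 <= (q * (B * u) - v) ^+ 2 / q by rewrite divr_ge0 ?sqr_ge0 // ltW.
rewrite (_ : _ / q = q * (B ^+ 2 * u ^+ 2) - 2 * (B * (u * v)) + q^-1 * v ^+ 2); last first.
  by field; rewrite gt_eqF.
have : 0 <= B * (u * v) by rewrite !mulr_ge0 ?powR_ge0.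
lra.
Qed.

Definition Bp (c : R) N : R := \sum_(n < N.+1) mobR n * n.+1%:R `^ c.

(* Expand [(n + 1) ^ c = \sum_k c ^ k ln (n + 1) ^ k / k!]. *)
Lemma mean_Bp a r c e : 0 < a < 1 -> 0 < c < r -> r < 2 - a -> 0 < e ->
  (forall s : R[i], a < complex.Re s -> zf s != 0) ->
  exists2 C : R, 0 < C & forall Y,
    \sum_(N < Y) `|Bp c N| * N.+1%:R `^ (- (3 + e)) <= C.
Proof.
move=> a01 /andP[c0 cr] ra e0 nz; have r0 : 0 < r := lt_trans c0 cr.
have hr : 0 < r < 2 - a by rewrite r0.
have [C C0 hC] := mean_Ak a01 hr e0 nz.
have q0 : 0 < c / r by rewrite divr_gt0.
have q1 : c / r < 1 by rewrite ltr_pdivrMr // mul1r.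
exists (C / (1 - c / r)); first by rewrite divr_gt0 ?subr_gt0.
(* Signs turn the sum of absolute values into an expression linear in the [Bp c N], into which the
   exponential series can be inserted termwise. *)
move=> Y; pose cc N := Num.sg (Bp c N) * N.+1%:R `^ (- (3 + e)).
have -> : \sum_(N < Y) `|Bp c N| * N.+1%:R `^ (- (3 + e)) = \sum_(N < Y) cc N * Bp c N.
  by apply: eq_bigr => N _; rewrite /cc normrEsg; ring.
have h : hasS (fun k => (\sum_(N < Y) cc N * (c ^+ k * Ak k N))%:C) (\sum_(N < Y) cc N * Bp c N)%:C.
  rewrite rmorph_sum /=.
  have h0 N : hasS (fun k => (cc N * (c ^+ k * Ak k N))%:C) (cc N * Bp c N)%:C.
    have h1 n : hasS (fun k => (cc N * mobR n)%:C * ((c * ln n.+1%:R)%:C ^+ k / k`!%:R))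
        (cc N * (mobR n * n.+1%:R `^ c))%:C.
      have -> : (cc N * (mobR n * n.+1%:R `^ c))%:C = (cc N * mobR n)%:C * (expR (c * ln n.+1%:R))%:C.
        by rewrite powR_nat !rmorphM /=; ring.
      exact: hasSZ (hasS_cexp_real _).
    have := @hasS_sumf R (fun n k => (cc N * mobR n)%:C * ((c * ln n.+1%:R)%:C ^+ k / k`!%:R)) _ N.+1 (fun n _ => h1 n).
    rewrite /Bp mulr_sumr rmorph_sum /=; apply: hasS_ext => k.
    rewrite /Ak mulr_sumr mulr_sumr rmorph_sum /=; apply: eq_bigr => n _.
    by rewrite /lnk !rmorphM /= exprMn fmorphV rmorph_nat !rmorphXn; ring.
  have := @hasS_sumf R (fun N k => (cc N * (c ^+ k * Ak k N))%:C) _ Y (fun N _ => h0 N).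
  by apply: hasS_ext => k; rewrite rmorph_sum.
have := hasS_le h; rewrite cabs_real => hle.
apply: le_trans (ler_norm _) _; apply: hle => n.
apply: (@le_trans _ _ (\sum_(k < n) C * (c / r) ^+ k)).
  apply: ler_sum => k _; rewrite cabs_real.
  apply: le_trans (ler_norm_sum _ _ _) _.
  apply: (@le_trans _ _ (c ^+ k * \sum_(N < Y) `|Ak k N| * N.+1%:R `^ (- (3 + e)))).
    rewrite mulr_sumr; apply: ler_sum => N _; rewrite !normrM normrX (gtr0_norm c0).
    rewrite [`|_ `^ _|]ger0_norm ?powR_ge0 //.
    rewrite (_ : _ * _ * _ = c ^+ k * (`|Ak k N| * N.+1%:R `^ (- (3 + e))) * `|Num.sg (Bp c N)|); last by ring.
    rewrite ler_piMr ?mulr_ge0 ?exprn_ge0 ?powR_ge0 ?(ltW c0) //.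
    by rewrite normr_sg; case: (_ == _).
  apply: le_trans (ler_wpM2l (exprn_ge0 _ (ltW c0)) (hC k Y)) _.
  by rewrite expr_div_n mulrCA.
rewrite -mulr_sumr ler_pM2l // -[leRHS]mul1r ler_pdivlMr ?subr_gt0 //.
have := subrX1 (c / r) n; have : 0 <= (c / r) ^+ n by rewrite exprn_ge0 // ltW.
set S := \sum_(k < n) _; set x := (c / r) ^+ n; move=> x0 hx.
by rewrite mulrC; lra.
Qed.

Definition mertN N : R := \sum_(n < N.+1) mobR n.

Lemma abel_mertN c N : mertN N = Bp c N * N.+1%:R `^ (- c) +
  \sum_(j < N) Bp c j * (j.+1%:R `^ (- c) - j.+2%:R `^ (- c)).
Proof.
have E n : mobR n = mobR n * n.+1%:R `^ c * n.+1%:R `^ (- c).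
  by rewrite -mulrA -powRD ?subrr ?powRr0 ?mulr1 // pnatr_eq0 implybT.
elim: N => [|N IH].
  by rewrite /mertN /Bp !big_ord1 big_ord0 addr0 -E.
rewrite /mertN big_ord_recr /= -/(mertN N) IH [in RHS]big_ord_recr /= [in LHS](E N.+1).
by rewrite /Bp [in RHS]big_ord_recr /=; ring.
Qed.

Lemma powR_diff_le c j : 0 < c ->
  0 <= (j.+1%:R : R) `^ (- c) - j.+2%:R `^ (- c) <= c * j.+1%:R `^ (- c - 1).
Proof.
move=> c0; apply/andP; split.
  by rewrite subr_ge0 !powRN lef_pV2 ?posrE ?powR_gt0 // ge0_ler_powR ?nnegrE ?ler_nat // ltW.
have j0 : 0 < (j.+1%:R : R) by [].
have E : (j.+2%:R : R) = j.+1%:R * (1 + j.+1%:R^-1).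
  by rewrite mulrDr mulr1 divff ?gt_eqF // natr1.
have E2 : (j.+1%:R : R) `^ (- c - 1) = j.+1%:R `^ (- c) * j.+1%:R^-1.
  by rewrite powRD ?pnatr_eq0 ?implybT // powR_inv1.
have i0 : 0 < 1 + (j.+1%:R : R)^-1 by rewrite addr_gt0 // invr_gt0.
rewrite E (powRM _ (ltW j0) (ltW i0)) -[X in X - _]mulr1 -mulrBr E2.
rewrite [leRHS]mulrCA ler_wpM2l ?powR_ge0 //.
rewrite /powR (gt_eqF i0).
have := expR_ge1Dx (- c * ln (1 + j.+1%:R^-1)).
have i2 : - 2^-1 <= (j.+1%:R : R)^-1 by apply: le_trans (_ : 0 <= _); rewrite ?invr_ge0 // oppr_le0.
have /andP[_] := ln1D_bounds i2.
move=> h1 h2; have : c * ln (1 + j.+1%:R^-1) <= c * j.+1%:R^-1 by rewrite ler_pM2l.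
by move: h2; rewrite mulNr => h2 h3; rewrite lerBlDl -lerBlDr; apply: le_trans h2; rewrite lerD2l lerN2.
Qed.

(** After interchanging the sums this is the tail estimate [sum_(N > j) (N + 1) ^ (- 1 - s) <= (j +
    1) ^ (- s) / s]. The induction carries the boundary term in [D Y], which absorbs each new
    summand by [zeta_step]. *)
Lemma tail_by_parts (d : nat -> R) s Y : 0 < s -> (forall j, 0 <= d j) ->
  \sum_(N < Y) N.+1%:R `^ (- 1 - s) * \sum_(j < N) d j <= s^-1 * \sum_(j < Y) d j * j.+1%:R `^ (- s).
Proof.
move=> s0 d0; pose D N := \sum_(j < N) d j.
have D0 N : 0 <= D N by apply: sumr_ge0.
suff : \sum_(N < Y.+1) N.+1%:R `^ (- 1 - s) * D N + s^-1 * (Y.+1%:R `^ (- s) * D Y) <=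
    s^-1 * \sum_(j < Y) d j * j.+1%:R `^ (- s).
  apply: le_trans; rewrite big_ord_recr /= -addrA lerDl addr_ge0 ?mulr_ge0 ?powR_ge0 ?invr_ge0 ?(ltW s0) //.
elim: Y => [|Y IH].
  by rewrite big_ord1 !big_ord0 /D big_ord0 !mulr0 addr0.
rewrite big_ord_recr [X in _ <= _ * X]big_ord_recr /= mulrDr.
apply: le_trans _ (lerD IH (lexx _)).
rewrite -[leLHS]addrA -[leRHS]addrA lerD2l.
have s1 : 1 < 1 + s by rewrite ltrDl.
have := zeta_step Y s1.
rewrite (_ : 1 + s - 1 = s); last by ring.
rewrite (_ : 1 - (1 + s) = - s); last by ring.
rewrite opprD => h.
rewrite -mulrDr (_ : Y.+1%:R `^ (- s) * _ + d Y * Y.+1%:R `^ (- s) = Y.+1%:R `^ (- s) * D Y.+1); last first.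
  by rewrite /D big_ord_recr /=; ring.
rewrite -(ler_pM2l s0) mulrDr !mulrA divff ?gt_eqF // !mul1r -mulrDl ler_wpM2r //.
by move: h; set x := _ `^ (- 1 - s); set y := _ `^ (- s); set z := _ `^ (- s); lra.
Qed.

Lemma mean_mertN a s : 0 < a < 1 -> a < s < 1 -> 
  (forall s : R[i], a < complex.Re s -> zf s != 0) ->
  exists2 C : R, 0 < C & forall n, \sum_(N < n) `|mertN N| / N.+1%:R <= C * n%:R `^ s.
Proof.
move=> a01 /andP[as_ s1] nz; have /andP[a0 a1] := a01.
(* Chosen so that [c < r < 2 - a], [e > 0] and [3 + e = c + (1 + s)]; the weight of [mean_Bp] then
   splits into the Abel factor [N ^ (- c)] and [N ^ (- 1 - s)]. *)
pose c := 2 - (a + s) / 2; pose r := 2 - (3 * a + s) / 4; pose e := (s - a) / 2.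
have c0 : 0 < c by rewrite /c; lra.
have e0 : 0 < e by rewrite /e; lra.
have s0 : 0 < s by lra.
have cr : 0 < c < r by rewrite c0 /c /r; lra.
have ra : r < 2 - a by rewrite /r; lra.
have [C C0 hC] := mean_Bp a01 cr ra e0 nz.
exists (C + s^-1 * (c * C)); first by rewrite addr_gt0 ?mulr_gt0 ?invr_gt0.
(* The sum of [|M N| N ^ (- 1 - s)] stays bounded; the factor [n ^ s] majorizes [N ^ s]. *)
move=> n; apply: (@le_trans _ _ ((\sum_(N < n) `|mertN N| * N.+1%:R `^ (- 1 - s)) * n%:R `^ s)).
  rewrite mulr_suml; apply: ler_sum => N _; rewrite -mulrA ler_wpM2l //.
  rewrite -powR_inv1 // -[X in _ `^ X <= _](subrK s (- 1)) powRD ?pnatr_eq0 ?implybT //.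
  by rewrite ler_wpM2l ?powR_ge0 // ge0_ler_powR ?nnegrE ?ler_nat ?(ltW s0).
rewrite ler_wpM2r ?powR_ge0 //.
pose d j := `|Bp c j| * (c * j.+1%:R `^ (- c - 1)).
have d0 j : 0 <= d j by rewrite !mulr_ge0 ?powR_ge0 // ltW.
have ce : - (3 + e) = - c + (- 1 - s) by rewrite /c /e; field.
apply: (@le_trans _ _ (\sum_(N < n) (`|Bp c N| * N.+1%:R `^ (- (3 + e)) +
   N.+1%:R `^ (- 1 - s) * \sum_(j < N) d j))).
  apply: ler_sum => N _.
  have -> : `|Bp c N| * N.+1%:R `^ (- (3 + e)) + N.+1%:R `^ (- 1 - s) * (\sum_(j < N) d j) =
      (`|Bp c N| * N.+1%:R `^ (- c) + \sum_(j < N) d j) * N.+1%:R `^ (- 1 - s).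
    by rewrite ce (powRD (r := - c)) ?pnatr_eq0 ?implybT //; ring.
  rewrite ler_wpM2r ?powR_ge0 // (abel_mertN c); apply: le_trans (ler_normD _ _) _; apply: lerD.
    by rewrite normrM [`|_ `^ _|]ger0_norm ?powR_ge0.
  apply: le_trans (ler_norm_sum _ _ _) _; apply: ler_sum => j _.
  by have /andP[h1 h2] := powR_diff_le j c0; rewrite normrM ler_wpM2l // ger0_norm.
rewrite big_split /=; apply: lerD; first exact: hC.
apply: le_trans (tail_by_parts _ s0 d0) _; rewrite ler_pM2l ?invr_gt0 //.
apply: le_trans (ler_wpM2l (ltW c0) (hC n)); rewrite mulr_sumr.
apply: ler_sum => j _; rewrite /d ce (_ : - c + (- 1 - s) = - c - 1 + - s); last by ring.
rewrite le_eqVlt; apply/orP; left; apply/eqP.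
by rewrite (powRD (r := - c - 1)) ?pnatr_eq0 ?implybT //; ring.
Qed.

End MertensMean.

(** * The functions G n *)

Section BaezDuarteFunction.
Variable R : realType.
Implicit Types (x y a b theta : R).

Notation leb := (@lebesgue_measure R).

Variable n : nat.
Hypothesis n0 : (0 < n)%N.

Let D : set R := `[n%:R^-1, +oo[%classic.

Let np : 0 < (n%:R : R). Proof. by rewrite ltr0n. Qed.

Let ip : 0 < (n%:R : R)^-1. Proof. by rewrite invr_gt0. Qed.

Let DE theta : D theta -> n%:R^-1 <= theta.
Proof. by rewrite /D /= in_itv /= andbT. Qed.

Let mD : @measurable _ (measurableTypeR R) D. Proof. exact: measurable_itv. Qed.

(** Integrability travels with the value, so that linearity and monotonicity compose. *)
Definition has_int (f : R -> R) (v : R) :=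
  leb.-integrable D (EFin \o f) /\ (\int[leb]_(theta in D) f theta)%R = v.

Lemma has_int_ext f g v : {in D, f =1 g} -> has_int f v -> has_int g v.
Proof.
move=> fg [h1 h2]; split; last by rewrite -h2; apply: eq_Rintegral => y /fg ->.
by apply: eq_integrable h1 => // y /fg /= ->.
Qed.

Lemma has_intD f g v w : has_int f v -> has_int g w -> has_int (fun y => f y + g y) (v + w).
Proof.
move=> [f1 f2] [g1 g2]; split; last by rewrite RintegralD // f2 g2.
by have := integrableD mD f1 g1; apply: eq_integrable => // y _ /=.
Qed.

Lemma has_intZ c f v : has_int f v -> has_int (fun y => c * f y) (c * v).
Proof.
move=> [f1 f2]; split; last by rewrite RintegralZl // f2.
by have := integrableZl mD c f1; apply: eq_integrable => // y _ /=.
Qed.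

Lemma has_int0 : has_int (fun=> 0) 0.
Proof.
split; last by rewrite Rintegral_cst // mul0r.
exact: integrable0.
Qed.

Lemma has_int_sum m (f : nat -> R -> R) (v : nat -> R) : (forall k, has_int (f k) (v k)) ->
  has_int (fun y => \sum_(k < m) f k y) (\sum_(k < m) v k).
Proof.
move=> h; elim: m => [|m IH].
  rewrite big_ord0; apply: has_int_ext has_int0 => y _; by rewrite big_ord0.
rewrite big_ord_recr; apply: has_int_ext (has_intD IH (h m)) => y _.
by rewrite big_ord_recr.
Qed.

Lemma has_int_le f g v w : has_int f v -> has_int g w -> {in D, forall y, f y <= g y} -> v <= w.
Proof.
move=> [f1 <-] [g1 <-] h; apply: le_Rintegral => // y Dy; apply: h; exact: mem_set.
Qed.

Lemma has_int_restrict (f : R -> R) (A : set R) :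
  @measurable _ (measurableTypeR R) A ->
  leb.-integrable (D `&` A) (EFin \o f) ->
  has_int (f \_ A) (\int[leb]_(theta in D `&` A) f theta)%R.
Proof.
move=> mA h; split; last by rewrite Rintegral_mkcondr.
apply/(integrable_mkcond _ mD); move/(integrable_mkcond _ (measurableI _ _ mD mA)): h.
by rewrite -restrict_EFin -patch_setI setIC.
Qed.

Lemma has_int_cst b : n%:R^-1 <= b -> has_int ((cst 1 : R -> R) \_ `[n%:R^-1, b]) (b - n%:R^-1).
Proof.
move=> nb; have DA : D `&` `[n%:R^-1, b] = `[n%:R^-1, b]%classic.
  apply/seteqP; split => y /=; first by case.
  by rewrite /D /= !in_itv /= andbT => /andP[h1 h2]; rewrite h1 h2.
have mu_fin : leb `[n%:R^-1, b]%classic = (b - n%:R^-1)%:E.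
  rewrite lebesgue_measure_itv /= lte_fin; case: ltP => // bn.
  have -> : b = n%:R^-1 by apply/eqP; rewrite eq_le bn nb.
  by rewrite subrr.
have := @has_int_restrict (cst 1) `[n%:R^-1, b]%classic (measurable_itv _).
rewrite DA Rintegral_cst // (_ : fine _ = b - n%:R^-1); last by rewrite -[RHS]/(fine (_%:E)) -mu_fin.
rewrite mul1r; apply.
apply: (@continuous_compact_integrable R); first exact: segment_compact.
apply: continuous_subspaceT; exact: cst_continuous.
Qed.

(* The value [Num.max 0 _] accounts for empty intervals. *)
Lemma has_int_inv a b : n%:R^-1 <= a -> 0 < b ->
  has_int ((GRing.inv : R -> R) \_ `[a, b]) (Num.max 0 (ln b - ln a)).
Proof.
move=> na b0; have a0 : 0 < a by apply: lt_le_trans na.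
have DA : D `&` `[a, b] = `[a, b]%classic.
  apply/seteqP; split => y /=; first by case.
  rewrite /D /= !in_itv /= andbT => /andP[h1 h2]; rewrite h1 h2; split => //.
  exact: le_trans h1.
have cont : {within `[a, b], continuous (GRing.inv : R -> R)}.
  apply: continuous_in_subspaceT => y; rewrite inE /= in_itv /= => /andP[ay _].
  by apply: inv_continuous; rewrite gt_eqF // (lt_le_trans a0).
have intg : leb.-integrable `[a, b] (EFin \o (GRing.inv : R -> R)).
  by apply: continuous_compact_integrable => //; exact: segment_compact.
have := @has_int_restrict GRing.inv `[a, b]%classic (measurable_itv _).
rewrite DA => /(_ intg) [h1 h2]; split => //; rewrite h2.
have [ab|ba] := ltP a b; last first.
  have l : ln b - ln a <= 0 by rewrite subr_le0 ler_ln ?posrE.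
  rewrite max_l // /Rintegral.
  have [eab|nab] := eqVneq a b; first by rewrite eab set_itv1 integral_set1.
  rewrite set_itv_ge ?integral_set0 //= bnd_simp -ltNge lt_neqAle eq_sym nab ba //.
have l : 0 <= ln b - ln a by rewrite subr_ge0 ler_ln ?posrE // ltW.
rewrite max_r // /Rintegral (continuous_FTC2 (F := @ln R)) //.
- split.
  + move=> y; rewrite in_itv /= => /andP[ay _]; apply: ex_derive.
    by apply: is_derive1_ln; exact: lt_trans ay.
  + by apply: cvg_at_right_filter; apply: continuous_ln.
  + by apply: cvg_at_left_filter; apply: continuous_ln.
- move=> y; rewrite in_itv /= => /andP[ay _]; rewrite derive1E.
  by apply: derive_val; apply: is_derive1_ln; exact: lt_trans ay.
Qed.

Lemma M1_sum theta : D theta -> M1 theta = \sum_(k < n) (theta <= k.+1%:R^-1)%R%:R * mobR R k.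
Proof.
move=> /DE Dt; have t0 : 0 < theta by apply: lt_le_trans Dt.
rewrite /M1 /mertens big_add1 /= big_mkord -/(mobR R _).
have tn : (Num.truncn theta^-1 <= n)%N.
  rewrite truncn_le_nat; apply: le_lt_trans (_ : n%:R < _); last by rewrite ltr_nat.
  by rewrite -[leRHS]invrK lef_pV2 ?posrE.
rewrite (big_ord_widen _ (fun k => (mobius k.+1)%:~R) tn) big_mkcond /=.
apply: eq_bigr => k _; rewrite truncn_gt_nat.
have -> : (k.+1%:R <= theta^-1) = (theta <= k.+1%:R^-1).
  by rewrite -{2}[theta]invrK lef_pV2 ?posrE ?invr_gt0.
by case: ifP => _; rewrite ?mul1r ?mul0r.
Qed.

Lemma floor_sum J y : 0 <= y -> y < J.+1%:R ->
  (Num.floor y)%:~R = \sum_(j < J) (j.+1%:R <= y)%R%:R :> R.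
Proof.
move=> y0 yJ; have -> : (Num.floor y)%:~R = (Num.truncn y)%:R :> R.
  by rewrite truncn_floor y0 natr_absz ger0_norm // floor_ge0.
have yJ' : (Num.truncn y <= J)%N by rewrite truncn_le_nat.
transitivity (\sum_(j < Num.truncn y) (1 : R)); first by rewrite sumr_const card_ord.
rewrite (big_ord_widen _ (fun=> 1) yJ') big_mkcond /=; apply: eq_bigr => j _.
by rewrite truncn_gt_nat; case: ifP.
Qed.

(** [M1] and the integer part are sums of indicators, of [theta <= 1 / k] and of [j x <= theta]. As
    [M1] vanishes for [theta > 1], indices [j <= J] suffice, and the integral reduces to those of
    [1] and [1 / theta] over intervals. *)
Lemma G_integrand_sum J x theta : 0 < x -> x^-1 < J.+1%:R -> D theta ->
  M1 theta * rho (theta / x) / theta =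
  \sum_(k < n) mobR R k * (x^-1 * ((cst 1 : R -> R) \_ `[n%:R^-1, k.+1%:R^-1]) theta -
     \sum_(j < J) ((GRing.inv : R -> R) \_ `[j.+1%:R * x, k.+1%:R^-1]) theta).
Proof.
move=> x0 xJ Dt; have nt := DE Dt; have t0 : 0 < theta by apply: lt_le_trans nt.
rewrite M1_sum // -mulrA mulr_suml; apply: eq_bigr => k _; rewrite mulrAC mulrC; congr (_ * _).
rewrite /patch; have -> : (theta \in `[n%:R^-1, k.+1%:R^-1]%classic) = (theta <= k.+1%:R^-1).
  by apply/idP/idP; rewrite inE /= in_itv /= nt.
have [tk|tk] := boolP (theta <= _); last first.
  rewrite mul0r mulr0 big1 ?subr0 // => j _; case: ifP => //.
  by rewrite inE /= in_itv /= (negbTE tk) andbF.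
have t1 : theta <= 1 by apply: le_trans tk _; rewrite invf_le1 ?ler1n.
rewrite mul1r mulr1 /rho (@floor_sum J).
- rewrite mulrBl mulrAC divff ?gt_eqF // mul1r mulr_suml; congr (_ - _).
  apply: eq_bigr => j _; have -> : (theta \in `[j.+1%:R * x, k.+1%:R^-1]%classic) = (j.+1%:R <= theta / x).
    by rewrite ler_pdivlMr //; apply/idP/idP; rewrite inE /= in_itv /= tk andbT.
  by case: ifP; rewrite ?mul1r ?mul0r.
- by rewrite divr_ge0 // ltW.
- by apply: le_lt_trans xJ; rewrite ler_piMl // invr_ge0 ltW.
Qed.

Definition logp a b : R := Num.max 0 (ln b - ln (Num.max n%:R^-1 a)).

Lemma has_int_logp a b : 0 < b -> has_int ((GRing.inv : R -> R) \_ `[a, b]) (logp a b).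
Proof.
move=> b0; rewrite /logp; set a' := Num.max _ a.
apply: has_int_ext (@has_int_inv a' b _ b0); last by rewrite le_max lexx.
move=> y; rewrite inE => /DE ny; rewrite /patch.
have -> // : (y \in `[a', b]%classic) = (y \in `[a, b]%classic).
by apply/idP/idP; rewrite !inE /= !in_itv /= /a' ge_max ny.
Qed.

Lemma has_int_G J x : 0 < x -> x^-1 < J.+1%:R ->
  has_int (fun theta => M1 theta * rho (theta / x) / theta)
   (\sum_(k < n) mobR R k * (x^-1 * (k.+1%:R^-1 - n%:R^-1) -
     \sum_(j < J) logp (j.+1%:R * x) k.+1%:R^-1)).
Proof.
move=> x0 xJ.
have nk (k : 'I_n) : (n%:R : R)^-1 <= k.+1%:R^-1 by rewrite lef_pV2 ?posrE // ler_nat.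
pose f (k : nat) (y : R) : R := if (k < n)%N then mobR R k * (x^-1 * ((cst 1 : R -> R) \_ `[n%:R^-1, k.+1%:R^-1]) y -
     \sum_(j < J) ((GRing.inv : R -> R) \_ `[j.+1%:R * x, k.+1%:R^-1]) y) else 0.
pose v (k : nat) : R := if (k < n)%N then mobR R k * (x^-1 * (k.+1%:R^-1 - n%:R^-1) -
     \sum_(j < J) logp (j.+1%:R * x) k.+1%:R^-1) else 0.
have h k : has_int (f k) (v k).
  rewrite /f /v; case: ltnP => [kn|_]; last exact: has_int0.
  apply: has_intZ; apply: has_intD.
    by apply: has_intZ; apply: has_int_cst; exact: (nk (Ordinal kn)).
  rewrite -mulN1r; apply: has_int_ext (has_intZ (-1) (@has_int_sum J (fun j => (GRing.inv : R -> R) \_ `[j.+1%:R * x, k.+1%:R^-1]) (fun j => logp (j.+1%:R * x) k.+1%:R^-1) _)).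
    by move=> y _; rewrite mulN1r.
  by move=> j; apply: has_int_logp; rewrite invr_gt0.
have := has_int_sum n h; rewrite (eq_bigr (fun k : 'I_n => mobR R k * (x^-1 * (k.+1%:R^-1 - n%:R^-1) -
     \sum_(j < J) logp (j.+1%:R * x) k.+1%:R^-1))); last by move=> k _; rewrite /v ltn_ord.
apply: has_int_ext => y; rewrite inE => Dy; rewrite (G_integrand_sum x0 xJ Dy).
by apply: eq_bigr => k _; rewrite /f ltn_ord.
Qed.

Lemma has_intE f v : has_int f v -> (\int[leb]_(theta in D) f theta)%R = v.
Proof. by case. Qed.

(** [|rho| <= 1], and for [1 / (N + 2) < theta <= 1 / (N + 1)] the function [M1] equals [mertN N],
    while [d theta / theta] has mass [ln (1 + 1 / (N + 1)) <= 1 / (N + 1)]. *)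
Lemma G_bound x : 0 < x -> `|G n x| <= \sum_(N < n) `|mertN R N| / N.+1%:R.
Proof.
move=> x0; have [v hv] : exists v, has_int (fun theta => M1 theta * rho (theta / x) / theta) v.
  have xJ : x^-1 < (Num.truncn x^-1).+1%:R by exact: truncnS_gt.
  by eexists; apply: (has_int_G x0 xJ).
rewrite /G (has_intE hv).
pose h (N : nat) (y : R) : R := if (N < n)%N then `|mertN R N| * ((GRing.inv : R -> R) \_ `[N.+2%:R^-1, N.+1%:R^-1]) y else 0.
have hN N : exists w, has_int (h N) w /\ ((N < n)%N -> w <= `|mertN R N| / N.+1%:R).
  rewrite /h; case: ltnP => [Nn|_]; last by exists 0; split => //; exact: has_int0.
  exists (`|mertN R N| * logp N.+2%:R^-1 N.+1%:R^-1); split.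
    by apply: has_intZ; apply: has_int_logp; rewrite invr_gt0.
  move=> _; rewrite ler_wpM2l // /logp ge_max invr_ge0 ler0n /=.
  apply: (@le_trans _ _ (ln N.+1%:R^-1 - ln N.+2%:R^-1)).
    have mp : 0 < Num.max (n%:R : R)^-1 N.+2%:R^-1 by rewrite lt_max ip.
    by rewrite lerD2l lerN2 ler_ln ?posrE ?invr_gt0 // le_max lexx orbT.
  rewrite !lnV ?posrE // opprK addrC -ln_div ?posrE //.
  have -> : N.+2%:R / N.+1%:R = 1 + N.+1%:R^-1 :> R.
    by rewrite -[N.+2%:R]natr1 mulrDl divff ?mul1r // gt_eqF.
  have i2 : - 2^-1 <= (N.+1%:R : R)^-1 by apply: le_trans (_ : 0 <= _); rewrite ?invr_ge0 // oppr_le0.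
  by have /andP[] := ln1D_bounds i2.
have [w hw] := choice hN.
have hs := @has_int_sum n h w (fun N => (hw N).1).
have pw : {in D, forall y, `|M1 y * rho (y / x) / y| <= \sum_(k < n) h k y}.
  move=> y; rewrite inE => Dy; have ny := DE Dy; have y0 : 0 < y by apply: lt_le_trans ny.
  have h0 (k : nat) : 0 <= h k y.
    rewrite /h; case: ifP => // _; rewrite mulr_ge0 // /patch; case: ifP => //.
    by rewrite invr_ge0 ltW.
  rewrite !normrM normfV (gtr0_norm y0).
  have rho1 : `|rho (y / x)| <= 1.
    by rewrite /rho ger0_norm ?subr_ge0 ?floor_le // lerBlDl -intrD1 ltW // floorD1_gt.
  apply: (@le_trans _ _ (`|M1 y| / y)).
    by rewrite ler_wpM2r ?invr_ge0 ?(ltW y0) // ler_piMr.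
  have [y1|y1] := ltP 1 y.
    rewrite /M1 /mertens big_geq ?normr0 ?mul0r ?sumr_ge0 //.
    by rewrite ltnS truncn_le_nat invf_lt1.
  pose N := (Num.truncn y^-1).-1.
  have yi1 : 1 <= y^-1 by rewrite invf_ge1.
  have tr : (0 < Num.truncn y^-1)%N by rewrite truncn_gt0.
  have NE : N.+1 = Num.truncn y^-1 by rewrite /N prednK.
  have /andP[t1 t2] := truncn_itv (le_trans ler01 yi1).
  have Nn : (N < n)%N.
    rewrite /N -ltnS prednK // ltnS truncn_le_nat; apply: le_lt_trans (_ : n%:R < _); last by rewrite ltr_nat.
    by rewrite -[leRHS]invrK lef_pV2 ?posrE.
  rewrite (bigD1 (Ordinal Nn)) //= -[leLHS]addr0; apply: lerD; last by apply: sumr_ge0.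
  have -> : M1 y = mertN R N.
    by rewrite /M1 /mertens -NE big_add1 big_mkord.
  rewrite /h Nn /patch ifT // inE /= in_itv /=; apply/andP; split.
    by rewrite -[leRHS]invrK lef_pV2 ?posrE ?invr_gt0 // NE ltW.
  by rewrite -[leLHS]invrK lef_pV2 ?posrE ?invr_gt0 // NE.
apply: (@le_trans _ _ (\sum_(k < n) w k)); last first.
  by apply: ler_sum => k _; apply: (hw k).2.
rewrite ler_norml; apply/andP; split.
  rewrite -mulN1r; apply: has_int_le (has_intZ (-1) hs) hv _ => y Dy.
  by rewrite mulN1r; have := pw y Dy; rewrite ler_norml => /andP[].
by apply: has_int_le hv hs _ => y Dy; have := pw y Dy; rewrite ler_norml => /andP[].
Qed.

(** For [x >= 1 / n] the lower limit does not cut the logarithmic integrals, which become [F (k j)]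
    with [F m = max 0 (- ln (m x))]. As [F] vanishes from [n] on, Moebius inversion up to [n] is
    exact and yields [F 1 = - lambda x]. The linear terms remain. *)
Lemma G_formula x : n%:R^-1 <= x -> G n x - lambda x = Tm R n.-1 / n%:R / x.
Proof.
move=> nx; have x0 : 0 < x by apply: lt_le_trans nx.
have xJ : x^-1 < n.+1%:R.
  apply: le_lt_trans (_ : n%:R < _); last by rewrite ltr_nat.
  by rewrite -[leRHS]invrK lef_pV2 ?posrE.
have [_] := has_int_G x0 xJ; rewrite -/(G n x) => ->.
pose F m : R := Num.max 0 (- ln (m%:R * x)).
have F0 m : 1 <= m%:R * x -> F m = 0.
  by move=> mx; rewrite /F max_l // oppr_le0 ln_ge0.
have FE k j : logp (j.+1%:R * x) k.+1%:R^-1 = F (k.+1 * j.+1)%N.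
  rewrite /logp /F (max_r (x := n%:R^-1)); last by rewrite (le_trans nx) // ler_peMl ?ler1n // ltW.
  by rewrite lnV ?posrE // -opprD -lnM ?posrE ?mulr_gt0 // natrM mulrA.
have E : \sum_(k < n) mobR R k * \sum_(j < n) F (k.+1 * j.+1)%N = - lambda x.
  transitivity (F 1%N).
    rewrite -(mobius_inversion F n0) big_add1 /= big_mkord; apply: eq_bigr => k _; congr (_ * _).
    rewrite [RHS]big_mkcond /= big_add1 /= big_mkord; apply: eq_bigr => j _.
    case: leqP => // h; apply: F0.
    apply: le_trans (_ : n%:R * x <= _); last by rewrite ler_wpM2r ?(ltW x0) // ler_nat ltnW.
    by rewrite -ler_pdivrMl // mulr1.
  rewrite /F mul1r /lambda indicE; have [x1|x1] := leP x 1.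
    rewrite mem_set ?mul1r /= ?in_itv /= ?x0 // max_r // oppr_ge0 ln_le0 //.
  rewrite memNset ?mul0r ?oppr0 /= ?in_itv /= ?x0 ?leNgt ?x1 // max_l // oppr_le0 ln_ge0 // ltW //.
under eq_bigr do (under eq_bigr do rewrite FE); under eq_bigr do rewrite mulrBr.
rewrite sumrB E opprK addrK /Tm.
have nE : n = n.-1.+1 by rewrite prednK.
rewrite -nE !mulr_suml; apply: eq_bigr => k _; rewrite -/(mobR R k).
by field; rewrite !gt_eqF.
Qed.

End BaezDuarteFunction.

(** * Norms *)

Section Norms.
Variable R : realType.
Implicit Types (x p r s : R) (f g : R -> R).

Notation leb := (@lebesgue_measure R).
Notation mset := (@measurable _ (measurableTypeR R)).

(* [ge0_le_integral] would require [G n] to be measurable. *)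
Lemma integral_mono (f g : R -> \bar R) : (forall x, (0 <= f x)%E) ->
  (forall x, (f x <= g x)%E) -> (\int[leb]_x f x <= \int[leb]_x g x)%E.
Proof.
move=> f0 fg; have g0 x : (0 <= g x)%E by apply: le_trans (fg x).
rewrite !ge0_integralTE //; apply: le_ereal_sup => _ [h hf <-]; exists h => // x.
exact: le_trans (hf x) (fg x).
Qed.

Lemma integral_step (a b : R) (A B : set R) (u v : R) : 0 <= a -> 0 <= b -> mset A -> mset B ->
  leb A = u%:E -> leb B = v%:E ->
  (\int[leb]_x (a * \1_A x + b * \1_B x)%:E = (a * u + b * v)%:E)%E.
Proof.
move=> a0 b0 mA mB uA vB.
have i1 (c : R) (C : set R) (w : R) : 0 <= c -> mset C -> leb C = w%:E ->
    (\int[leb]_x (c * \1_C x)%:E = (c * w)%:E)%E.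
  move=> c0 mC wC; under eq_integral do rewrite EFinM.
  rewrite ge0_integralZl_EFin //.
  - by rewrite integral_indic // setIT EFinM; congr (_ * _)%E.
  - by apply/measurable_EFinP; exact: measurable_indic.
under eq_integral do rewrite EFinD.
rewrite ge0_integralD //.
- by rewrite (i1 a A u) // (i1 b B v).
- by move=> x _; rewrite lee_fin mulr_ge0.
- by apply/measurable_EFinP; apply: measurable_funM => //; exact: measurable_indic.
- by move=> x _; rewrite lee_fin mulr_ge0.
- by apply/measurable_EFinP; apply: measurable_funM => //; exact: measurable_indic.
Qed.

(** Two sequences of pieces are provided because the functions to be bounded have one regime towards
    infinity and another towards 0. *)
Lemma integral_le_steps (f : R -> \bar R) (a b u v : nat -> R) (A B : nat -> set R) (U : R) :
  (forall x, (0 <= f x)%E) -> (forall k, 0 <= a k) -> (forall k, 0 <= b k) ->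
  (forall k, mset (A k)) -> (forall k, mset (B k)) ->
  (forall k, leb (A k) = (u k)%:E) -> (forall k, leb (B k) = (v k)%:E) ->
  (forall x, [\/ f x = 0%E, exists2 k, A k x & (f x <= (a k)%:E)%E |
     exists2 k, B k x & (f x <= (b k)%:E)%E]) ->
  (forall m, \sum_(k < m) (a k * u k + b k * v k) <= U) ->
  (\int[leb]_x f x <= U%:E)%E.
Proof.
move=> f0 a0 b0 mA mB uA vB cover sumU.
pose h k x : \bar R := (a k * \1_(A k) x + b k * \1_(B k) x)%:E.
have h0 k x : (0 <= h k x)%E by rewrite lee_fin addr_ge0 // mulr_ge0.
apply: (@le_trans _ _ (\int[leb]_x (\sum_(0 <= k <oo) h k x))%E).
  apply: integral_mono => // x.
  have one k : (h k x <= \sum_(0 <= k <oo) h k x)%E.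
    apply: le_trans (@nneseries_lim_ge R (h ^~ x) xpredT 0 k.+1 (fun k _ _ => h0 k x)).
    by rewrite big_nat_recr //= leeDr // sume_ge0.
  case: (cover x) => [->|[k Ak fk]|[k Bk fk]].
  - by apply: nneseries_ge0.
  - apply: le_trans (one k); apply: le_trans fk _; rewrite lee_fin indicE mem_set // mulr1.
    by rewrite lerDl mulr_ge0.
  - apply: le_trans (one k); apply: le_trans fk _; rewrite lee_fin [\1_(B k) x]indicE mem_set // mulr1.
    by rewrite lerDr mulr_ge0.
rewrite integral_nneseries //; last first.
  move=> k; apply/measurable_EFinP; apply: measurable_funD.
    by apply: measurable_funM => //; exact: measurable_indic.
  by apply: measurable_funM => //; exact: measurable_indic.
apply: lime_le.
  by apply: is_cvg_nneseries => k _ _; apply: integral_ge0.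
apply: nearW => m /=; rewrite big_mkord.
rewrite (eq_bigr (fun k : 'I_m => (a k * u k + b k * v k)%:E)); last first.
  by move=> k _; exact: integral_step.
by rewrite sumEFin lee_fin; exact: sumU.
Qed.

Lemma Lp_normE r f : 0 < r ->
  Lp_norm r f = ((\int[leb]_x (if (0 < x)%R then (`|f x| `^ r)%:E else 0)) `^ r^-1)%E.
Proof.
move=> r0; rewrite /Lp_norm unlock; congr (_ `^ _)%E; apply: eq_integral => x _.
rewrite /patch; have -> : (x \in `]0, +oo[%classic) = (0 < x).
  by apply/idP/idP; rewrite inE /= in_itv /= andbT.
case: ifP => _; first by rewrite -poweR_EFin.
by rewrite abse0 poweR_EFin powR0 // gt_eqF.
Qed.

Lemma Lp_norm_ge_0 r f : (0 <= Lp_norm r f)%E.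
Proof. exact: Lnorm_ge0. Qed.

Lemma Lp_norm_le r f (U : R) : 0 < r -> 0 <= U ->
  (\int[leb]_x (if (0 < x)%R then (`|f x| `^ r)%:E else 0) <= U%:E)%E ->
  (Lp_norm r f <= (U `^ r^-1)%:E)%E.
Proof.
move=> r0 U0 h; rewrite Lp_normE // -poweR_EFin; apply: gt0_ler_poweR => //.
- by rewrite invr_ge0 ltW.
- rewrite in_itv /= leey andbT; apply: integral_ge0 => x _.
  by case: ifP => // _; rewrite lee_fin powR_ge0.
- by rewrite in_itv /= leey andbT lee_fin.
Qed.

(** The interval [[1 / n, 2 / n]] suffices: it has length [1 / n], and there [|G n - lambda| = |Tm|
    / (n x) >= |Tm| / 2] by [G_formula]. *)
Lemma Tm_le_norm n p : (0 < n)%N -> 1 < p ->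
  ((`|Tm R n.-1| / 2 * n%:R `^ (- p^-1))%:E <= Lp_norm p (fun x => (G n x - lambda x)%R))%E.
Proof.
move=> n0 p1; have p0 : 0 < p by lra.
have np : 0 < (n%:R : R) by rewrite ltr0n.
set T := `|Tm R n.-1| / 2; have T0 : 0 <= T by rewrite divr_ge0.
pose A : set R := `[n%:R^-1, 2 / n%:R]%classic.
have mA : mset A by exact: measurable_itv.
have lA : leb A = (n%:R^-1)%:E.
  rewrite /A lebesgue_measure_itv /= lte_fin ltr_pMl ?invr_gt0 // ltr1n -EFinB; congr (_%:E).
  by rewrite -{2}[n%:R^-1]mul1r -mulrBl (_ : 2 - 1 = 1) ?mul1r //; lra.
rewrite Lp_normE //.
have -> : T * n%:R `^ (- p^-1) = (T `^ p * n%:R^-1) `^ p^-1.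
  rewrite powRM ?powR_ge0 ?invr_ge0 // -powRrM divff ?gt_eqF // powRr1 //.
  by rewrite -(powR_inv1 (ltW np)) -powRrM mulN1r.
rewrite -poweR_EFin; apply: gt0_ler_poweR.
- by rewrite invr_ge0 ltW.
- by rewrite in_itv /= leey andbT lee_fin mulr_ge0 ?powR_ge0 // invr_ge0.
- rewrite in_itv /= leey andbT; apply: integral_ge0 => x _.
  by case: ifP => // _; rewrite lee_fin powR_ge0.
have <- : (\int[leb]_x (T `^ p * \1_A x + 0 * \1_set0 x)%:E = (T `^ p * n%:R^-1)%:E)%E.
  rewrite (@integral_step _ _ _ _ n%:R^-1 0) ?powR_ge0 // ?mul0r ?addr0 //.
  exact: measure0.
apply: integral_mono => x.
  by rewrite lee_fin mul0r addr0 mulr_ge0 ?powR_ge0.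
rewrite mul0r addr0 indicE; case: (boolP (x \in A)) => [|_]; last first.
  by rewrite mulr0; case: ifP => // _; rewrite lee_fin powR_ge0.
rewrite inE /A /= in_itv /= => /andP[x1 x2].
have x0 : 0 < x by apply: lt_le_trans x1; rewrite invr_gt0.
rewrite x0 mulr1 lee_fin; apply: ge0_ler_powR; rewrite ?nnegrE ?(ltW p0) //.
rewrite (G_formula n0 x1) !normrM !normfV (gtr0_norm np) (gtr0_norm x0) /T -!mulrA ler_wpM2l //.
rewrite -invfM lef_pV2 ?posrE ?mulr_gt0 //.
by rewrite mulrC -ler_pdivlMr.
Qed.

Lemma ln_le_powR y s : 0 < y -> 0 < s -> ln y <= y `^ s / s.
Proof.
move=> y0 s0; rewrite ler_pdivlMr // mulrC; have := expR_ge1Dx (s * ln y).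
rewrite /powR gt_eqF //; lra.
Qed.

(** For [x <= 1 / n] the functions [G n] and [lambda] are bounded separately. For [x >= 1 / n] their
    difference is a multiple of [1 / x], hence determined by its value at [1 / n], which the first
    case bounds. *)
Lemma G_lambda_bound a s : 0 < a < 1 -> a < s < 1 ->
  (forall z : R[i], a < complex.Re z -> zf z != 0) ->
  exists2 D : R, 0 < D & forall n x, (0 < n)%N -> 0 < x ->
    (x <= n%:R^-1 -> `|G n x - lambda x| <= D * (x^-1) `^ s) /\
    (n%:R^-1 <= x -> `|G n x - lambda x| <= D * n%:R `^ s / (n%:R * x)).
Proof.
move=> a01 as1 nz; have [C C0 hC] := mean_mertN a01 as1 nz.
have s0 : 0 < s by case/andP: a01 as1 => ? _ /andP[? _]; lra.
have D0 : 0 < C + s^-1 by rewrite addr_gt0 // invr_gt0.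
exists (C + s^-1) => // n x n0 x0.
have np : 0 < (n%:R : R) by rewrite ltr0n.
have part1 y : 0 < y -> y <= n%:R^-1 -> `|G n y - lambda y| <= (C + s^-1) * (y^-1) `^ s.
  move=> y0 yn; apply: le_trans (ler_normB _ _) _; rewrite mulrDl; apply: lerD.
    apply: le_trans (G_bound n0 y0) _; apply: le_trans (hC n) _; rewrite ler_pM2l //.
    apply: ge0_ler_powR; rewrite ?nnegrE ?invr_ge0 ?(ltW s0) ?(ltW y0) //.
    by rewrite -[leLHS]invrK lef_pV2 ?posrE ?invr_gt0.
  have y1 : y <= 1 by apply: le_trans yn _; rewrite invf_le1 ?ler1n.
  rewrite /lambda indicE mem_set /= ?in_itv /= ?y0 // mul1r.
  rewrite ler0_norm ?ln_le0 // -lnV ?posrE // mulrC; apply: ln_le_powR => //.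
  by rewrite invr_gt0.
split; first exact: part1.
move=> nx; rewrite (G_formula n0 nx) !normrM !normfV (gtr0_norm np) (gtr0_norm x0) invfM.
rewrite -mulrA ler_wpM2r ?mulr_ge0 ?invr_ge0 ?(ltW np) ?(ltW x0) //.
have in0 : 0 < (n%:R : R)^-1 by rewrite invr_gt0.
have := part1 _ in0 (lexx _); rewrite (G_formula n0 (lexx _)) invrK divfK ?gt_eqF //.
Qed.

End Norms.

(** * Upper bound for the norm, and the theorem *)

Section Limits.
Variable R : realType.
Implicit Types (x p r s : R).

Notation leb := (@lebesgue_measure R).

Lemma powRN_cvg0 (C d : R) : 0 < C -> 0 < d ->
  (fun n : nat => C * n%:R `^ (- d)) @ \oo --> (0 : R).
Proof.
move=> C0 d0; apply/cvgrPdist_le => e e0.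
pose N := (Num.truncn ((C / e) `^ d^-1)).+1.
exists N => // n /= Nn; have n0 : 0 < (n%:R : R) by rewrite ltr0n (leq_trans _ Nn).
rewrite sub0r normrN ger0_norm ?mulr_ge0 ?powR_ge0 ?(ltW C0) //.
rewrite powRN ler_pdivrMr ?powR_gt0 // mulrC -ler_pdivrMr //.
have h : (C / e) `^ d^-1 <= n%:R.
  by apply: ltW; apply: lt_le_trans (truncnS_gt _) _; rewrite ler_nat.
rewrite -[leLHS](_ : ((C / e) `^ d^-1) `^ d = _); last first.
  by rewrite -powRrM mulVf ?gt_eqF // powRr1 // divr_ge0 // ltW.
by apply: ge0_ler_powR; rewrite ?nnegrE ?powR_ge0 ?(ltW d0).
Qed.

Section Upper.
Variables (r s D : R) (f : R -> R) (n : nat).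
Hypothesis r1 : 1 < r.
Hypothesis s0 : 0 < s.
Hypothesis sr : s * r < 1.
Hypothesis D0 : 0 < D.
Hypothesis n0 : (0 < n)%N.
Hypothesis small : forall x, 0 < x -> x <= n%:R^-1 -> `|f x| <= D * (x^-1) `^ s.
Hypothesis large : forall x, n%:R^-1 <= x -> `|f x| <= D * n%:R `^ s / (n%:R * x).

(** The bounds of [zeta_psum] at the exponents [r], for large [x], and [2 - s r], for small [x]. *)
Let Z := (1 + (r - 1)^-1) + (1 + (1 - s * r)^-1).

(* On [k+1, k+2) / n and (1/(n(k+2)), 1/(n(k+1))] the bounds are replaced by
   their suprema. *)
Lemma Lp_norm_small_large :
  (Lp_norm r f <= ((D `^ r * Z) `^ r^-1 * n%:R `^ (- ((1 - s * r) / r)))%:E)%E.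
Proof.
have r1' := r1; have sr' := sr; have r0 : 0 < r by lra.
have np : 0 < (n%:R : R) by rewrite ltr0n.
have sr0 : 0 < 1 - s * r by lra.
have r10 : 0 < r - 1 by lra.
have Z0 : 0 <= Z by rewrite /Z !addr_ge0 ?invr_ge0 // ltW.
pose a (k : nat) := (D * n%:R `^ s / k.+1%:R) `^ r.
pose b (k : nat) := (D * (n%:R * k.+2%:R) `^ s) `^ r.
pose A (k : nat) : set R := `[k.+1%:R / n%:R, k.+2%:R / n%:R[%classic.
pose B (k : nat) : set R := `](n%:R * k.+2%:R)^-1, (n%:R * k.+1%:R)^-1]%classic.
pose v (k : nat) : R := (n%:R * k.+1%:R)^-1 - (n%:R * k.+2%:R)^-1.
have -> : (D `^ r * Z) `^ r^-1 * n%:R `^ (- ((1 - s * r) / r)) =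
    (D `^ r * n%:R `^ (s * r - 1) * Z) `^ r^-1.
  rewrite [in RHS]mulrAC [RHS]powRM ?mulr_ge0 ?powR_ge0 // -[in RHS]powRrM; congr (_ * _ `^ _).
  by rewrite -mulNr opprB.
apply: Lp_norm_le => //; first by rewrite !mulr_ge0 ?powR_ge0.
apply: (@integral_le_steps R _ a b (fun=> n%:R^-1) v A B).
- by move=> x; case: ifP => // _; rewrite lee_fin powR_ge0.
- by move=> k; exact: powR_ge0.
- by move=> k; exact: powR_ge0.
- by move=> k; exact: measurable_itv.
- by move=> k; exact: measurable_itv.
- move=> k; rewrite /A lebesgue_measure_itv /= lte_fin ltr_pM2r ?invr_gt0 // ltr_nat ltnSn.
  by rewrite -EFinB -mulrBl -natrB // subSnn mul1r.
- move=> k; rewrite /B lebesgue_measure_itv /= lte_fin.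
  by rewrite ltf_pV2 ?posrE ?mulr_gt0 // ltr_pM2l // ltr_nat ltnSn -EFinB.
- move=> x; case: ltP => [x0|_]; last by apply: Or31.
  have [xn|nx] := leP x n%:R^-1.
    apply: Or33; pose y := (n%:R * x)^-1.
    have nx0 : 0 < n%:R * x by rewrite mulr_gt0.
    have y1 : 1 <= y by rewrite invf_ge1 // mulrC -ler_pdivlMr // mul1r.
    have tr : (0 < Num.truncn y)%N by rewrite truncn_gt0.
    have /andP[t1 t2] := truncn_itv (le_trans ler01 y1).
    have nyE : n%:R * y = x^-1 by rewrite /y invfM mulrA divff ?mul1r // gt_eqF.
    have y0 : 0 < y by rewrite invr_gt0.
    exists (Num.truncn y).-1; rewrite /B /b prednK //.
      rewrite /= in_itv /= -[x]invrK -nyE !ltf_pV2 ?lef_pV2 ?posrE ?mulr_gt0 ?ltr0n //.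
      by rewrite ltr_pM2l // ler_pM2l // t1 t2.
    rewrite lee_fin; apply: ge0_ler_powR; rewrite ?nnegrE ?(ltW r0) ?mulr_ge0 ?powR_ge0 ?(ltW D0) //.
    apply: le_trans (small x0 xn) _; rewrite ler_pM2l //.
    apply: ge0_ler_powR; rewrite ?nnegrE ?invr_ge0 ?(ltW s0) ?(ltW x0) ?mulr_ge0 //.
    by rewrite -nyE ler_pM2l // ltW.
  apply: Or32; pose y := n%:R * x.
  have y1 : 1 <= y by rewrite /y mulrC -ler_pdivrMr // mul1r ltW.
  have tr : (0 < Num.truncn y)%N by rewrite truncn_gt0.
  have /andP[t1 t2] := truncn_itv (le_trans ler01 y1).
  exists (Num.truncn y).-1; rewrite /A /a prednK //.
    by rewrite /= in_itv /= ler_pdivrMr // ltr_pdivlMr // [x * _]mulrC t1 t2.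
  rewrite lee_fin; apply: ge0_ler_powR; rewrite ?nnegrE ?(ltW r0) ?mulr_ge0 ?powR_ge0 ?invr_ge0 ?(ltW D0) //.
  apply: le_trans (large (ltW nx)) _; rewrite ler_wpM2l ?mulr_ge0 ?powR_ge0 ?(ltW D0) //.
  by rewrite lef_pV2 ?posrE ?ltr0n // mulr_gt0.
move=> m.
apply: (@le_trans _ _ (\sum_(k < m) D `^ r * n%:R `^ (s * r - 1) *
    (k.+1%:R `^ (- r) + k.+1%:R `^ (- (2 - s * r))))).
  apply: ler_sum => k _; rewrite [leRHS]mulrDr; apply: lerD.
    rewrite /a !powRM ?mulr_ge0 ?powR_ge0 ?invr_ge0 ?(ltW D0) // -powRrM -(powR_inv1 (ltW np)).
    rewrite -[k.+1%:R^-1]powR_inv1 // -powRrM mulN1r powRD ?(gt_eqF np) ?implybT //.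
    by rewrite le_eqVlt; apply/orP; left; apply/eqP; ring.
  rewrite /b !powRM ?mulr_ge0 ?powR_ge0 ?(ltW D0) // -!powRrM.
  have -> : v k = n%:R `^ (- 1) * (k.+1%:R * k.+2%:R)^-1.
    have e : k.+2%:R - k.+1%:R = 1 :> R by rewrite -natrB // subSnn.
    have k1 : (k.+1%:R : R) != 0 by rewrite pnatr_eq0.
    have k2 : (k.+2%:R : R) != 0 by rewrite pnatr_eq0.
    rewrite /v powR_inv1 ?(ltW np) // -[RHS]mulr1 -[X in _ = _ * X]e.
    move: k1 k2 {e}; move: (k.+1%:R : R) (k.+2%:R : R) => u w u0 w0.
    by field; rewrite u0 w0 gt_eqF.
  rewrite powRD ?(gt_eqF np) ?implybT //.
  rewrite (_ : _ * _ * _ = D `^ r * (n%:R `^ (s * r) * n%:R `^ (-1)) *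
     (k.+2%:R `^ (s * r) * (k.+1%:R * k.+2%:R)^-1)); last by ring.
  rewrite ler_wpM2l ?mulr_ge0 ?powR_ge0 //.
  rewrite invfM mulrCA -powR_inv1 // -(powR_inv1 (a := k.+2%:R)) //.
  rewrite -powRD ?pnatr_eq0 ?implybT //.
  rewrite (_ : - (2 - s * r) = - 1 + (s * r - 1)); last by ring.
  rewrite [leRHS]powRD ?pnatr_eq0 ?implybT // ler_wpM2l ?powR_ge0 //.
  rewrite -opprB !powRN lef_pV2 ?posrE ?powR_gt0 //.
  by apply: ge0_ler_powR; rewrite ?nnegrE ?ler_nat ?(ltW sr0).
rewrite -mulr_sumr ler_wpM2l ?mulr_ge0 ?powR_ge0 // big_split /=; apply: lerD.
  exact: zeta_psum.
have s2 : 1 < 2 - s * r by lra.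
by apply: le_trans (zeta_psum m s2) _; rewrite (_ : 2 - s * r - 1 = 1 - s * r) //; ring.
Qed.

End Upper.

End Limits.

Theorem theoremB (R : realType) (zeta : R[i] -> R[i])
    (hzeta : is_riemann_zeta zeta) (p : R) (hp : 1 < p) :
  ((forall s : R[i], s != 1 -> p^-1 < complex.Re s -> zeta s != 0) ->
    forall r : R, 1 < r -> r < p ->
      Lp_norm r (fun x => G n x - lambda x) @[n --> \oo] --> 0%E)
  /\
  (Lp_norm p (fun x => G n x - lambda x) @[n --> \oo] --> 0%E ->
    forall s : R[i], s != 1 -> p^-1 <= complex.Re s -> zeta s != 0).
Proof.
have p0 : 0 < p by lra.
have a01 : 0 < p^-1 < 1 by rewrite invr_gt0 p0 invf_lt1.
have a0 : 0 < p^-1 by rewrite invr_gt0.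
split=> [hz r r1 rp|hcv].
  have nz (z : R[i]) : p^-1 < complex.Re z -> zf z != 0.
    move=> hzr; have [->|z1] := eqVneq z 1; first by rewrite zf1 oner_eq0.
    rewrite (zf_eq hzeta) ?(lt_trans a0) // mulf_neq0 ?subr_eq0 //.
    exact: hz.
  have r0 : 0 < r by lra.
  have pr : p^-1 < r^-1 by rewrite ltf_pV2.
  have r11 : r^-1 < 1 by rewrite invf_lt1.
  (* Above [1 / p] for the bound on [I n], below [1 / r] so that [x ^ (- s)] is integrable to the
     power [r] near 0. *)
  pose s := (p^-1 + r^-1) / 2.
  have as1 : p^-1 < s < 1 by rewrite /s; lra.
  have sr : s * r < 1 by rewrite -ltr_pdivlMr // mul1r /s; lra.
  have s0 : 0 < s by rewrite /s; lra.
  have [D D0 hD] := G_lambda_bound a01 as1 nz.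
  set Z : R := (D `^ r * ((1 + (r - 1)^-1) + (1 + (1 - s * r)^-1))) `^ r^-1.
  have Z0 : 0 < Z.
    rewrite powR_gt0 // mulr_gt0 ?powR_gt0 // !addr_gt0 // invr_gt0; lra.
  have d0 : 0 < (1 - s * r) / r by rewrite divr_gt0 //; lra.
  apply: (@squeeze_cvge _ _ _ _ (fun=> 0%E) _ (fun n : nat => (Z * n%:R `^ (- ((1 - s * r) / r)))%:E)).
  - exists 1%N => // n /= n0; rewrite Lp_norm_ge_0 /=.
    apply: Lp_norm_small_large => // x.
      by move=> x0; exact: (hD n x n0 x0).1.
    move=> nx; have x0 : 0 < x by apply: lt_le_trans nx; rewrite invr_gt0 ltr0n.
    exact: (hD n x n0 x0).2.
  - exact: cvg_cst.
  - by apply: cvg_EFin; [exact: nearW|exact: powRN_cvg0].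
have key e : 0 < e -> exists N, forall n, (N <= n)%N -> `|Tm R n| <= e * n.+1%:R `^ p^-1.
  move=> e0; have e2 : 0 < e / 2 by rewrite divr_gt0.
  have nb : nbhs (0%:E : \bar R) [set y : \bar R | (y < (e / 2)%:E)%E].
    have : nbhs (0 : R) [set y | y < e / 2] by exact: lt_nbhsl.
    apply: filterS => y /=; by rewrite lte_fin.
  have [N _ hN] := hcv _ nb; exists N => n Nn.
  have /= h := hN n.+1 (leqW Nn).
  have := le_lt_trans (@Tm_le_norm R n.+1 p isT hp) h; rewrite lte_fin /= => h2.
  have w0 : 0 < (n.+1%:R : R) `^ (p^-1) by rewrite powR_gt0.
  move: h2; rewrite powRN -ltr_pdivlMr ?invr_gt0 // invrK.
  by rewrite ltr_pdivrMr // mulrAC divfK // => /ltW.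
have [N hN] := key 1 ltr01.
(* The bound with [e = 1] holds from [N] on; adding the first [N] values makes it hold for all
   [n]. *)
apply: (@zeta_neq0_closed R zeta hzeta p^-1 (1 + \sum_(k < N) `|Tm R k|)) => // n.
have w1 : 1 <= (n.+1%:R : R) `^ (p^-1).
  by rewrite -[leLHS](@powRr0 R n.+1%:R) ler_powR ?ler1n // ltW.
have S0 : 0 <= \sum_(k < N) `|Tm R k| by apply: sumr_ge0.
have [nN|nN] := leqP N n.
  apply: le_trans (hN n nN) _; rewrite ler_wpM2r ?powR_ge0 //; lra.
apply: (@le_trans _ _ (\sum_(k < N) `|Tm R k|)).
  by rewrite (bigD1 (Ordinal nN)) //= lerDl sumr_ge0.
apply: le_trans (_ : 1 + \sum_(k < N) `|Tm R k| <= _); first by rewrite lerDr.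
by rewrite ler_peMr // addr_ge0.
Qed.
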